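(* Let $\mathcal{G}$ be the group functor $A\mapsto \mathcal{G}(A)=$ group of continuous $A$-algebra automorphisms of $A((t))$, and let $\mathcal{G}_{\mathbb{Q}}$ and $\mathbb{G}_{m,\mathbb{Q}}$ be the restrictions of $\mathcal{G}$ and $\mathbb{G}_m$ to the category of commutative $\mathbb{Q}$-algebras. Let $\mathcal{G}_{\mathbb{Q}}$ act trivially on $\mathbb{G}_{m,\mathbb{Q}}$. Let $\hat{B}$ be the formal Bott-Thurston $2$-cocycle and let $D$ be the $2$-cocycle $D(f,g)=\det(d_f\, d_g\, d_{fg}^{-1})$ defining the determinantal central extension. Then in the group $H^2(\mathcal{G}_{\mathbb{Q}},\mathbb{G}_{m,\mathbb{Q}})$ the classes of these cocycles satisfy $$D^{12}=\hat{B}.$$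
   Context: All rings are commutative. A group functor is a covariant functor from commutative rings (or commutative $R$-algebras) to groups. **The group functor $\mathcal{G}$.** $A((t))=A[[t]][t^{-1}]$ has the topology in which the $A$-submodules $t^nA[[t]]$, $n\in\mathbb{Z}$, form a base of neighbourhoods of $0$. $\mathcal{G}(A)$ is the group of $A$-algebra automorphisms of $A((t))$ that are homeomorphisms, with composition as group law. An element $\varphi\in\mathcal{G}(A)$ is determined by $\widetilde{\varphi}=\varphi(t)$ via $\varphi(\sum a_it^i)=\sum a_i\widetilde{\varphi}^{\,i}$, and the series $\widetilde\varphi$ that occur are exactly those $\sum_{i\ge -n}a_it^i$ with $a_1\in A^*$ and $a_i$ nilpotent for all $i\le 0$. Functoriality in $A$ is by applying ring homomorphisms to the coefficients of $\widetilde\varphi$. For $f=\sum b_it^i\in A((t))$ write $f\circ\widetilde\varphi=\sum b_i\widetilde\varphi^{\,i}$; then $\widetilde{\varphi_1\varphi_2}=\widetilde{\varphi_2}\circ\widetilde{\varphi_1}$. **Cohomology of group functors.** For a group functor $G$ and a commutative group functor $F$ (on commutative $R$-algebras) with trivial action of $G$ on $F$, let $C^0(G,F)=F(R)$ and, for $k\ge1$, let $C^k(G,F)$ be the abelian group of morphisms of set-valued functors $G^{\times k}\to F$, with the usual bar differentials (multiplicative notation) $$\delta_qc(g_1,\dots,g_{q+1})=c(g_2,\dots,g_{q+1})\prod_{i=1}^q c(g_1,\dots,g_ig_{i+1},\dots,g_{q+1})^{(-1)^i}\, c(g_1,\dots,g_q)^{(-1)^{q+1}}.$$ $H^q(G,F)=\ker\delta_q/\operatorname{im}\delta_{q-1}$;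 elements of $\ker\delta_q$ are $q$-cocycles. Here $R=\mathbb{Q}$. **Contou-Carrère symbol.** For $f\in A((t))^*$ there is a unique decomposition $f=\prod_{i<0}(1-a_it^i)\cdot a_0\cdot t^{\nu(f)}\cdot\prod_{i>0}(1-a_it^i)$ with $\nu(f)$ a locally constant $\mathbb{Z}$-valued function on $\operatorname{Spec}A$, $a_0\in A^*$, $a_i$ nilpotent for $i<0$ and the product over $i<0$ finite (for a locally constant function $\underline n$, $t^{\underline n}$ and $a^{\underline n}$ are defined factor by factor on the corresponding finite product decomposition of $A$). If $g$ has the analogous decomposition with $b_j$, then, with $(i,j)$ denoting the greatest common divisor, $$\mathrm{CC}(f,g)=(-1)^{\nu(f)\nu(g)}\frac{a_0^{\nu(g)}\prod_{i>0}\prod_{j>0}\bigl(1-a_i^{j/(i,j)}b_{-j}^{i/(i,j)}\bigr)^{(i,j)}}{b_0^{\nu(f)}\prod_{i>0}\prod_{j>0}\bigl(1-a_{-i}^{j/(i,j)}b_{j}^{i/(i,j)}\bigr)^{(i,j)}}\in A^*$$ (only finitely many factors differ from $1$). It is bimultiplicative, antisymmetric and functorial in $A$. **$\hat{B}$.** $\hat{B}(\varphi_1,\varphi_2)=\mathrm{CC}(\widetilde{\varphi_1}',\ \widetilde{\varphi_2}'\circ\widetilde{\varphi_1})\in A^*$, where $'=\partial/\partial t$. It is a $2$-cocycle on $\mathcal{G}$ with coefficients in $\mathbb{G}_m$. **$D$.** For $h\in\mathcal{G}(A)$ let $d_h=\mathrm{pr}\circ h|_{A[[t]]}:A[[t]]\to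 A[[t]]$, where $\mathrm{pr}$ is the projection of $A((t))=t^{-1}A[t^{-1}]\oplus A[[t]]$ onto $A[[t]]$. Each $d_h$ is bijective. $D(f,g)=\det(d_fd_gd_{fg}^{-1})\in A^*$; the determinant makes sense because $d_fd_gd_{fg}^{-1}$ is an $A$-module automorphism of $A[[t]]$ equal to the identity on $t^nA[[t]]$ for some $n\ge 0$, and it is the determinant of the induced automorphism of $A[[t]]/t^nA[[t]]$. $D$ is a $2$-cocycle on $\mathcal{G}$ with coefficients in $\mathbb{G}_m$. *)

(* Defs.v *)
From HB Require Import structures.
From mathcomp Require Import all_boot all_order all_algebra.
From mathcomp Require Import zify.
From mathcomp Require Import boolp classical_sets functions cardinality fsbigop.
From mathcomp Require Import filter topology_structure.

Set Implicit Arguments.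
Unset Strict Implicit.
Unset Printing Implicit Defensive.

Import Order.TTheory GRing.Theory Num.Theory.
Local Open Scope classical_set_scope.
Local Open Scope ring_scope.

(** Rings are [comPzRingType]s, so that the zero ring is a ring. *)

(** ** Laurent series *)

Section Laurent.
Variable A : comPzRingType.

(** $A((t))$, a series being given by its coefficients. *)
Record laurent := Laurent {
  coef :> int -> A;
  coefP : exists N : int, forall i, i < N -> coef i = 0 }.

HB.instance Definition _ := gen_eqMixin laurent.
HB.instance Definition _ := gen_choiceMixin laurent.

Implicit Types (f g h : laurent) (i j n : int).

Lemma laurentP f g : (forall i, f i = g i) -> f = g.
Proof.
case: f g => [f fP] [g gP] /= fg; have {fg}E : f = g by apply/funext.
by subst g; rewrite (Prop_irrelevance fP gP).
Qed.

(** $t^n A[[t]]$ *)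
Definition tpow n : set laurent := [set f | forall i, i < n -> f i = 0].

Lemma tpow_le m n : n <= m -> tpow m `<=` tpow n.
Proof. by move=> le f Hf i lt; apply: Hf; exact: lt_le_trans le. Qed.

Lemma tpow_ex f : exists n, tpow n f. Proof. exact: coefP. Qed.

Definition iv (a : int) (K : nat) : seq int := [seq a + k%:Z | k <- iota 0 K].

Lemma iv_uniq a K : uniq (iv a K).
Proof. by rewrite map_inj_uniq ?iota_uniq// => x y; lia. Qed.

Lemma mem_iv a K i : (i \in iv a K) = (a <= i < a + K%:Z).
Proof.
apply/mapP/idP => [[k]|H]; first by rewrite mem_iota; lia.
by exists `|i - a|%N; rewrite ?mem_iota; lia.
Qed.

Lemma fsum_seq (V : nmodType) (F : int -> V) (s : seq int) : uniq s ->
  (forall i, i \notin s -> F i = 0) ->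
  \sum_(i \in setT) F i = \sum_(i <- s) F i.
Proof.
move=> us F0; rewrite (fsbigE s)//=; last by move=> i _; exact: F0.
by apply: eq_bigl => i; rewrite mem_set.
Qed.

Lemma fsum_iv (V : nmodType) (F : int -> V) a K :
  (forall i, ~~ (a <= i < a + K%:Z) -> F i = 0) ->
  \sum_(i \in setT) F i = \sum_(i <- iv a K) F i.
Proof.
by move=> F0; apply: fsum_seq (iv_uniq a K) _ => i; rewrite mem_iv; exact: F0.
Qed.

Lemma zero_subproof : exists N : int, forall i, i < N -> (0 : A) = 0.
Proof. by exists 0. Qed.
Definition laurent0 := Laurent zero_subproof.

Lemma add_subproof f g : exists N : int, forall i, i < N -> f i + g i = 0.
Proof.
case: (coefP f) (coefP g) => M HM [N HN]; exists (Num.min M N) => i.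
by rewrite lt_min => /andP[/HM-> /HN->]; rewrite addr0.
Qed.
Definition laurent_add f g := Laurent (add_subproof f g).

Lemma opp_subproof f : exists N : int, forall i, i < N -> - f i = 0.
Proof. by case: (coefP f) => N H; exists N => i /H ->; rewrite oppr0. Qed.
Definition laurent_opp f := Laurent (opp_subproof f).

Lemma laurent_addA : associative laurent_add.
Proof. by move=> f g h; apply: laurentP => i /=; rewrite addrA. Qed.
Lemma laurent_addC : commutative laurent_add.
Proof. by move=> f g; apply: laurentP => i /=; rewrite addrC. Qed.
Lemma laurent_add0 : left_id laurent0 laurent_add.
Proof. by move=> f; apply: laurentP => i /=; rewrite add0r. Qed.
Lemma laurent_addN : left_inverse laurent0 laurent_opp laurent_add.
Proof. by move=> f; apply: laurentP => i /=; rewrite addNr. Qed.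

HB.instance Definition _ := GRing.isZmodule.Build laurent
  laurent_addA laurent_addC laurent_add0 laurent_addN.

Lemma coef0 i : (0 : laurent) i = 0. Proof. by []. Qed.
Lemma coefD f g i : (f + g) i = f i + g i. Proof. by []. Qed.
Lemma coefN f i : (- f) i = - f i. Proof. by []. Qed.
Lemma coefB f g i : (f - g) i = f i - g i. Proof. by []. Qed.

Lemma tpow0 n : tpow n 0. Proof. by []. Qed.
Lemma tpowD n f g : tpow n f -> tpow n g -> tpow n (f + g).
Proof. by move=> Hf Hg i lt; rewrite coefD Hf// Hg// addr0. Qed.
Lemma tpowN n f : tpow n f -> tpow n (- f).
Proof. by move=> Hf i lt; rewrite coefN Hf// oppr0. Qed.
Lemma tpowB n f g : tpow n f -> tpow n g -> tpow n (f - g).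
Proof. by move=> Hf Hg; apply/tpowD/tpowN. Qed.

(** Only finitely many terms of this sum are nonzero. *)
Definition conv f g n : A := \sum_(i \in setT) f i * g (n - i).

Lemma convE a b f g n s : tpow a f -> tpow b g -> uniq s ->
  (forall i, a <= i <= n - b -> i \in s) ->
  conv f g n = \sum_(i <- s) f i * g (n - i).
Proof.
move=> Hf Hg us Hs; apply: fsum_seq us _ => i /negP nis.
have [lt|le] := ltP i a; first by rewrite Hf// mul0r.
have [le'|lt] := leP i (n - b); last by rewrite Hg ?mulr0//; lia.
by case: nis; apply: Hs; rewrite le.
Qed.

Lemma conv0 a b f g n : tpow a f -> tpow b g -> n < a + b -> conv f g n = 0.
Proof.
move=> Hf Hg lt; rewrite (convE (s := [::]) Hf Hg) ?big_nil// => i; lia.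
Qed.

Lemma mul_subproof f g : exists N : int, forall i, i < N -> conv f g i = 0.
Proof.
case: (tpow_ex f) (tpow_ex g) => a Hf [b Hg]; exists (a + b) => i.
exact: conv0.
Qed.
Definition laurent_mul f g := Laurent (mul_subproof f g).

Lemma mono_subproof n : exists N : int, forall i, i < N -> (i == n)%:R = 0 :> A.
Proof. by exists n => i lt; rewrite lt_eqF. Qed.

(** $t^n$ *)
Definition mono n : laurent := Laurent (mono_subproof n).

Lemma coef_mono n i : mono n i = (i == n)%:R. Proof. by []. Qed.

Lemma tpow_mono m n : m <= n -> tpow m (mono n).
Proof. by move=> le i lt; rewrite coef_mono lt_eqF//; lia. Qed.

Lemma laurent_mulC : commutative laurent_mul.
Proof.
move=> f g; apply: laurentP => n /=; rewrite /conv.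
rewrite (reindex_fsbigT (fun i : int => n - i)); last first.
  by exists (fun i => n - i) => i; lia.
by apply: eq_fsbigr => i _; rewrite mulrC; congr (g _ * _); lia.
Qed.

Lemma laurent_mul1 : left_id (mono 0) laurent_mul.
Proof.
move=> f; apply: laurentP => n /=; rewrite /conv (@fsum_seq _ _ [:: 0])//.
  by rewrite big_seq1 coef_mono eqxx mul1r subr0.
by move=> i; rewrite inE coef_mono => /negPf ->; rewrite mul0r.
Qed.

Lemma laurent_mulD : left_distributive laurent_mul +%R.
Proof.
move=> f g h; apply: laurentP => n /=.
have [a Hf] := tpow_ex f; have [b Hg] := tpow_ex g; have [c Hh] := tpow_ex h.
have le1 : Num.min a b <= a by lia.
have le2 : Num.min a b <= b by lia.
have Hf' := tpow_le le1 Hf; have Hg' := tpow_le le2 Hg.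
pose s := iv (Num.min a b) (absz (n - c + 1 - Num.min a b)%R).
have Hs i : Num.min a b <= i <= n - c -> i \in s by rewrite mem_iv; lia.
rewrite (convE (tpowD Hf' Hg') Hh (iv_uniq _ _) Hs).
rewrite (convE Hf' Hh (iv_uniq _ _) Hs) (convE Hg' Hh (iv_uniq _ _) Hs).
by rewrite -big_split /=; apply: eq_bigr => i _; rewrite -mulrDl.
Qed.

Lemma laurent_mulA : associative laurent_mul.
Proof.
move=> f g h; apply: laurentP => n /=.
have [a Hf] := tpow_ex f; have [b Hg] := tpow_ex g; have [c Hh] := tpow_ex h.
have Hgh : tpow (b + c) (laurent_mul g h) by move=> i; exact: conv0.
have Hfg : tpow (a + b) (laurent_mul f g) by move=> i; exact: conv0.
pose K := absz (n - a - b - c + 1)%R.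
have HS1 i : a <= i <= n - (b + c) -> i \in iv a K by rewrite mem_iv; lia.
have HS2 i : a + b <= i <= n - c -> i \in iv (a + b) K by rewrite mem_iv; lia.
rewrite (convE Hf Hgh (iv_uniq a K)) //.
rewrite (convE Hfg Hh (iv_uniq (a + b) K)) //=.
transitivity (\sum_(j <- iv a K) \sum_(i <- iv (a + b) K)
                f j * g (i - j) * h (n - i)).
  rewrite big_seq [RHS]big_seq; apply: eq_bigr => j; rewrite mem_iv => jK.
  under eq_bigr do rewrite -mulrA.
  rewrite -big_distrr /=; congr (_ * _).
  rewrite (convE (s := [seq i - j | i <- iv (a + b) K]) Hg Hh).
  - rewrite big_map; apply: eq_bigr => i _; congr (_ * h _); lia.
  - by rewrite map_inj_uniq ?iv_uniq// => x y; lia.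
  - move=> k Hk; apply/mapP; exists (k + j); last by lia.
    by rewrite mem_iv; lia.
rewrite exchange_big /= big_seq [RHS]big_seq; apply: eq_bigr => i.
rewrite mem_iv => iK; rewrite -big_distrl /=; congr (_ * _).
by rewrite (convE Hf Hg (iv_uniq a K)) // => k; rewrite mem_iv; lia.
Qed.

HB.instance Definition _ := GRing.Zmodule_isComPzRing.Build laurent
  laurent_mulA laurent_mulC laurent_mul1 laurent_mulD.

Lemma coefM f g n : (f * g) n = \sum_(i \in setT) f i * g (n - i).
Proof. by []. Qed.

Lemma tpowM a b f g : tpow a f -> tpow b g -> tpow (a + b) (f * g).
Proof. by move=> Hf Hg i; exact: conv0. Qed.

Lemma scale_subproof (a : A) f :
  exists N : int, forall i, i < N -> a * f i = 0.
Proof. by case: (coefP f) => N H; exists N => i /H ->; rewrite mulr0. Qed.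
Definition laurent_scale a f := Laurent (scale_subproof a f).

Lemma laurent_scaleA a b f :
  laurent_scale a (laurent_scale b f) = laurent_scale (a * b) f.
Proof. by apply: laurentP => i /=; rewrite mulrA. Qed.
Lemma laurent_scale1 : left_id 1 laurent_scale.
Proof. by move=> f; apply: laurentP => i /=; rewrite mul1r. Qed.
Lemma laurent_scaleDr : right_distributive laurent_scale +%R.
Proof. by move=> a f g; apply: laurentP => i; rewrite /= mulrDr. Qed.
Lemma laurent_scaleDl f : {morph laurent_scale^~ f : a b / a + b}.
Proof. by move=> a b; apply: laurentP => i; rewrite /= mulrDl. Qed.

HB.instance Definition _ := GRing.Zmodule_isLmodule.Build A laurent
  laurent_scaleA laurent_scale1 laurent_scaleDr laurent_scaleDl.

Lemma coefZ a f i : (a *: f) i = a * f i. Proof. by []. Qed.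
Lemma tpowZ a n f : tpow n f -> tpow n (a *: f).
Proof. by move=> Hf i lt; rewrite coefZ Hf// mulr0. Qed.

Lemma scale_laurentAl a f g : a *: (f * g) = (a *: f) * g.
Proof.
apply: laurentP => n; rewrite coefZ.
have [b Hf] := tpow_ex f; have [c Hg] := tpow_ex g.
pose s := iv b (absz (n - c + 1 - b)%R).
have Hs i : b <= i <= n - c -> i \in s by rewrite mem_iv; lia.
rewrite [(f * g) n](convE Hf Hg (iv_uniq _ _) Hs).
rewrite [RHS](convE (tpowZ a Hf) Hg (iv_uniq _ _) Hs) big_distrr /=.
by apply: eq_bigr => i _; rewrite mulrA.
Qed.

Lemma mono0 : mono 0 = 1. Proof. by []. Qed.

Lemma coefMmono f j n : (f * mono j) n = f (n - j).
Proof.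
rewrite coefM (@fsum_seq _ _ [:: n - j])//.
  by rewrite big_seq1 coef_mono (_ : (_ == _) = true) ?mulr1//; lia.
move=> i; rewrite inE coef_mono => /negPf nij.
by rewrite (_ : (_ == _) = false) ?mulr0//; lia.
Qed.

Lemma monoD i j : mono (i + j) = mono i * mono j.
Proof. by apply: laurentP => n; rewrite coefMmono !coef_mono; congr (_%:R); lia. Qed.

(** The topology in which the $f + t^n A[[t]]$ form a base of neighbourhoods
    of $f$. *)
Definition laurent_nbhs f : set_system laurent :=
  filter_from [set: int] (fun n => [set g | tpow n (g - f)]).

HB.instance Definition _ := hasNbhs.Build laurent laurent_nbhs.

Lemma laurent_nbhs_filter f : ProperFilter (nbhs f).
Proof.
apply: filter_from_proper; last by move=> n _; exists f; rewrite /= subrr.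
apply: filter_from_filter; first by exists 0.
move=> m n _ _; exists (Num.max m n) => // g Hg.
by split; apply: tpow_le Hg; lia.
Qed.

Lemma laurent_nbhs_singleton f (P : set laurent) : nbhs f P -> P f.
Proof. by case=> n _; apply; rewrite /= subrr. Qed.

Lemma laurent_nbhs_nbhs f (P : set laurent) : nbhs f P -> nbhs f (nbhs^~ P).
Proof.
case=> n _ Hn; exists n => // g /= Hg; exists n => // h /= Hh.
by apply: Hn => /=; rewrite -(subrKA g); exact: tpowD.
Qed.

HB.instance Definition _ := Nbhs_isNbhsTopological.Build laurent
  laurent_nbhs_filter laurent_nbhs_singleton laurent_nbhs_nbhs.

End Laurent.

(** ** Continuous automorphisms of [A((t))] *)

Section ContinuousLinear.
Variable A : comPzRingType.
Implicit Types (L M : laurent A -> laurent A) (f g : laurent A) (i j n : int).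

Lemma continuousP0 L : linear L ->
  continuous L <-> forall n, exists m, forall f, tpow m f -> tpow n (L f).
Proof.
move=> linL; pose LL := GRing.isLinear.Build _ _ _ _ L linL.
pose L' : {linear laurent A -> laurent A} := HB.pack L LL.
have LB f g : L (f - g) = L f - L g by exact: (raddfB L').
have L0 : L 0 = 0 by exact: (raddf0 L').
split=> [cL n|H f P [n _ HP]].
  have : nbhs (L 0) [set g | tpow n (g - L 0)] by exists n.
  move=> /cL [m _ Hm]; exists m => f Hf.
  by have := Hm f; rewrite /= L0 !subr0; apply.
have [m Hm] := H n; exists m => // g /= Hg; apply: HP => /=.
by rewrite -LB; exact: Hm.
Qed.

(** Linear and continuous, see [contlinP]. *)
Definition contlin L :=
  linear L /\ forall n, exists m, forall f, tpow m f -> tpow n (L f).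

Lemma contlinP L : contlin L <-> linear L /\ continuous L.
Proof. by split=> -[lL H]; split=> //; apply/continuousP0. Qed.

Section Theory.
Variable L : laurent A -> laurent A.
Hypothesis LP : contlin L.

Lemma contlin0 : L 0 = 0.
Proof.
have := LP.1 (-1) 0 0.
by rewrite scaler0 addr0 scaleN1r addNr.
Qed.
Lemma contlinD f g : L (f + g) = L f + L g.
Proof. by have := LP.1 1 f g; rewrite !scale1r. Qed.
Lemma contlinZ a f : L (a *: f) = a *: L f.
Proof. by have := LP.1 a f 0; rewrite addr0 contlin0 addr0. Qed.
Lemma contlin_sum (I : Type) (s : seq I) (F : I -> laurent A) :
  L (\sum_(i <- s) F i) = \sum_(i <- s) L (F i).
Proof. exact: (big_morph L contlinD contlin0). Qed.
End Theory.

Lemma coef_sum (I : Type) (s : seq I) (F : I -> laurent A) n :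
  (\sum_(i <- s) F i) n = \sum_(i <- s) F i n.
Proof. exact: (big_morph (fun f : laurent A => f n)). Qed.

Lemma trunc_tpow a K f : tpow a f ->
  tpow (a + K%:Z) (f - \sum_(i <- iv a K) f i *: mono A i).
Proof.
move=> Hf n lt; rewrite coefB coef_sum.
have [lta|le] := ltP n a.
  rewrite Hf// big_seq big1 ?subrr// => i; rewrite mem_iv => iK.
  by rewrite coefZ coef_mono (_ : (_ == _) = false) ?mulr0//; lia.
have nK : n \in iv a K by rewrite mem_iv; lia.
rewrite (bigD1_seq n nK (iv_uniq _ _)) big1 /=.
  by rewrite eqxx mulr1 addr0 subrr.
by move=> i ni; rewrite eq_sym (negPf ni) mulr0.
Qed.

Lemma contlinE L a K n f : contlin L -> tpow a f ->
  (forall g, tpow (a + K%:Z) g -> tpow (n + 1) (L g)) ->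
  L f n = \sum_(i <- iv a K) f i * L (mono A i) n.
Proof.
move=> LP Hf HK; have := HK _ (trunc_tpow Hf) n.
rewrite -scaleN1r contlinD// contlinZ// contlin_sum// coefD coefZ mulN1r.
rewrite coef_sum; under eq_bigr do rewrite contlinZ// coefZ.
by move=> H; apply/eqP; rewrite -subr_eq0 H//; lia.
Qed.

Lemma contlin_fsum L n f : contlin L ->
  L f n = \sum_(i \in setT) f i * L (mono A i) n.
Proof.
move=> LP; have [a Hf] := tpow_ex f; have [m Hm] := LP.2 (n + 1).
have HK g : tpow (a + (absz (m - a)%R)%:Z) g -> tpow (n + 1) (L g).
  by move=> Hg; apply: Hm; apply: tpow_le Hg; lia.
rewrite (contlinE LP Hf HK) (@fsum_iv _ _ a (absz (m - a)%R))// => i ni.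
have [lt|le] := ltP i a; first by rewrite Hf// mul0r.
rewrite (HK (mono A i)) ?mulr0//; last by lia.
by apply: tpow_mono; lia.
Qed.

Lemma contlin_ext L M : contlin L -> contlin M ->
  (forall i, L (mono A i) = M (mono A i)) -> L =1 M.
Proof.
move=> LP MP LM f; apply: laurentP => n.
by rewrite (contlin_fsum n f LP) (contlin_fsum n f MP); under eq_fsbigr do rewrite LM.
Qed.

Lemma contlin_comp L M : contlin L -> contlin M -> contlin (L \o M).
Proof.
move=> LP MP; split=> [a f g|n] /=; first by rewrite MP.1 LP.1.
have [m Hm] := LP.2 n; have [k Hk] := MP.2 m.
by exists k => f /Hk /Hm.
Qed.

Lemma contlin_id : contlin id.
Proof. by split=> // n; exists n. Qed.

Lemma contlin_mulr g : contlin (fun f => f * g).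
Proof.
split=> [a f h|n]; first by rewrite mulrDl scale_laurentAl.
have [b Hg] := tpow_ex g; exists (n - b) => f Hf.
by rewrite -(subrK b n); exact: tpowM.
Qed.

Lemma contlin_mull g : contlin (fun f => g * f).
Proof.
have [H1 H2] := contlin_mulr g; split=> [a f h|n].
  by rewrite ![g * _]mulrC; exact: H1.
by have [m Hm] := H2 n; exists m => f /Hm; rewrite mulrC.
Qed.

Lemma contlin_morph L : contlin L ->
  (forall i j, L (mono A (i + j)) = L (mono A i) * L (mono A j)) ->
  {morph L : f g / f * g}.
Proof.
move=> LP LM f g.
have H j h : L (h * mono A j) = L h * L (mono A j).
  have := @contlin_ext (L \o (fun h => h * mono A j))
    ((fun h => h * L (mono A j)) \o L)
    (contlin_comp LP (contlin_mulr _)) (contlin_comp (contlin_mulr _) LP).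
  by move=> E; apply: E => i /=; rewrite -monoD LM.
have := @contlin_ext (L \o (fun h => f * h)) ((fun h => L f * h) \o L)
    (contlin_comp LP (contlin_mull _)) (contlin_comp (contlin_mull _) LP).
by move=> E; apply: E => i /=; rewrite H.
Qed.

Lemma contlin_bound L a : contlin L -> {morph L : f g / f * g} ->
  exists N, forall f, tpow a f -> tpow N (L f).
Proof.
move=> LP LM; have [m Hm] := LP.2 0.
have [N HN] := tpow_ex (L (mono A (a - m))); exists N => f Hf.
have -> : f = mono A (a - m) * (mono A (m - a) * f).
  by rewrite mulrA -monoD (_ : a - m + (m - a) = 0) ?mono0 ?mul1r//; lia.
rewrite LM -(addr0 N); apply: tpowM => //; apply: Hm.
rewrite -[X in tpow X _](subrK a m); apply: tpowM => //; exact: tpow_mono.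
Qed.

End ContinuousLinear.

Record laut (A : comPzRingType) := Laut {
  laut_fun :> laurent A -> laurent A;
  laut_inv : laurent A -> laurent A;
  laut_linear : linear laut_fun;
  laut_morph : monoid_morphism laut_fun;
  lautK : cancel laut_fun laut_inv;
  lautVK : cancel laut_inv laut_fun;
  laut_cont : continuous laut_fun;
  laut_inv_cont : continuous laut_inv }.

Section LautGroup.
Variable A : comPzRingType.
Implicit Types x y z : laut A.

HB.instance Definition _ := gen_eqMixin (laut A).
HB.instance Definition _ := gen_choiceMixin (laut A).

Lemma lautP x y : x =1 y -> x = y.
Proof.
case: x y => [f f' f1 f2 f3 f4 f5 f6] [g g' g1 g2 g3 g4 g5 g6] /= fg.
have {fg}E : f = g by apply/funext.
have E' : f' = g' by apply/funext => u; rewrite -[u in LHS]g4 -E f3.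
subst g g'; congr Laut; exact: Prop_irrelevance.
Qed.

Lemma laut_inv_linear x : linear (laut_inv x).
Proof.
move=> a f g; rewrite -[in LHS](lautVK x f) -[in LHS](lautVK x g).
by rewrite -(laut_linear x) lautK.
Qed.

Lemma laut_inv_morph x : monoid_morphism (laut_inv x).
Proof.
split=> [|f g]; first by rewrite -[in LHS](laut_morph x).1 lautK.
rewrite -[in LHS](lautVK x f) -[in LHS](lautVK x g).
by rewrite -(laut_morph x).2 lautK.
Qed.

Lemma laut_contlin x : contlin x.
Proof. by apply/contlinP; split; [exact: laut_linear|exact: laut_cont]. Qed.

Lemma laut_inv_contlin x : contlin (laut_inv x).
Proof. by apply/contlinP; split; [exact: laut_inv_linear|exact: laut_inv_cont]. Qed.

Lemma contlin_continuous (L : laurent A -> laurent A) :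
  contlin L -> continuous L.
Proof. by case/contlinP. Qed.

Lemma laut1_morph : monoid_morphism (@idfun (laurent A)).
Proof. by []. Qed.

Definition laut1 : laut A :=
  @Laut A idfun idfun (contlin_id A).1 laut1_morph (frefl _) (frefl _)
    (contlin_continuous (contlin_id A)) (contlin_continuous (contlin_id A)).

Definition laut_invg x : laut A :=
  @Laut A (laut_inv x) x (laut_inv_linear x) (laut_inv_morph x)
    (lautVK x) (lautK x) (@laut_inv_cont _ x) (@laut_cont _ x).

Lemma laut_mul_morph x y : monoid_morphism (x \o y).
Proof.
split=> [|f g] /=; first by rewrite (laut_morph y).1 (laut_morph x).1.
by rewrite (laut_morph y).2 (laut_morph x).2.
Qed.

Let comp_cl x y := contlin_comp (laut_contlin x) (laut_contlin y).
Let comp_invcl x y := contlin_comp (laut_inv_contlin x) (laut_inv_contlin y).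

Definition laut_mul x y : laut A :=
  @Laut A (x \o y) (laut_inv y \o laut_inv x) (comp_cl x y).1
    (laut_mul_morph x y) (can_comp (lautK x) (lautK y))
    (can_comp (lautVK y) (lautVK x))
    (contlin_continuous (comp_cl x y)) (contlin_continuous (comp_invcl y x)).

Lemma laut_mulA : associative laut_mul.
Proof. by move=> x y z; exact: lautP. Qed.
Lemma laut_mul1g : left_id laut1 laut_mul.
Proof. by move=> x; exact: lautP. Qed.
Lemma laut_mulg1 : right_id laut1 laut_mul.
Proof. by move=> x; exact: lautP. Qed.
Lemma laut_mulVg : left_inverse laut1 laut_invg laut_mul.
Proof. by move=> x; apply: lautP => f; exact: lautK. Qed.
Lemma laut_mulgV : right_inverse laut1 laut_invg laut_mul.
Proof. by move=> x; apply: lautP => f; exact: lautVK. Qed.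

HB.instance Definition _ := isGroup.Build (laut A)
  laut_mulA laut_mul1g laut_mulg1 laut_mulVg laut_mulgV.

Lemma laut_mulE x y f : (x * y)%g f = x (y f). Proof. by []. Qed.
Lemma laut1E f : (1%g : laut A) f = f. Proof. by []. Qed.

End LautGroup.

(** ** Base change along a ring morphism *)

Section BaseChange.
Variables (A B : comPzRingType) (rho : {rmorphism A -> B}).

Lemma map_laurent_subproof (f : laurent A) :
  exists N : int, forall i, i < N -> rho (f i) = 0.
Proof. by have [N H] := coefP f; exists N => i /H ->; exact: rmorph0. Qed.
Definition map_laurent (f : laurent A) : laurent B :=
  Laurent (map_laurent_subproof f).

Lemma map_mono i : map_laurent (mono A i) = mono B i.
Proof. by apply: laurentP => n /=; rewrite rmorph_nat. Qed.

Lemma tpow_map n f : tpow n f -> tpow n (map_laurent f).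
Proof. by move=> Hf i /Hf /= ->; exact: rmorph0. Qed.

Lemma map_laurentM f g :
  map_laurent (f * g) = map_laurent f * map_laurent g.
Proof.
apply: laurentP => n /=.
have [a Hf] := tpow_ex f; have [b Hg] := tpow_ex g.
pose s := iv a (absz (n - b + 1 - a)%R).
have Hs i : a <= i <= n - b -> i \in s by rewrite mem_iv; lia.
rewrite (convE Hf Hg (iv_uniq _ _) Hs).
rewrite (convE (tpow_map Hf) (tpow_map Hg) (iv_uniq _ _) Hs).
by rewrite rmorph_sum; apply: eq_bigr => i _; rewrite rmorphM.
Qed.

Section Def.
Variable L : laurent A -> laurent A.

(** The coefficients of the continuous [B]-linear extension of [L]; it maps
    [mono B i] to [map_laurent (L (mono A i))]. *)
Definition bc (f : laurent B) (n : int) : B :=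
  \sum_(i \in setT) f i * rho (L (mono A i) n).

Hypothesis LP : contlin L.
Hypothesis LM : {morph L : f g / f * g}.

Lemma bc_zero a n f N : tpow a f -> (forall g, tpow a g -> tpow N (L g)) ->
  n < N -> bc f n = 0.
Proof.
move=> Hf HN lt; rewrite /bc fsbig1// => i _.
have [lti|le] := ltP i a; first by rewrite Hf// mul0r.
by rewrite (HN (mono A i)) ?rmorph0 ?mulr0//; exact: tpow_mono.
Qed.

Lemma bc_subproof f : exists N : int, forall i, i < N -> bc f i = 0.
Proof.
have [a Hf] := tpow_ex f; have [N HN] := contlin_bound a LP LM.
by exists N => i lt; exact: bc_zero HN lt.
Qed.
Definition bcl f : laurent B := Laurent (bc_subproof f).

Lemma bcE n : exists m, forall a K f, tpow a f -> m <= a + K%:Z ->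
  bc f n = \sum_(i <- iv a K) f i * rho (L (mono A i) n).
Proof.
have [m Hm] := LP.2 (n + 1); exists m => a K f Hf le.
apply: fsum_iv => i ni.
have [lt|lei] := ltP i a; first by rewrite Hf// mul0r.
rewrite (Hm (mono A i)) ?rmorph0 ?mulr0//; last by lia.
by apply: tpow_mono; lia.
Qed.

Lemma bcl_contlin : contlin bcl.
Proof.
split=> [c f g|n].
  apply: laurentP => n; rewrite coefD coefZ /=.
  have [m Hm] := bcE n; have [a Hf] := tpow_ex f; have [b Hg] := tpow_ex g.
  pose d := Num.min a b; have le1 : d <= a by lia.
  have le2 : d <= b by lia.
  have Hf' := tpow_le le1 Hf; have Hg' := tpow_le le2 Hg.
  have le : m <= d + (absz (m - d)%R)%:Z by lia.
  rewrite (Hm _ _ _ (tpowD (tpowZ c Hf') Hg') le) (Hm _ _ _ Hf' le).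
  rewrite (Hm _ _ _ Hg' le) big_distrr -big_split /=.
  by apply: eq_bigr => i _; rewrite mulrDl mulrA.
have [m Hm] := LP.2 n; exists m => f Hf i lt; exact: bc_zero Hm lt.
Qed.

Lemma bcl_map f : bcl (map_laurent f) = map_laurent (L f).
Proof.
apply: laurentP => n /=.
have [m Hm] := bcE n; have [a Hf] := tpow_ex f; have [k Hk] := LP.2 (n + 1).
pose K := absz (Num.max m k - a)%R.
have le : m <= a + K%:Z by lia.
rewrite (Hm _ _ _ (tpow_map Hf) le) (contlinE (K := K) LP Hf).
  by rewrite rmorph_sum; apply: eq_bigr => i _; rewrite rmorphM.
by move=> g Hg; apply: Hk; apply: tpow_le Hg; lia.
Qed.

Lemma bcl_mono i : bcl (mono B i) = map_laurent (L (mono A i)).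
Proof. by rewrite -map_mono bcl_map. Qed.

Lemma bcl_morph : {morph bcl : f g / f * g}.
Proof.
apply: contlin_morph bcl_contlin _ => i j.
by rewrite !bcl_mono -map_laurentM -LM monoD.
Qed.

Lemma bcl_monoid_morphism : L 1 = 1 -> monoid_morphism bcl.
Proof.
move=> L1; split; last exact: bcl_morph.
by rewrite -mono0 bcl_mono mono0 L1 -mono0 map_mono.
Qed.
End Def.

Lemma bcl_can L M (LP : contlin L) (MP : contlin M)
    (LM : {morph L : f g / f * g}) (MM : {morph M : f g / f * g}) :
  cancel L M -> cancel (bcl LP LM) (bcl MP MM).
Proof.
move=> LK.
apply: (contlin_ext (contlin_comp (bcl_contlin _ _) (bcl_contlin _ _))).
  exact: contlin_id.
by move=> i /=; rewrite bcl_mono bcl_map LK map_mono.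
Qed.

Variable x : laut A.

Definition base_change : laut B :=
  @Laut B (bcl (laut_contlin x) (laut_morph x).2)
    (bcl (laut_inv_contlin x) (laut_inv_morph x).2)
    (bcl_contlin _ _).1 (bcl_monoid_morphism _ _ (laut_morph x).1)
    (bcl_can _ _ _ _ (@lautK _ x)) (bcl_can _ _ _ _ (@lautVK _ x))
    (contlin_continuous (bcl_contlin _ _))
    (contlin_continuous (bcl_contlin _ _)).

Lemma base_change_map f : base_change (map_laurent f) = map_laurent (x f).
Proof. exact: bcl_map. Qed.

Lemma base_change_mono i : base_change (mono B i) = map_laurent (x (mono A i)).
Proof. exact: bcl_mono. Qed.

(** Base change acts on $\widetilde\varphi$ by applying [rho] to the
    coefficients. *)
Lemma base_changet : base_change (mono B 1) = map_laurent (x (mono A 1)).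
Proof. exact: base_change_mono. Qed.

End BaseChange.

Lemma laut_ext (A : comPzRingType) (x y : laut A) :
  (forall i, x (mono A i) = y (mono A i)) -> x = y.
Proof. by move=> xy; apply/lautP/contlin_ext => //; exact: laut_contlin. Qed.

Lemma base_changeM (A B : comPzRingType) (rho : {rmorphism A -> B}) :
  {morph base_change rho : x y / (x * y)%g}.
Proof.
move=> x y; apply: laut_ext => i.
by rewrite laut_mulE !base_change_mono base_change_map.
Qed.

(** ** Group functors on commutative [R]-algebras and their cohomology *)

Record calg (R : comPzRingType) := CAlg {
  calg_ring :> comPzRingType;
  calg_str : {rmorphism R -> calg_ring} }.

Record calg_hom (R : comPzRingType) (A B : calg R) := CAlgHom {
  calg_fun :> {rmorphism A -> B};
  calg_funP : forall r, calg_fun (calg_str A r) = calg_str B r }.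

Definition calg_id (R : comPzRingType) (A : calg R) : calg_hom A A :=
  @CAlgHom R A A idfun (fun=> erefl).

Lemma calg_comp_subproof (R : comPzRingType) (A B C : calg R)
    (s : calg_hom B C) (r : calg_hom A B) (a : R) :
  (s \o r) (calg_str A a) = calg_str C a.
Proof. by rewrite /= !calg_funP. Qed.

Definition calg_comp (R : comPzRingType) (A B C : calg R)
    (s : calg_hom B C) (r : calg_hom A B) : calg_hom A C :=
  @CAlgHom R A C (s \o r) (calg_comp_subproof s r).

Record groupFunctor (R : comPzRingType) := GroupFunctor {
  gf_obj :> calg R -> groupType;
  gf_map : forall A B : calg R, calg_hom A B -> gf_obj A -> gf_obj B;
  gf_mapM : forall A B (r : calg_hom A B), {morph gf_map r : x y / (x * y)%g};
  gf_map_id : forall A, gf_map (calg_id A) =1 id;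
  gf_map_comp : forall A B C (s : calg_hom B C) (r : calg_hom A B),
    gf_map (calg_comp s r) =1 gf_map s \o gf_map r }.

Record comGroupFunctor (R : comPzRingType) := ComGroupFunctor {
  cgf :> groupFunctor R;
  cgf_mulC : forall (A : calg R) (x y : cgf A), (x * y)%g = (y * x)%g }.

Lemma gf_map1 (R : comPzRingType) (G : groupFunctor R) (A B : calg R)
  (r : calg_hom A B) : gf_map (g := G) r 1%g = 1%g.
Proof. by apply: (mulIg (gf_map r 1%g)); rewrite -gf_mapM !mul1g. Qed.

Lemma gf_mapV (R : comPzRingType) (G : groupFunctor R) (A B : calg R)
  (r : calg_hom A B) : {morph gf_map (g := G) r : x / (x^-1)%g}.
Proof.
by move=> x; apply: (mulIg (gf_map r x)); rewrite -gf_mapM !mulVg gf_map1.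
Qed.

Lemma gf_map_prod (R : comPzRingType) (G : groupFunctor R) (A B : calg R)
    (r : calg_hom A B) (I : Type) (s : seq I) (F : I -> G A) :
  gf_map r (\prod_(i <- s) F i)%g = (\prod_(i <- s) gf_map r (F i))%g.
Proof. exact: (big_morph _ (gf_mapM r) (gf_map1 G r)). Qed.

Section Cohomology.
Variables (R : comPzRingType) (G : groupFunctor R) (F : comGroupFunctor R).
Local Open Scope group_scope.

(** Morphisms of set-valued functors [G ^ q -> F]. For [q = 0] these are the
    families of points of the [F A] compatible with base change, that is, the
    points of [F R], [R] being the initial commutative [R]-algebra. *)
Definition gfamily q := forall A : calg R, ('I_q -> G A) -> F A.

Definition natural q (c : gfamily q) := forall (A B : calg R) (r : calg_hom A B)
  (g : 'I_q -> G A), c B (gf_map r \o g) = gf_map r (c A g).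

Record cochain q := Cochain {
  cochain_fun :> forall A : calg R, ('I_q -> G A) -> F A;
  _ : natural cochain_fun }.

Lemma cochain_natural q (c : cochain q) : natural c. Proof. by case: c. Qed.

Lemma cochainP q (c d : cochain q) : (forall A g, c A g = d A g) -> c = d.
Proof.
case: c d => [c cP] [d dP] /= cd.
have E : c = d by apply: functional_extensionality_dep => A; exact/funext/cd.
by subst d; rewrite (Prop_irrelevance cP dP).
Qed.

Lemma cochain1_subproof q : natural (fun A (_ : 'I_q -> G A) => 1 : F A).
Proof. by move=> A B r g; rewrite gf_map1. Qed.
Definition cochain1 q : cochain q := Cochain (@cochain1_subproof q).

Lemma cochainV_subproof q (c : cochain q) :
  natural (fun A (g : 'I_q -> G A) => (c A g)^-1 : F A).
Proof. by move=> A B r g; rewrite cochain_natural gf_mapV. Qed.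
Definition cochainV q (c : cochain q) : cochain q :=
  Cochain (cochainV_subproof c).

Lemma cochainM_subproof q (c d : cochain q) :
  natural (fun A (g : 'I_q -> G A) => c A g * d A g : F A).
Proof. by move=> A B r g; rewrite !cochain_natural gf_mapM. Qed.
Definition cochainM q (c d : cochain q) : cochain q :=
  Cochain (cochainM_subproof c d).

Lemma cochain_mulA q : associative (@cochainM q).
Proof. by move=> c d e; apply: cochainP => A g /=; rewrite mulgA. Qed.
Lemma cochain_mul1 q : left_id (cochain1 q) (@cochainM q).
Proof. by move=> c; apply: cochainP => A g /=; rewrite mul1g. Qed.
Lemma cochain_mulr1 q : right_id (cochain1 q) (@cochainM q).
Proof. by move=> c; apply: cochainP => A g /=; rewrite mulg1. Qed.
Lemma cochain_mulV q : left_inverse (cochain1 q) (@cochainV q) (@cochainM q).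
Proof. by move=> c; apply: cochainP => A g /=; rewrite mulVg. Qed.
Lemma cochain_mulrV q : right_inverse (cochain1 q) (@cochainV q) (@cochainM q).
Proof. by move=> c; apply: cochainP => A g /=; rewrite mulgV. Qed.

Lemma cochain_mulC q : commutative (@cochainM q).
Proof. by move=> c d; apply: cochainP => A g; exact: cgf_mulC. Qed.

(** [contract g i] is $(g_1, \dots, g_{i+1} g_{i+2}, \dots, g_{q+1})$ when [g]
    is $(g_1, \dots, g_{q+1})$: the index [i < q] starts from [0]. *)
Definition contract q A (g : 'I_q.+1 -> G A) (i j : 'I_q) : G A :=
  if (j < i)%N then g (widen_ord (leqnSn q) j)
  else if j == i then g (widen_ord (leqnSn q) j) * g (lift ord0 j)
  else g (lift ord0 j).

(** $x^{(-1)^n}$ *)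
Definition alt (H : groupType) (n : nat) (x : H) := if odd n then x^-1 else x.

Definition diff_fun q (c : gfamily q) : gfamily q.+1 := fun A g =>
  c A (fun j => g (lift ord0 j)) *
  (\prod_(i < q) alt i.+1 (c A (contract g i))) *
  alt q.+1 (c A (fun j => g (widen_ord (leqnSn q) j))).

Lemma gf_map_alt (H : groupFunctor R) n (A B : calg R) (r : calg_hom A B)
  (x : H A) : gf_map r (alt n x) = alt n (gf_map r x).
Proof. by rewrite /alt; case: odd; rewrite ?gf_mapV. Qed.

Lemma diff_natural q (c : cochain q) : natural (diff_fun c).
Proof.
move=> A B r g; rewrite /diff_fun !gf_mapM gf_map_prod gf_map_alt.
rewrite -!cochain_natural; congr (_ * _ * _).
apply: eq_bigr => i _; rewrite gf_map_alt -cochain_natural.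
congr (alt _ (c B _)); apply/funext => j; rewrite /contract /=.
by case: ltnP => // _; case: eqP => //=; rewrite gf_mapM.
Qed.

Definition diff q (c : cochain q) : cochain q.+1 := Cochain (diff_natural c).

Lemma altM n A (x y : F A) : alt n (x * y) = alt n x * alt n y.
Proof. by rewrite /alt; case: odd => //; rewrite invgM cgf_mulC. Qed.

Lemma mulgACA A (x y z t : F A) : (x * y) * (z * t) = (x * z) * (y * t).
Proof. by rewrite !mulgA -[x * y * z]mulgA (cgf_mulC y z) !mulgA. Qed.

Lemma prodgM A (I : Type) (s : seq I) (P Q : I -> F A) :
  \prod_(i <- s) (P i * Q i) = \prod_(i <- s) P i * \prod_(i <- s) Q i.
Proof.
elim: s => [|i s IH]; first by rewrite !big_nil mulg1.
by rewrite !big_cons IH mulgACA.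
Qed.

Lemma diffM q (c d : cochain q) :
  diff (cochainM c d) = cochainM (diff c) (diff d).
Proof.
apply: cochainP => A g; rewrite /= /diff_fun /= altM.
under eq_bigr do rewrite altM.
by rewrite prodgM [RHS]mulgACA; congr (_ * _); exact: mulgACA.
Qed.

Lemma diff1 q : diff (cochain1 q) = cochain1 q.+1.
Proof.
rewrite -[LHS]cochain_mul1 -(cochain_mulV (diff (cochain1 q))) -cochain_mulA.
by rewrite -diffM cochain_mul1.
Qed.

Lemma diffV q (c : cochain q) : diff (cochainV c) = cochainV (diff c).
Proof.
rewrite -[LHS]cochain_mul1 -(cochain_mulV (diff c)) -cochain_mulA.
by rewrite -diffM cochain_mulrV diff1 cochain_mulr1.
Qed.

(** [cocycle], [coboundary] and [cohomology] are $\ker\delta_q$,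
    $\operatorname{im}\delta_{q-1}$ and $H^q(G,F)$. They are too large to carry
    a [groupType] structure: cochains quantify over all algebras. *)
Record cocycle q := Cocycle {
  cocycle_val :> cochain q;
  _ : diff cocycle_val = cochain1 q.+1 }.

Lemma cocycleK q (c : cocycle q) : diff c = cochain1 q.+1.
Proof. by case: c. Qed.

Lemma cocycleP q (c d : cocycle q) : c = d :> cochain q -> c = d.
Proof.
case: c d => [c cP] [d dP] /= E; subst d.
by rewrite (Prop_irrelevance cP dP).
Qed.

Definition cocycle1 q : cocycle q := Cocycle (diff1 q).

Lemma cocycleV_subproof q (c : cocycle q) :
  diff (cochainV c) = cochain1 q.+1.
Proof. by rewrite diffV cocycleK -[LHS]cochain_mulr1 cochain_mulV. Qed.
Definition cocycleV q (c : cocycle q) : cocycle q :=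
  Cocycle (cocycleV_subproof c).

Lemma cocycleM_subproof q (c d : cocycle q) :
  diff (cochainM c d) = cochain1 q.+1.
Proof. by rewrite diffM !cocycleK cochain_mul1. Qed.
Definition cocycleM q (c d : cocycle q) : cocycle q :=
  Cocycle (cocycleM_subproof c d).

Lemma cocycle_mulA q : associative (@cocycleM q).
Proof. by move=> c d e; apply/cocycleP/cochain_mulA. Qed.
Lemma cocycle_mulC q : commutative (@cocycleM q).
Proof. by move=> c d; apply/cocycleP/cochain_mulC. Qed.
Lemma cocycle_mul1 q : left_id (cocycle1 q) (@cocycleM q).
Proof. by move=> c; apply/cocycleP/cochain_mul1. Qed.
Lemma cocycle_mulV q : left_inverse (cocycle1 q) (@cocycleV q) (@cocycleM q).
Proof. by move=> c; apply/cocycleP/cochain_mulV. Qed.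

Definition coboundary q : cochain q -> Prop :=
  if q is q'.+1 then fun c => exists b : cochain q', c = diff b
  else fun c => c = cochain1 _.

Lemma coboundary1 q : coboundary (cochain1 q).
Proof. by case: q => //= q; exists (cochain1 q); rewrite diff1. Qed.

Lemma coboundaryV q (c : cochain q) : coboundary c -> coboundary (cochainV c).
Proof.
case: q c => /= [c ->|q c [b ->]].
  by rewrite -[LHS]cochain_mulr1 cochain_mulV.
by exists (cochainV b); rewrite diffV.
Qed.

Lemma coboundaryM q (c d : cochain q) :
  coboundary c -> coboundary d -> coboundary (cochainM c d).
Proof.
case: q c d => /= [c d -> ->|q c d [b ->] [e ->]].
  by rewrite cochain_mul1.
by exists (cochainM b e); rewrite diffM.
Qed.

(** The coset of [c] modulo coboundaries. *)
Definition cosetb q (c d : cocycle q) : Prop := coboundary (cocycleM d (cocycleV c)).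

Record cohomology q := Cohomology {
  cohom_coset : cocycle q -> Prop;
  _ : exists c, cohom_coset = cosetb c }.

Definition hclass q (c : cocycle q) : cohomology q :=
  Cohomology (ex_intro _ c erefl).

Lemma cohomP q (x y : cohomology q) :
  (forall c, cohom_coset x c <-> cohom_coset y c) -> x = y.
Proof.
case: x y => [x xP] [y yP] /= xy.
have E : x = y by apply/funext => c; exact/propext/xy.
by subst y; rewrite (Prop_irrelevance xP yP).
Qed.

Lemma coset_refl q (c : cocycle q) : cosetb c c.
Proof.
by rewrite /cosetb /= cochain_mulrV; exact: coboundary1.
Qed.

Lemma coset_sym q (c d : cocycle q) : cosetb c d -> cosetb d c.
Proof.
move=> /coboundaryV; rewrite /cosetb.
congr (coboundary _); apply: cochainP => A g /=.
by rewrite invgM invgK.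
Qed.

Lemma coset_trans q (c d e : cocycle q) : cosetb c d -> cosetb d e -> cosetb c e.
Proof.
move=> cd de; have := coboundaryM de cd; rewrite /cosetb.
congr (coboundary _); apply: cochainP => A g /=.
by rewrite mulgA mulgVK.
Qed.

Lemma hclass_surj q (x : cohomology q) : exists c, x = hclass c.
Proof. by case: x => x [c E]; exists c; apply: cohomP => d /=; rewrite E. Qed.

Lemma hclassP q (c d : cocycle q) :
  hclass c = hclass d <-> coboundary (cocycleM c (cocycleV d)).
Proof.
split=> [E|cd].
  by have : cohom_coset (hclass c) c by [exact: coset_refl]; rewrite E.
apply: cohomP => e /=; split; last first.
  by move=> de; apply: coset_trans de; exact: coset_sym.
by move=> ce; apply: coset_trans ce.
Qed.

Lemma cohomM_subproof q (x y : cohomology q) : exists c, 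
  (fun e => exists d d', [/\ cohom_coset x d, cohom_coset y d' &
    e = cocycleM d d']) = cosetb c.
Proof.
have [c ->] := hclass_surj x; have [c' ->] := hclass_surj y.
exists (cocycleM c c'); apply/funext => e; apply/propext; split=> /=.
  case=> d [d' [cd cd' ->]]; have := coboundaryM cd cd'.
  rewrite /cosetb; congr (coboundary _); apply: cochainP => A g /=.
  by rewrite mulgACA invgM [(c' A g)^-1 * _]cgf_mulC.
move=> H; exists (cocycleM e (cocycleV c')), c'; split.
- move: H; rewrite /cosetb; congr (coboundary _); apply: cochainP => A g /=.
  by rewrite invgM mulgA.
- exact: coset_refl.
- by apply: cocycleP; apply: cochainP => A g /=; rewrite mulgVK.
Qed.

(** The product of cosets. *)
Definition cohomM q (x y : cohomology q) : cohomology q :=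
  Cohomology (cohomM_subproof x y).
Definition cohom1 q : cohomology q := hclass (cocycle1 q).
Definition cohomX q (x : cohomology q) (n : nat) : cohomology q :=
  iter n (cohomM x) (cohom1 q).

Lemma hclassM q (c d : cocycle q) :
  hclass (cocycleM c d) = cohomM (hclass c) (hclass d).
Proof.
have [e E] := hclass_surj (cohomM (hclass c) (hclass d)); rewrite E.
have : cohom_coset (hclass e) (cocycleM c d).
  by rewrite -E; exists c, d; split=> //; exact: coset_refl.
by move=> ?; apply/hclassP.
Qed.

Lemma cohom_mulA q : associative (@cohomM q).
Proof.
move=> x y z; have [c ->] := hclass_surj x; have [d ->] := hclass_surj y.
by have [e ->] := hclass_surj z; rewrite -!hclassM cocycle_mulA.
Qed.
Lemma cohom_mulC q : commutative (@cohomM q).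
Proof.
move=> x y; have [c ->] := hclass_surj x; have [d ->] := hclass_surj y.
by rewrite -!hclassM cocycle_mulC.
Qed.
Lemma cohom_mul1 q : left_id (cohom1 q) (@cohomM q).
Proof. by move=> x; have [c ->] := hclass_surj x; rewrite -hclassM cocycle_mul1. Qed.
Lemma cohom_mulV q (c : cocycle q) :
  cohomM (hclass (cocycleV c)) (hclass c) = cohom1 q.
Proof. by rewrite -hclassM cocycle_mulV. Qed.

End Cohomology.

(** ** The functors [Gm] and [Aut A((t))] *)

Record units (A : comPzRingType) := Units {
  uval : A;
  uinv : A;
  uvalK : uval * uinv = 1 }.

Section Units.
Variable A : comPzRingType.
Implicit Types x y z : units A.

HB.instance Definition _ := gen_eqMixin (units A).
HB.instance Definition _ := gen_choiceMixin (units A).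

Lemma unitsP x y : uval x = uval y -> x = y.
Proof.
case: x y => [x x' xx'] [y y' yy'] /= E; subst y.
have E' : x' = y' by rewrite -[x']mulr1 -yy' mulrA (mulrC x') xx' mul1r.
by subst y'; rewrite (Prop_irrelevance xx' yy').
Qed.

Definition units1 : units A := Units (mulr1 1).

Lemma unitsV_subproof x : uinv x * uval x = 1.
Proof. by rewrite mulrC uvalK. Qed.
Definition unitsV x : units A := Units (unitsV_subproof x).

Lemma unitsM_subproof x y : (uval x * uval y) * (uinv x * uinv y) = 1.
Proof. by rewrite mulrACA !uvalK mulr1. Qed.
Definition unitsM x y : units A := Units (unitsM_subproof x y).

Lemma units_mulA : associative unitsM.
Proof. by move=> x y z; apply/unitsP/mulrA. Qed.
Lemma units_mul1 : left_id units1 unitsM.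
Proof. by move=> x; apply/unitsP/mul1r. Qed.
Lemma units_mulr1 : right_id units1 unitsM.
Proof. by move=> x; apply/unitsP/mulr1. Qed.
Lemma units_mulV : left_inverse units1 unitsV unitsM.
Proof. by move=> x; apply: unitsP; rewrite /= mulrC uvalK. Qed.
Lemma units_mulrV : right_inverse units1 unitsV unitsM.
Proof. by move=> x; apply: unitsP; rewrite /= uvalK. Qed.

HB.instance Definition _ := isGroup.Build (units A)
  units_mulA units_mul1 units_mulr1 units_mulV units_mulrV.

Lemma units_mulC x y : (x * y)%g = (y * x)%g.
Proof. by apply/unitsP/mulrC. Qed.

Lemma uvalM x y : uval (x * y)%g = uval x * uval y. Proof. by []. Qed.

(** $x^n$ for $n \in \mathbb Z$ *)
Definition zexp x (n : int) : units A :=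
  match n with Posz k => (x ^+ k)%g | Negz k => (x ^- k.+1)%g end.

End Units.

Section UnitsMap.
Variables (A B : comPzRingType) (rho : {rmorphism A -> B}).

Lemma units_map_subproof (x : units A) : rho (uval x) * rho (uinv x) = 1.
Proof. by rewrite -rmorphM uvalK rmorph1. Qed.
Definition units_map (x : units A) : units B := Units (units_map_subproof x).

Lemma units_mapM : {morph units_map : x y / (x * y)%g}.
Proof. by move=> x y; apply: unitsP; rewrite /= rmorphM. Qed.
End UnitsMap.

Section Functors.
Variable R : comPzRingType.

Lemma Gm_map_id (A : calg R) : units_map (calg_id A) =1 id.
Proof. by move=> x; exact: unitsP. Qed.
Lemma Gm_map_comp (A B C : calg R) (s : calg_hom B C) (r : calg_hom A B) :
  units_map (calg_comp s r) =1 units_map s \o units_map r.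
Proof. by move=> x; exact: unitsP. Qed.

Definition Gm_functor : groupFunctor R :=
  @GroupFunctor R (fun A => units A) (fun A B r => units_map r)
    (fun A B r => units_mapM r) Gm_map_id Gm_map_comp.

(** $\mathbb G_{m,R}$ *)
Definition Gm : comGroupFunctor R :=
  @ComGroupFunctor R Gm_functor (fun A => @units_mulC A).

Lemma Laut_map_id (A : calg R) : base_change (calg_id A) =1 id.
Proof.
move=> x; apply: laut_ext => i; rewrite base_change_mono.
exact: laurentP.
Qed.
Lemma Laut_map_comp (A B C : calg R) (s : calg_hom B C) (r : calg_hom A B) :
  base_change (calg_comp s r) =1 base_change s \o base_change r.
Proof.
move=> x; apply: laut_ext => i; rewrite [LHS]base_change_mono.
by rewrite /comp 2!base_change_mono; exact: laurentP.
Qed.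

(** $\mathcal G_R$ *)
Definition LAut : groupFunctor R :=
  @GroupFunctor R (fun A => laut A) (fun A B r => base_change r)
    (fun A B r => base_changeM r) Laut_map_id Laut_map_comp.

End Functors.

(** ** The Contou-Carrere symbol *)

Section ContouCarrere.
Variable A : comPzRingType.

Record spec := Spec {
  prime_ideal : set A;
  prime0 : prime_ideal 0;
  primeD : forall a b, prime_ideal a -> prime_ideal b -> prime_ideal (a + b);
  primeMr : forall a b, prime_ideal b -> prime_ideal (a * b);
  primeN1 : ~ prime_ideal 1;
  primeP : forall a b, prime_ideal (a * b) -> prime_ideal a \/ prime_ideal b }.

(** A locally constant function $\nu : \operatorname{Spec} A \to \mathbb Z$
    with the orthogonal idempotents $e_n$ of the corresponding decomposition
    $A = \prod_n A e_n$: the factor $A e_n$ is the one on which $\nu = n$. *)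
Record locconst := LocConst {
  lc_fun :> spec -> int;
  lc_idem : int -> A;
  lc_locconst : forall p, exists2 a, ~ prime_ideal p a &
    forall q, ~ prime_ideal q a -> lc_fun q = lc_fun p;
  lc_finite : finite_set [set n | lc_idem n <> 0];
  lc_orth : forall m n, m != n -> lc_idem m * lc_idem n = 0;
  lc_sum1 : \sum_(n \in setT) lc_idem n = 1;
  lc_idemP : forall n p, ~ prime_ideal p (lc_idem n) <-> lc_fun p = n }.

Implicit Types (nu mu : locconst) (u v : units A) (a b : int -> A).
Implicit Types (f g : laurent A).

(** $t^\nu$ *)
Definition tpow_lc nu : laurent A :=
  \sum_(n \in setT) lc_idem nu n *: mono A n.

(** $u^\nu$ *)
Definition upow_lc u nu : A := \sum_(n \in setT) lc_idem nu n * uval (zexp u n).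

(** $(-1)^{\nu\mu}$ *)
Definition sign_lc nu mu : A :=
  \sum_(m \in setT) \sum_(n \in setT)
    lc_idem nu m * lc_idem mu n * (-1) ^+ absz (m * n)%R.

Definition nilpotent (x : A) := exists n, x ^+ n = 0.

(** $f = \prod_{i<0}(1-a_it^i)\cdot u\cdot t^\nu\cdot\prod_{i>0}(1-a_it^i)$,
    where [a 0] plays no role; the product over $i<0$ has finitely many factors
    different from $1$ and [P] is the product over $i>0$. *)
Definition CC_decomp f nu u a := exists P : laurent A,
  [/\ forall i, i < 0 -> nilpotent (a i),
      exists N, forall i, i < N -> a i = 0,
      (fun n : nat => \prod_(1 <= i < n) (1 - a i%:Z *: mono A i%:Z)) @ \oo --> P &
      f = \big[*%R/1]_(i \in [set i : int | i < 0]) (1 - a i *: mono A i)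
            * (uval u *: tpow_lc nu) * P].

(** $\prod_{i>0}\prod_{j>0}
      \bigl(1-a_i^{j/(i,j)}b_{-j}^{i/(i,j)}\bigr)^{(i,j)}$, the double product
    in the numerator of the symbol; exchanging $i$ and $j$, the one in the
    denominator is [CC_prod b a]. Only finitely many factors are not $1$. *)
Definition CC_prod a b : A :=
  \big[*%R/1]_(ij \in [set ij : nat * nat | (0 < ij.1)%N /\ (0 < ij.2)%N])
    (1 - a ij.1%:Z ^+ (ij.2 %/ gcdn ij.1 ij.2)
         * b (- ij.2%:Z) ^+ (ij.1 %/ gcdn ij.1 ij.2)) ^+ gcdn ij.1 ij.2.

(** [w] is the value of the symbol computed from decompositions of [f] and
    [g]. *)
Definition CC_spec f g (w : units A) := exists nu u a mu v b,
  [/\ CC_decomp f nu u a, CC_decomp g mu v b &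
    uval w * (upow_lc v nu * CC_prod b a) =
      sign_lc nu mu * (upow_lc u mu * CC_prod a b)].

(** The value [1] outside $A((t))^* \times A((t))^*$ is a default. *)
Definition CC f g : units A := xget 1%g (CC_spec f g).

End ContouCarrere.

(** ** The two cocycles *)

Section Cocycles.
Variable A : comPzRingType.
Implicit Types (x y : laut A) (f : laurent A).

Lemma deriv_subproof f :
  exists N : int, forall i, i < N -> f (i + 1) *~ (i + 1) = 0.
Proof.
have [N H] := coefP f; exists (N - 1) => i lt.
by rewrite H ?mul0rz//; lia.
Qed.

(** $\partial f / \partial t$ *)
Definition laurent_deriv f : laurent A := Laurent (deriv_subproof f).

(** $\widetilde\varphi$ *)
Definition tilde x : laurent A := x (mono A 1).

Lemma laut_monoX x (k : nat) : x (mono A k%:Z) = tilde x ^+ k.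
Proof.
elim: k => [|k IH]; first exact: (laut_morph x).1.
by rewrite exprS -IH -(laut_morph x).2 -monoD; congr (x (mono A _)); lia.
Qed.

Lemma laut_monoV x (k : nat) : x (mono A (- k%:Z)) * tilde x ^+ k = 1.
Proof.
by rewrite -laut_monoX -(laut_morph x).2 -monoD addNr; exact: (laut_morph x).1.
Qed.

Lemma coef_laut x f n : x f n = \sum_(i \in setT) f i * x (mono A i) n.
Proof. exact/contlin_fsum/laut_contlin. Qed.

(** $f \circ \widetilde\varphi = \sum_i b_i \widetilde\varphi^{\,i}$ is [x f]
    by [coef_laut], [laut_monoX] and [laut_monoV]. *)
Definition bott x y : units A :=
  CC (laurent_deriv (tilde x)) (x (laurent_deriv (tilde y))).

Lemma pr_subproof f :
  exists N : int, forall i, i < N -> (if 0 <= i then f i else 0) = 0.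
Proof. by exists 0 => i; rewrite ltNge => /negPf ->. Qed.

(** The projection of $A((t)) = t^{-1}A[t^{-1}] \oplus A[[t]]$ to $A[[t]]$. *)
Definition pr f : laurent A := Laurent (pr_subproof f).

(** The map $d_x$; only its restriction to $A[[t]]$, which is [tpow A 0], is
    meaningful. *)
Definition dmap x f : laurent A := pr (x f).

(** [e] is $d_{xy}^{-1}$ on $A[[t]]$, and the matrix is that of
    $d_x d_y d_{xy}^{-1}$ on $A[[t]]/t^nA[[t]]$ in the basis of the $t^j$. *)
Definition det_spec x y (w : units A) :=
  exists (e : laurent A -> laurent A) (n : nat),
  [/\ [/\ forall f, tpow 0 f -> tpow 0 (e f),
          forall f, tpow 0 f -> dmap (x * y)%g (e f) = f &
          forall f, tpow 0 f -> e (dmap (x * y)%g f) = f],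
      forall f, tpow n%:Z f -> dmap x (dmap y (e f)) = f &
      uval w =
        \det (\matrix_(i < n, j < n) dmap x (dmap y (e (mono A j%:Z))) i%:Z)].

Definition det_cocycle x y : units A := xget 1%g (det_spec x y).

End Cocycles.

(* Main.v *)
(** Write $G_+$ for the automorphisms preserving all $t^nA[[t]]$ and $G_-$ for
    those with $\widetilde\varphi - t \in A[t^{-1}]$.
    Every automorphism is uniquely $hk$ with $h \in G_-$ and $k \in G_+$. Over a
    $\mathbb Q$-algebra $\hat B = \exp b$, where $b$ is an additive cocycle given by
    residues. The cocycle $D$ is trivial on $G_- \times \mathcal G$ and on
    $\mathcal G \times G_+$, and so is $\hat B$ times the coboundary of
    $\exp\beta$, $\beta(hk) = b(h,k)$. Hence the quotient of $D^{12}$ by the latter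
    depends only on the factors $k$ and $h'$ of $hk$ and $h'k'$. Scaling $t$ by $s$
    joins $k$ and $h'$ to diagonal and trivial automorphisms, where the quotient is
    $1$, and the cocycle identity reduces the derivative in $s$ to
    the quotient at $(1 + eu\partial_t, 1 + dv\partial_t)$ with $e^2 = d^2 = 0$. There
    it is $1$: by $6\sum_{j<c} j(c-j) = c^3 - c$, the value of $D$ is
    $1 + \frac{ed}{6}\operatorname{res}(u'v'')$, while the corrected $\hat B$ is
    $1 + 2ed\operatorname{res}(u'v'')$. *)
From HB Require Import structures.
Require Import Defs.
From mathcomp Require Import all_boot all_order all_algebra.
From mathcomp Require Import zify ring.
From mathcomp Require Import perm boolp classical_sets cardinality fsbigop filter.
Import Defs.
Set Implicit Arguments. Unset Strict Implicit. Unset Printing Implicit Defensive.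
Import Order.TTheory GRing.Theory Num.Theory.
Local Open Scope classical_set_scope.
Local Open Scope ring_scope.
(** * Nilpotent elements, exponentials and deformations *)

(** Units of $A((t))$ have in general no logarithm. So [cca] takes logarithms only of the factor in
    $1+t^{-1}A[t^{-1}]$, where nilpotence makes them finite sums. Its invariance under automorphisms
    is integration by parts if one argument is an exponential; for two unit power series it needs a
    deformation of its own. The derivative in $s$ is replaced by two homomorphisms $A[s]\to
    A[s][e]$, $s\mapsto s$ and $s\mapsto s+e$. Over $\mathbb Q$ a polynomial on which they agree is
    constant, and naturality of the cocycles turns this into an equality of their values at $s=0$
    and $s=1$. The parameter $s$ is not invertible. Scaling multiplies the matrix entry of $t^n$ in
    the image of $t^i$ by $s^{\pm(n-i)}$, and on triangular automorphisms only one sign occurs, so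
    $s=0$ is allowed. The factors are deformed in a fixed order: $h'$ against an infinitesimal
    element of $G_+$, then $k$. The deformation of $k$ produces a product $zh'$ whose new $G_-$
    factor is not under control, hence the infinitesimal case must be known for all of $G_-$. *)

Section Nilpotent.
Variable A : comPzRingType.
Implicit Types (x y a b : A) (s : seq A).

Lemma nilp0 : nilpotent (0 : A). Proof. by exists 1%N; rewrite expr1. Qed.

Lemma nilpM a x : nilpotent x -> nilpotent (a * x).
Proof. by case=> n xn; exists n; rewrite exprMn xn mulr0. Qed.

Lemma nilpMr a x : nilpotent x -> nilpotent (x * a).
Proof. by rewrite mulrC; exact: nilpM. Qed.

Lemma nilpN x : nilpotent x -> nilpotent (- x).
Proof. by move=> nx; rewrite -mulN1r; exact: nilpM. Qed.

Lemma expr_le0 x m n : (m <= n)%N -> x ^+ m = 0 -> x ^+ n = 0.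
Proof. by move=> le xm; rewrite -(subnK le) exprD xm mulr0. Qed.

Lemma exprD_eq0 x y m n k : x ^+ m = 0 -> y ^+ n = 0 -> (m + n <= k.+1)%N ->
  (x + y) ^+ k = 0.
Proof.
move=> xm yn le; rewrite exprDn big1 // => i _.
have [lei|lti] := leqP n i; first by rewrite (expr_le0 lei yn) mulr0 mul0rn.
by rewrite (@expr_le0 _ m) ?mul0r ?mul0rn//; have := ltn_ord i; lia.
Qed.

Lemma nilpD x y : nilpotent x -> nilpotent y -> nilpotent (x + y).
Proof.
by case=> m xm [n yn]; exists (m + n)%N; apply: exprD_eq0 xm yn _.
Qed.

Lemma nilpB x y : nilpotent x -> nilpotent y -> nilpotent (x - y).
Proof. by move=> nx /nilpN; exact: nilpD. Qed.

Lemma nilp_sum (I : eqType) (r : seq I) (F : I -> A) :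
  (forall i, i \in r -> nilpotent (F i)) -> nilpotent (\sum_(i <- r) F i).
Proof.
by move=> H; rewrite big_seq; apply: big_ind => //; [exact: nilp0|exact: nilpD].
Qed.

Lemma nilpX x n : nilpotent x -> nilpotent (x ^+ n.+1).
Proof. by rewrite exprS; exact: nilpMr. Qed.

Lemma nilp_unit x : nilpotent x -> exists y, (1 - x) * y = 1.
Proof.
by case=> n xn; exists (\sum_(i < n) x ^+ i); rewrite -opprB mulNr -subrX1 xn sub0r opprK.
Qed.

(** Invertibility can be tested modulo nilpotents: $ab$ is $1$ plus a nilpotent, hence a unit. *)
Lemma unit_modnil a b : nilpotent (a * b - 1) -> exists c, a * c = 1.
Proof.
move=> /nilpN /nilp_unit[y]; rewrite opprK addrC subrK => E.
by exists (b * y); rewrite mulrA.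
Qed.

Lemma idem_nilp (e : A) : e * e = e -> nilpotent e -> e = 0.
Proof.
move=> ee [n en]; have en1 : e ^+ n.+1 = e.
  by elim: n {en} => [|n IH]; rewrite ?expr1// exprS IH.
by rewrite -en1 exprS en mulr0.
Qed.

(** [pw s k] is the [k]-th power of the ideal generated by [s]. *)
Inductive pw s : nat -> A -> Prop :=
| pw_unit a : pw s 0 a
| pw_zero k : pw s k 0
| pw_add k a b : pw s k a -> pw s k b -> pw s k (a + b)
| pw_mul k x a : x \in s -> pw s k a -> pw s k.+1 (x * a).

Lemma pwMl s k r a : pw s k a -> pw s k (r * a).
Proof.
elim=> {k a} [a|k|k a b _ H1 _ H2|k x a xs _ IH].
- exact: pw_unit.
- by rewrite mulr0; exact: pw_zero.
- by rewrite mulrDr; exact: pw_add.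
- by rewrite mulrCA; exact: pw_mul.
Qed.

Lemma pwW s k a : pw s k.+1 a -> pw s k a.
Proof.
suff G l b : pw s l b -> forall k, l = k.+1 -> pw s k b by move=> /G; apply.
elim=> {l b} [//|l k' _|l a' b _ H1 _ H2 k' E|l x a' xs H IH k' [<-]].
- exact: pw_zero.
- by apply: pw_add; [exact: H1|exact: H2].
- exact: pwMl.
Qed.

Lemma pw_le s k l a : (k <= l)%N -> pw s l a -> pw s k a.
Proof.
elim: l => [|l IH]; first by rewrite leqn0 => /eqP ->.
by rewrite leq_eqVlt => /orP[/eqP ->//|/IH{}IH /pwW].
Qed.

Lemma pwM s k l a b : pw s k a -> pw s l b -> pw s (k + l) (a * b).
Proof.
move=> H Hb; elim: H => {k a} [a|k|k a c _ H1 _ H2|k x a xs _ IH].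
- exact: pwMl.
- by rewrite mul0r; exact: pw_zero.
- by rewrite mulrDl; exact: pw_add.
- by rewrite -mulrA addSn; exact: pw_mul.
Qed.

Lemma pw_sum s k (I : eqType) (r : seq I) (F : I -> A) :
  (forall i, i \in r -> pw s k (F i)) -> pw s k (\sum_(i <- r) F i).
Proof.
by move=> H; rewrite big_seq; apply: big_ind => //; [exact: pw_zero|exact: pw_add].
Qed.

Lemma pwN s k a : pw s k a -> pw s k (- a).
Proof. by rewrite -mulN1r; exact: pwMl. Qed.

Lemma pw_mem s x : x \in s -> pw s 1 x.
Proof. by move=> xs; rewrite -[x]mulr1; apply: pw_mul => //; exact: pw_unit. Qed.

Lemma pwX s k n a : pw s k a -> pw s (n * k) (a ^+ n).
Proof.
move=> H; elim: n => [|n IH]; first exact: pw_unit.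
by rewrite exprS mulSn; exact: pwM.
Qed.

(** Isolates one generator: the coefficients lie in powers of the ideal of the others, which permits
    induction on the list of generators. *)
Lemma pw_cons s y m k x : y ^+ m = 0 -> pw (y :: s) k x ->
  exists2 f : nat -> A, x = \sum_(l < m) y ^+ l * f l &
    forall l, pw s (k - l) (f l).
Proof.
move=> ym; elim=> {k x} [a|k|k a b _ [f -> Hf] _ [g -> Hg]|k x a xs _ [f -> Hf]].
- case: m ym => [|m] ym.
    exists (fun=> 0); last by move=> l; exact: pw_zero.
    by rewrite big_ord0 -[LHS]mulr1 -[X in _ * X](expr0 y) ym mulr0.
  exists (fun l => if l == 0%N then a else 0).
    by rewrite big_ord_recl /= mul1r big1 ?addr0// => i _; rewrite mulr0.
  by move=> l; rewrite sub0n; exact: pw_unit.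
- by exists (fun=> 0) => [|l]; [by rewrite big1// => i _; rewrite mulr0|exact: pw_zero].
- exists (fun l => f l + g l) => [|l]; last exact: pw_add.
  by rewrite -big_split /=; apply: eq_bigr => i _; rewrite mulrDr.
- move: xs; rewrite inE => /orP[/eqP ->|xs].
    exists (fun l => if l is l'.+1 then f l' else 0); last first.
      by case=> [|l]; [exact: pw_zero|rewrite subSS].
    case: m ym => [|m] ym; first by rewrite !big_ord0 mulr0.
    rewrite [RHS]big_ord_recl /= mulr0 add0r mulr_sumr big_ord_recr /=.
    rewrite [y * (_ * _)]mulrA -exprS ym mul0r addr0.
    by apply: eq_bigr => i _; rewrite mulrA -exprS.
  exists (fun l => x * f l) => [|l].
    by rewrite mulr_sumr; apply: eq_bigr => i _; rewrite mulrCA.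
  have [le|lt] := leqP l k; first by rewrite subSn//; exact: pw_mul.
  by rewrite (_ : (_ - _ = 0)%N); [exact: pw_unit|lia].
Qed.

(** If $y^m=0$ and the $N$-th power of the ideal of the other generators is zero, the exponent $m+N$
    works: in [pw_cons] the coefficient of $y^l$, $l<m$, lies in an ideal power at least the
    $N$-th. *)
Lemma pw_nilp s : (forall x, x \in s -> nilpotent x) ->
  exists N, forall x, pw s N x -> x = 0.
Proof.
elim: s => [|y s IH] ns.
  suff G l b : pw [::] l b -> l = 1%N -> b = 0 by exists 1%N => x /G; apply.
  by elim=> {l b} // k a b _ H1 _ H2 E; rewrite H1// H2// addr0.
have [|N HN] := IH; first by move=> x xs; apply: ns; rewrite inE xs orbT.
have [m ym] := ns y (mem_head _ _).
exists (m + N)%N => x /(pw_cons ym)[f -> Hf]; rewrite big1// => l _.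
rewrite (HN (f l)) ?mulr0//; apply: pw_le (Hf l).
by have := ltn_ord l; lia.
Qed.

Lemma pw1_nilp s x : (forall x, x \in s -> nilpotent x) -> pw s 1 x -> nilpotent x.
Proof.
move=> ns H; have [N HN] := pw_nilp ns; exists N; apply: HN.
by have := pwX N H; rewrite muln1.
Qed.

End Nilpotent.

(** * The exponential over a $\mathbb Q$-algebra *)

Definition isQ (A : comPzRingType) := forall n, exists r : A, r * n.+1%:R = 1.

Section Exp.
Variable A : comPzRingType.
Hypothesis QA : isQ A.
Implicit Types (x y a b : A).

Lemma isQ_nat n : (0 < n)%N -> exists r : A, r * n%:R = 1.
Proof. by case: n => // n _; exact: QA. Qed.

Lemma isQ_eq0 n x : (0 < n)%N -> x *+ n = 0 -> x = 0.
Proof.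
move=> /isQ_nat[r rn] H; rewrite -[x]mul1r -rn -mulrA mulr_natl H.
by rewrite mulr0.
Qed.

Definition qinv n : A := xget 0 [set r | r * n%:R = 1].

Lemma qinvP n : (0 < n)%N -> qinv n * n%:R = 1.
Proof. by move=> /isQ_nat[r rn]; apply: (@xgetPex _ 0 [set r | r * n%:R = 1]); exists r. Qed.

Lemma inv_uniq (x y z : A) : y * x = 1 -> z * x = 1 -> y = z.
Proof. by move=> E1 E2; rewrite -[LHS]mulr1 -E2 mulrCA E1 mulr1. Qed.

Lemma qinvM m n : (0 < m)%N -> (0 < n)%N -> qinv (m * n) = qinv m * qinv n.
Proof.
move=> m0 n0; apply: (@inv_uniq (m * n)%:R); first by rewrite qinvP// muln_gt0 m0.
by rewrite natrM mulrACA !qinvP// mulr1.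
Qed.

Lemma qinv1 : qinv 1 = 1.
Proof. by rewrite -[LHS]mulr1 -[X in _ * X]mulr1n qinvP. Qed.

Definition expt N x : A := \sum_(k < N) qinv k`! * x ^+ k.
(** The series stops at a chosen exponent that kills $x$; [expt_eq] makes the choice immaterial. If
    $x$ is not nilpotent, the value is the empty sum $0$. *)
Definition exp x := expt (xget 0%N [set N | x ^+ N = 0]) x.

Lemma expt_eq N M x : x ^+ N = 0 -> x ^+ M = 0 -> expt N x = expt M x.
Proof.
wlog le : N M / (N <= M)%N.
  by move=> H xN xM; have [/H->|/ltnW/H->] := leqP N M.
move=> xN _; rewrite /expt -(subnKC le) big_split_ord /= [X in _ + X]big1 ?addr0// => i _.
by rewrite exprD xN mul0r mulr0.
Qed.

Lemma expE N x : x ^+ N = 0 -> exp x = expt N x.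
Proof.
move=> xN; apply: expt_eq => //.
by apply: (@xgetPex _ _ [set N | x ^+ N = 0]); exists N.
Qed.

Lemma exp0 : exp 0 = 1.
Proof. by rewrite (@expE 1) ?expr1// /expt big_ord1 fact0 qinv1 mulr1. Qed.

Lemma bin_qinv n m : (m <= n)%N ->
  qinv n`! *+ 'C(n, m) = qinv (n - m)`! * qinv m`!.
Proof.
move=> le; apply: (@inv_uniq (m`! * (n - m)`!)%:R); last first.
  by rewrite natrM [X in X * _]mulrC mulrACA !qinvP ?fact_gt0// mulr1.
by rewrite mulrnAl -mulrnAr -mulrnA mulnC bin_fact// qinvP// fact_gt0.
Qed.

Lemma sum_triangle (F : nat -> nat -> A) M :
  \sum_(k < M) \sum_(i < k.+1) F (k - i)%N i =
  \sum_(i < M) \sum_(j < M - i) F j i.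
Proof.
elim: M => [|M IH]; first by rewrite !big_ord0.
rewrite big_ord_recr {}IH /= [in RHS]big_ord_recr /= subSnn big_ord1.
rewrite [\sum_(i < M.+1) _]big_ord_recr /= subnn addrA -big_split /=.
by congr (_ + _); apply: eq_bigr => i _; rewrite subSn ?big_ord_recr// ltnW.
Qed.

Lemma expD x y : nilpotent x -> nilpotent y -> exp (x + y) = exp x * exp y.
Proof.
case=> m xm [n yn]; pose M := (m + n)%N.
have xM : x ^+ M = 0 by apply: expr_le0 xm; rewrite leq_addr.
have yM : y ^+ M = 0 by apply: expr_le0 yn; rewrite leq_addl.
rewrite (@expE M (x + y)); last by exact: exprD_eq0 xm yn _.
rewrite (expE xM) (expE yM) /expt.
pose F j i := (qinv j`! * x ^+ j) * (qinv i`! * y ^+ i).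
transitivity (\sum_(k < M) \sum_(i < k.+1) F (k - i)%N i).
  apply: eq_bigr => k _; rewrite exprDn mulr_sumr; apply: eq_bigr => i _.
  rewrite /F mulrACA -(@bin_qinv k i (ltn_ord i)). by rewrite mulrnAr mulrnAl.
rewrite sum_triangle mulr_sumr; apply: eq_bigr => i _; rewrite mulr_suml.
rewrite -(big_mkord xpredT (fun j => F j i)) -(big_mkord xpredT (fun j => F j i)).
rewrite [RHS](big_cat_nat (n := (M - i)%N)) ?leq_subr//=.
(* The triangle is completed to the square: if $i+j\ge m+n$, then $i\ge n$ or $j\ge m$. *)
rewrite [X in _ + X]big_nat [X in _ + X]big1 ?addr0// => j /andP[le _].
rewrite /F mulrACA; have [lei|lti] := leqP n i.
  by rewrite (expr_le0 lei yn) !mulr0.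
by rewrite (@expr_le0 _ _ m j) ?mul0r ?mulr0//; lia.
Qed.

Lemma expNr x : nilpotent x -> exp (- x) * exp x = 1.
Proof. by move=> nx; rewrite -expD ?addNr ?exp0//; exact: nilpN. Qed.

Lemma exp_quad x : nilpotent x -> exists r, exp x = 1 + x + x * x * r.
Proof.
case=> n xn; have xn2 : x ^+ n.+2 = 0 by apply: expr_le0 xn; lia.
exists (\sum_(k < n) qinv k.+2`! * x ^+ k).
rewrite (expE xn2) /expt !big_ord_recl /= fact0 !qinv1 !mul1r addrA; congr (_ + _).
by rewrite mulr_sumr; apply: eq_bigr => i _; rewrite !exprS; ring.
Qed.

Lemma exp_nilp x : nilpotent x -> nilpotent (exp x - 1).
Proof.
move=> nx; have [r ->] := exp_quad nx.
by rewrite (_ : _ - 1 = x * (1 + x * r)); [exact: nilpMr|ring].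
Qed.

Lemma exp_eq1 x : nilpotent x -> exp x = 1 -> x = 0.
Proof.
move=> nx; have [r ->] := exp_quad nx => E.
have [y xy] := nilp_unit (nilpN (nilpMr r nx)).
rewrite -[x]mulr1 -xy mulrA (_ : x * _ = (1 + x + x * x * r) - 1); last by ring.
by rewrite E subrr mul0r.
Qed.

Lemma exp_inj x y : nilpotent x -> nilpotent y -> exp x = exp y -> x = y.
Proof.
move=> nx ny E; apply/eqP; rewrite -subr_eq0; apply/eqP/exp_eq1.
  exact: nilpB.
by rewrite expD ?E; [rewrite mulrC expNr|by []|exact: nilpN].
Qed.

Lemma exp_sq x : x * x = 0 -> exp x = 1 + x.
Proof.
move=> xx; have [|r ->] := @exp_quad x; first by exists 2%N.
by rewrite xx mul0r addr0.
Qed.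

Lemma exp_mulrn x n : nilpotent x -> exp (x *+ n) = exp x ^+ n.
Proof.
move=> nx; elim: n => [|n IH]; first by rewrite mulr0n exp0.
by rewrite mulrS exprS expD ?IH// -mulr_natl; exact: nilpM.
Qed.

Lemma exp_sum (I : Type) (r : seq I) (F : I -> A) :
  (forall i, nilpotent (F i)) ->
  exp (\sum_(i <- r) F i) = \prod_(i <- r) exp (F i).
Proof.
move=> H; elim: r => [|i r IH]; first by rewrite !big_nil exp0.
rewrite !big_cons expD ?IH//; elim: r {IH} => [|j r IH]; first by rewrite big_nil; exact: nilp0.
by rewrite big_cons; apply: nilpD.
Qed.

Section Derivation.
Variable d : A -> A.
Hypothesis dD : {morph d : x y / x + y}.
Hypothesis dM : forall x y, d (x * y) = d x * y + x * d y.

Lemma der0 : d 0 = 0.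
Proof. by apply: (@addrI _ (d 0)); rewrite -dD !addr0. Qed.

Lemma der1 : d 1 = 0.
Proof. by apply: (@addrI _ (d 1)); have := dM 1 1; rewrite !mulr1 mul1r addr0 => <-. Qed.

Lemma derMn x n : d (x *+ n) = d x *+ n.
Proof. by elim: n => [|n IH]; rewrite ?mulr0n ?der0// !mulrS dD IH. Qed.

Lemma der_qinv n : (0 < n)%N -> d (qinv n) = 0.
Proof.
move=> n0; apply: (isQ_eq0 n0); rewrite -derMn -mulr_natr qinvP//.
exact: der1.
Qed.

Lemma derX x n : d (x ^+ n.+1) = (x ^+ n * d x) *+ n.+1.
Proof.
elim: n => [|n IH]; first by rewrite expr1 mul1r.
by rewrite exprS dM IH [in RHS]mulrS exprS -mulrnAr mulrA mulrC mulrA mulrC; ring.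
Qed.

Lemma der_sum (I : Type) (r : seq I) (F : I -> A) :
  d (\sum_(i <- r) F i) = \sum_(i <- r) d (F i).
Proof. exact: (big_morph d dD der0). Qed.

(** A derivation kills the rational constants, so termwise differentiation shifts the index by one;
    the left side is truncated one term later to match. *)
Lemma der_exp x : nilpotent x -> d (exp x) = exp x * d x.
Proof.
case=> N xN; have xN1 : x ^+ N.+1 = 0 by exact: expr_le0 xN.
rewrite [in LHS](expE xN1) [in RHS](expE xN) /expt der_sum big_ord_recl /=.
rewrite dM der1 mulr0 addr0 der_qinv// mul0r add0r mulr_suml.
apply: eq_bigr => k _; rewrite dM der_qinv ?fact_gt0// mul0r add0r /bump leq0n add1n.
rewrite derX factS qinvM ?fact_gt0// -mulr_natl !mulrA (mulrAC (qinv _)).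
by rewrite qinvP// mul1r.
Qed.
End Derivation.

End Exp.

Section ExpMorph.
Variables (A B : comPzRingType) (f : {rmorphism A -> B}).
Hypothesis QA : isQ A.

Lemma isQ_morph : isQ B.
Proof.
by move=> n; have [r rn] := QA n; exists (f r); rewrite -(rmorph_nat f) -rmorphM rn rmorph1.
Qed.

Lemma nilp_morph x : nilpotent x -> nilpotent (f x).
Proof. by case=> n xn; exists n; rewrite -rmorphXn xn rmorph0. Qed.

Lemma qinv_morph n : (0 < n)%N -> f (qinv A n) = qinv B n.
Proof.
move=> n0; apply: (@inv_uniq _ n%:R); last exact: (qinvP isQ_morph).
by rewrite -(rmorph_nat f) -rmorphM qinvP// rmorph1.
Qed.

Lemma exp_morph x : nilpotent x -> f (exp x) = exp (f x).
Proof.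
case=> N xN; have fxN : f x ^+ N = 0 by rewrite -rmorphXn xN rmorph0.
rewrite (expE xN) (expE fxN) rmorph_sum /=; apply: eq_bigr => k _.
by rewrite rmorphM rmorphXn qinv_morph ?fact_gt0.
Qed.
End ExpMorph.

(** * Dual numbers and polynomial deformations *)

Definition dual (R : Type) : Type := (R * R)%type.

Section Dual.
Variable R : comPzRingType.
HB.instance Definition _ := GRing.Zmodule.copy (dual R) (R * R)%type.
Implicit Types x y z : dual R.

Definition dual1 : dual R := (1, 0).
Definition dual_mul x y : dual R := (x.1 * y.1, x.1 * y.2 + x.2 * y.1).

Lemma dual_mulA : associative dual_mul.
Proof. by move=> x y z; rewrite /dual_mul /=; congr pair; ring. Qed.
Lemma dual_mulC : commutative dual_mul.
Proof. by move=> x y; rewrite /dual_mul /=; congr pair; ring. Qed.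
Lemma dual_mul1 : left_id dual1 dual_mul.
Proof. by case=> x1 x2; rewrite /dual_mul /=; congr pair; ring. Qed.
Lemma dual_mulD : left_distributive dual_mul +%R.
Proof. by case=> x1 x2 [y1 y2] [z1 z2]; rewrite /dual_mul /=; congr pair; rewrite /=; ring. Qed.

HB.instance Definition _ := GRing.Zmodule_isComPzRing.Build (dual R)
  dual_mulA dual_mulC dual_mul1 dual_mulD.

Section DualMorph.
Variables (S : comPzRingType) (f : {rmorphism S -> R}) (d : S -> R).
Hypothesis dB : {morph d : x y / x - y}.
Hypothesis dM : forall x y : S, d (x * y) = f x * d y + d x * f y.

(** A ring homomorphism to the dual numbers that lifts [f] is the same as a derivation along [f]. *)
Definition dual_map (x : S) : dual R := (f x, d x).

Lemma dual_map_zmod : zmod_morphism dual_map.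
Proof. by move=> x y; rewrite /dual_map rmorphB dB. Qed.
Lemma dual_map_monoid : monoid_morphism dual_map.
Proof.
split=> [|x y]; last by rewrite /dual_map rmorphM dM.
rewrite /dual_map rmorph1; congr pair; apply: (@addrI _ (d 1)).
by rewrite addr0 -[in RHS](mulr1 1) dM !rmorph1 mul1r mulr1.
Qed.
Definition dual_rmorph : {rmorphism S -> dual R} :=
  HB.pack dual_map (GRing.isZmodMorphism.Build S (dual R) dual_map dual_map_zmod)
    (GRing.isMonoidMorphism.Build S (dual R) dual_map dual_map_monoid).
End DualMorph.
End Dual.

(** A model of $A[s]$, with the evaluations [df0] and [df1] at $s = 0$ and
    $s = 1$ and the homomorphisms [dfi] and [dft] to $A[s][e]$, $e^2 = 0$, that
    map $s$ to $s$ and to $s + e$. By [df_const] a polynomial that is invariant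
    under the infinitesimal translation is constant: this needs
    $\mathbb Q \subset A$. *)
Record deformation (A : comPzRingType) := Deformation {
  dfS : comPzRingType;
  dfT : comPzRingType;
  dfc : {rmorphism A -> dfS};
  dfs : dfS;
  df0 : {rmorphism dfS -> A};
  df1 : {rmorphism dfS -> A};
  dfi : {rmorphism dfS -> dfT};
  dft : {rmorphism dfS -> dfT};
  dfe : dfT;
  df0c : forall a, df0 (dfc a) = a;
  df1c : forall a, df1 (dfc a) = a;
  df0s : df0 dfs = 0;
  df1s : df1 dfs = 1;
  dfee : dfe * dfe = 0;
  dfit : forall p, exists q, dft p = dfi p + dfe * q;
  dftc : forall a, dft (dfc a) = dfi (dfc a);
  df_const : forall p, dft p = dfi p -> df0 p = df1 p }.

Section Deform.
Variable A : comNzRingType.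
Hypothesis QA : isQ A.

Lemma deriv_eq0 (p : {poly A}) : p^`() = 0 -> p = (p`_0)%:P.
Proof.
move=> p0; apply/polyP => -[|i]; first by rewrite coefC.
rewrite coefC /=; have := coef_deriv p i; rewrite p0 poly.coef0 => /esym.
exact: isQ_eq0.
Qed.

Lemma deform_nz : deformation A.
Proof.
pose d1 (p : {poly A}) : {poly A} := p^`().
have d1B : {morph d1 : x y / x - y} by move=> x y; exact: derivB.
have d1M (x y : {poly A}) : d1 (x * y) = x * d1 y + d1 x * y by rewrite /d1 derivM addrC.
have zB : {morph (fun _ : {poly A} => 0 : {poly A}) : x y / x - y}.
  by move=> x y; rewrite subr0.
have zM (x y : {poly A}) : 0 = x * 0 + 0 * y :> {poly A} by rewrite mulr0 mul0r addr0.
(* [th] is $p(s)\mapsto p(s+e)=p+ep'$ and [io] is the inclusion; they agree on $p$ exactly when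
   $p'=0$. *)
pose th := @dual_rmorph _ _ idfun d1 d1B d1M.
pose io := @dual_rmorph _ _ idfun (fun=> 0) zB zM.
refine (@Deformation A {poly A} (dual {poly A}) polyC 'X (horner_eval 0)
  (horner_eval 1) io th ((0 : {poly A}, 1 : {poly A}) : dual {poly A}) _ _ _ _ _ _ _ _).
- by move=> a; rewrite /= /horner_eval hornerC.
- by move=> a; rewrite /= /horner_eval hornerC.
- by rewrite /= /horner_eval hornerX.
- by rewrite /= /horner_eval hornerX.
- by congr pair; rewrite /= ?mul0r ?mulr0 ?addr0.
- move=> p; exists ((d1 p, 0) : dual _).
  by congr pair; rewrite /= ?mul0r ?mul1r ?mulr0 ?addr0 ?add0r.
- by move=> a; congr pair; rewrite /d1 derivC.
- move=> p [/deriv_eq0 ->]; by rewrite /= /horner_eval !hornerC.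
Qed.

(** A variable is introduced in order to differentiate. With $C=cX$, the derivative of
    $\exp(\log(1-C))/(1-C)$ vanishes, so this quotient is constant, equal to its value $1$ at $X=0$.
    Then $X=1$ gives the claim. *)
Lemma exp_log_nz (c : A) N : c ^+ N = 0 ->
  exp (- \sum_(i < N) qinv A i.+1 * c ^+ i.+1) = 1 - c.
Proof.
move=> cN; have QP : isQ {poly A} := isQ_morph polyC QA.
pose C : {poly A} := c *: 'X.
have CN : C ^+ N = 0 by rewrite exprZn cN scale0r.
pose l : {poly A} := - \sum_(i < N) qinv _ i.+1 * C ^+ i.+1.
have nC : nilpotent C by exists N.
have nl : nilpotent l.
  by apply: nilpN; apply: nilp_sum => i _; apply/nilpM/nilpX.
pose P := exp l; pose G := \sum_(i < N) C ^+ i.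
have CG : (1 - C) * G = 1.
  by rewrite -opprB mulNr -subrX1 CN sub0r opprK.
have dA : {morph (@deriv A) : x y / x + y} by move=> x y; exact: derivD.
have dM (x y : {poly A}) : (x * y)^`() = x^`() * y + x * y^`() by exact: derivM.
have dC : C^`() = c%:P by rewrite derivZ derivX alg_polyC.
have dl : l^`() = - (c%:P * G).
  rewrite derivN (der_sum dA); congr (- _); rewrite mulr_sumr.
  apply: eq_bigr => i _; rewrite dM (der_qinv QP dA dM)// mul0r add0r.
  by rewrite (derX dM) dC -mulr_natl !mulrA qinvP// mul1r mulrC.
have dG : G^`() = c%:P * G * G.
  have : ((1 - C) * G)^`() = 0 by rewrite CG derivC.
  rewrite dM derivB derivC sub0r dC => E.
  have E1 : (1 - C) * G^`() = c%:P * G by rewrite -[LHS]subr0 -E; ring.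
  by rewrite -[LHS]mul1r -CG mulrAC E1.
have PG : (P * G)^`() = 0.
  by rewrite dM (der_exp QP dA dM nl) dl dG -/P mulrN mulNr -!mulrA addNr.
have PG1 : P * G = 1.
  rewrite (deriv_eq0 PG) -horner_coef0 hornerM.
  rewrite -[P.[0]]/((horner_eval (0 : A) : {rmorphism {poly A} -> A}) P) (exp_morph _ QP nl).
  have -> : (horner_eval (0 : A) : {rmorphism {poly A} -> A}) l = 0.
    rewrite rmorphN rmorph_sum big1 ?oppr0//= => i _.
    by rewrite rmorphM rmorphXn /= /horner_eval hornerZ hornerX mulr0 expr0n mulr0.
  (* For $N=0$ the hypothesis reads $1=0$, which is excluded over a nonzero ring. *)
  rewrite exp0// mul1r /G; case: N {CN l nl P G CG dl dG PG} cN => [|N] cN.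
    by move/eqP: cN; rewrite expr0 oner_eq0.
  suff -> : (\sum_(i < N.+1) C ^+ i).[0] = 1 by [].
  rewrite -[LHS]/((horner_eval (0 : A) : {rmorphism {poly A} -> A}) _) rmorph_sum.
  rewrite big_ord_recl /= big1 ?addr0 => [|i _]; last first.
    by rewrite rmorphXn /= /horner_eval hornerZ hornerX mulr0 expr0n.
  by rewrite /horner_eval expr0 hornerC.
have P1 : P = 1 - C by rewrite -[LHS]mulr1 -[X in _ * X]CG mulrCA PG1 mulr1.
have := congr1 (horner_eval (1 : A) : {rmorphism {poly A} -> A}) P1.
rewrite (exp_morph _ QP nl) rmorphB rmorph1 /= {2}/horner_eval hornerZ hornerX mulr1 => <-.
congr exp; rewrite rmorphN rmorph_sum; congr (- _); apply: eq_bigr => i _.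
rewrite rmorphM rmorphXn (qinv_morph _ QP)//= /horner_eval hornerZ hornerX mulr1.
by [].
Qed.
End Deform.

(** [{poly A}] requires [A] to be a nonzero ring. *)
Lemma nz_structure (P : comPzRingType -> Type) :
  (forall A : comNzRingType, P A) ->
  forall A : comPzRingType, (1 : A) != 0 -> P A.
Proof.
move=> H [T c] ne.
pose A' : comNzRingType := HB.pack T (GRing.ComPzRing.Pack c)
  (GRing.PzSemiRing_isNonZero.Build (GRing.ComPzRing.Pack c) ne).
move: (H A'); rewrite /A' {A'}; by case: c ne.
Qed.

Section DeformPz.
Variable A : comPzRingType.
Hypothesis QA : isQ A.

Lemma deform : deformation A.
Proof.
have [E|ne] := eqVneq (1 : A) 0.
  have A0 (x y : A) : x = y by rewrite -[x]mulr1 -[y]mulr1 E !mulr0.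
  (* Over the zero ring all equations hold, and $A$ with identity maps will do. *)
  by refine (@Deformation A A A idfun 0 idfun idfun idfun idfun 0 _ _ _ _ _ _ _ _)
    => *; try (exists 0).
apply: (@nz_structure (fun A => isQ A -> deformation A)) => // A'.
exact: deform_nz.
Qed.

Lemma exp_log (c : A) N : c ^+ N = 0 ->
  exp (- \sum_(i < N) qinv A i.+1 * c ^+ i.+1) = 1 - c.
Proof.
have [E|ne] := eqVneq (1 : A) 0.
  by move=> _; rewrite -[LHS]mulr1 -[RHS]mulr1 E !mulr0.
move: QA c N; apply: (@nz_structure (fun A => isQ A -> forall c N, _)) => // A'.
exact: exp_log_nz.
Qed.
End DeformPz.

(* Conversion must not unfold the arithmetic of Laurent series. *)
Opaque laurent_add laurent_opp laurent_mul laurent_scale laurent0 conv.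

(** * Laurent series and their automorphisms *)

Section LaurentBasics.
Variable A : comPzRingType.
Implicit Types (f g h : laurent A) (i j n : int).

(** The bound is strict, so that [low i] and [tpow i] cut out complementary summands of $A((t))$. *)
Definition low i f := forall n, i <= n -> f n = 0.

Lemma lowD i f g : low i f -> low i g -> low i (f + g).
Proof. by move=> Hf Hg n le; rewrite coefD Hf// Hg// addr0. Qed.
Lemma lowN i f : low i f -> low i (- f).
Proof. by move=> Hf n le; rewrite coefN Hf// oppr0. Qed.
Lemma lowB i f g : low i f -> low i g -> low i (f - g).
Proof. by move=> Hf Hg; apply/lowD/lowN. Qed.
Lemma low_le i j f : i <= j -> low i f -> low j f.
Proof. by move=> le Hf n len; apply: Hf; lia. Qed.
Lemma low0 i : low i 0. Proof. by []. Qed.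
Lemma low_mono i j : i < j -> low j (mono A i).
Proof. by move=> lt n le; rewrite coef_mono gt_eqF//; lia. Qed.

Lemma low_tpow0 i f : low i f -> tpow i f -> f = 0.
Proof.
by move=> Hl Ht; apply: laurentP => n; have [/Ht|/Hl] := ltP n i.
Qed.

Lemma hi_subproof i f : exists N : int, forall n, n < N -> (if i <= n then f n else 0) = 0.
Proof. by exists i => n; rewrite ltNge => /negPf ->. Qed.
Definition hi i f : laurent A := Laurent (hi_subproof i f).

Lemma hi_tpow i f : tpow i (hi i f).
Proof. by move=> n; rewrite /= ltNge => /negPf ->. Qed.
Lemma hi_low i f : low i (f - hi i f).
Proof. by move=> n le; rewrite coefB /= le subrr. Qed.
Lemma hi_id i f : tpow i f -> hi i f = f.
Proof. by move=> Hf; apply: laurentP => n /=; case: leP => // /Hf ->. Qed.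
Lemma hi_eq0 i f : low i f -> hi i f = 0.
Proof. by move=> Hf; apply: laurentP => n /=; case: leP => // /Hf ->. Qed.
Lemma hi_linear i : linear (hi i).
Proof.
by move=> a f g; apply: laurentP => n; rewrite coefD coefZ /=; case: leP; rewrite ?mulr0 ?addr0.
Qed.
HB.instance Definition _ i :=
  GRing.isLinear.Build A (laurent A) (laurent A) _ (hi i) (@hi_linear i).
Lemma prE f : pr f = hi 0 f.
Proof. exact: laurentP. Qed.
Lemma hi_le_tpow i j f : tpow j f -> tpow j (hi i f).
Proof. by move=> Hf n /Hf /= ->; rewrite if_same. Qed.
Lemma hi_contlin i : contlin (hi i).
Proof. by split; [exact: hi_linear|move=> n; exists n => f; exact: hi_le_tpow]. Qed.

(** A coefficient of a product is a finite sum of products of coefficients. Vanishing, nilpotence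
    and membership in ideal powers are all propagated by this principle and by its analogue
    [contlin_ind]. *)
Lemma coefM_ind (P : A -> Prop) f g n : P 0 -> (forall a b, P a -> P b -> P (a + b)) ->
  (forall i, P (f i * g (n - i))) -> P ((f * g) n).
Proof.
move=> P0 PD H; have [a Hf] := tpow_ex f; have [b Hg] := tpow_ex g.
rewrite [(f * g) n](convE (s := iv a (absz (n - b + 1 - a)%R)) Hf Hg (iv_uniq _ _)).
  by apply: big_ind.
by move=> i; rewrite mem_iv; lia.
Qed.

Lemma coefM1 s f g n : uniq s -> (forall i, i \notin s -> f i * g (n - i) = 0) ->
  (f * g) n = \sum_(i <- s) f i * g (n - i).
Proof. by move=> us H; rewrite coefM; exact: fsum_seq. Qed.

Lemma coefM_low a b f g : tpow a f -> tpow b g -> (f * g) (a + b) = f a * g b.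
Proof.
move=> Hf Hg; rewrite (@coefM1 [:: a] f g (a + b) isT) ?big_seq1 ?(addrC a) ?addrK// => i.
rewrite inE => ia; have [lt|le] := ltP i a; first by rewrite Hf// mul0r.
by rewrite Hg ?mulr0//; lia.
Qed.

(** Degree at most $i$ plus degree at most $j-1$; the asymmetric bounds reflect that [low] is
    strict. *)
Lemma lowM i j f g : low (i + 1) f -> low j g -> low (i + j) (f * g).
Proof.
move=> Hf Hg n le; apply: (@coefM_ind (fun x => x = 0)) => // [a b -> ->|k].
  by rewrite addr0.
have [lt|le'] := ltP i k; first by rewrite Hf ?mul0r//; lia.
by rewrite Hg ?mulr0//; lia.
Qed.

Lemma tpowX n k f : tpow n f -> tpow (n * k%:Z) (f ^+ k).
Proof.
move=> Hf; elim: k => [|k IH]; first by rewrite mulr0 expr0; exact: tpow_mono.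
by rewrite exprS (_ : n * k.+1%:Z = n + n * k%:Z); [exact: tpowM|lia].
Qed.

Lemma tpowX0 k f : tpow 0 f -> tpow 0 (f ^+ k).
Proof. by move=> /(tpowX (k := k)); rewrite mul0r. Qed.

Lemma tpow1 n : n <= 0 -> tpow n (1 : laurent A).
Proof. exact: tpow_mono. Qed.

Lemma tpowM0 n f g : tpow 0 f -> tpow n g -> tpow n (f * g).
Proof. by move=> Hf Hg; rewrite -(add0r n); exact: tpowM. Qed.

Lemma tpow_sum (I : eqType) (r : seq I) (F : I -> laurent A) n :
  (forall i : I, i \in r -> tpow n (F i)) -> tpow n (\sum_(i <- r) F i).
Proof. by move=> H; rewrite big_seq; apply: big_ind => // f g; exact: tpowD. Qed.

Lemma low_sum (I : eqType) (r : seq I) (F : I -> laurent A) n :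
  (forall i : I, i \in r -> low n (F i)) -> low n (\sum_(i <- r) F i).
Proof. by move=> H; rewrite big_seq; apply: big_ind => // f g; exact: lowD. Qed.

Lemma coefX_low n k f : tpow n f -> (f ^+ k) (n * k%:Z) = f n ^+ k.
Proof.
move=> Hf; elim: k => [|k IH]; first by rewrite mulr0 !expr0.
rewrite !exprS (_ : n * k.+1%:Z = n + n * k%:Z); last by lia.
by rewrite coefM_low ?IH//; exact: tpowX.
Qed.

Lemma contlin_ind (P : A -> Prop) (L : laurent A -> laurent A) f n : contlin L ->
  P 0 -> (forall a b, P a -> P b -> P (a + b)) ->
  (forall i, P (f i * L (mono A i) n)) -> P (L f n).
Proof.
move=> LP P0 PD H; have [a Hf] := tpow_ex f; have [m Hm] := LP.2 (n + 1).
have HK g : tpow (a + (absz (m - a)%R)%:Z) g -> tpow (n + 1) (L g).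
  by move=> Hg; apply: Hm; apply: tpow_le Hg; lia.
by rewrite (contlinE LP Hf HK); apply: big_ind.
Qed.

Definition nilS j f := forall n, n < j -> nilpotent (f n).

Lemma nilSM i j f g : nilS i f -> nilS j g -> nilS (i + j) (f * g).
Proof.
move=> Hf Hg n lt; apply: coefM_ind => [||k]; [exact: nilp0|exact: nilpD|].
have [lti|le] := ltP k i; first by apply/nilpMr/Hf.
by apply/nilpM/Hg; lia.
Qed.

Lemma nilS_tpow j f : tpow j f -> nilS j f.
Proof. by move=> Hf n /Hf ->; exact: nilp0. Qed.

Lemma nilSX j k f : nilS j f -> nilS (j * k%:Z) (f ^+ k).
Proof.
move=> Hf; elim: k => [|k IH]; first by rewrite mulr0 expr0; apply/nilS_tpow/tpow1.
by rewrite exprS (_ : j * k.+1%:Z = j + j * k%:Z); [exact: nilSM|lia].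
Qed.

(** Modulo nilpotents, $f$ and $g$ have leading terms in degrees $i$ and $j$, and leading
    coefficients multiply. *)
Lemma nilS_coefM i j f g : nilS i f -> nilS j g ->
  nilpotent ((f * g) (i + j) - f i * g j).
Proof.
move=> Hf Hg.
have -> : (f * g) (i + j) - f i * g j =
   ((f - f i *: mono A i) * g) (i + j).
  rewrite [in RHS]mulrBl [RHS]coefB -scale_laurentAl [X in _ = _ - X]coefZ.
  rewrite (mulrC (mono A i)) [X in _ = _ - _ * X]coefMmono.
  by rewrite (addrC i) addrK.
apply: coefM_ind => [||k]; [exact: nilp0|exact: nilpD|].
rewrite coefB coefZ coef_mono; have [->|ne] := eqVneq k i.
  by rewrite mulr1 subrr mul0r; exact: nilp0.
rewrite mulr0 subr0; have [lti|le] := ltP k i; first by apply/nilpMr/Hf.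
by apply/nilpM/Hg; lia.
Qed.

(** Turns scalings into products, so that [ring] can decide identities that involve them. *)
Definition cst (a : A) : laurent A := a *: (1 : laurent A).
Lemma scale_cst a f : a *: f = cst a * f.
Proof. by rewrite /cst -scale_laurentAl mul1r. Qed.
Lemma cst_zmod : zmod_morphism cst.
Proof. by move=> a b; rewrite /cst scalerBl. Qed.
Lemma cst_monoid : monoid_morphism cst.
Proof. by split=> [|a b]; [exact: scale1r|rewrite -scale_cst /cst scalerA]. Qed.
HB.instance Definition _ := GRing.isZmodMorphism.Build A (laurent A) cst cst_zmod.
HB.instance Definition _ := GRing.isMonoidMorphism.Build A (laurent A) cst cst_monoid.

Lemma nilp_scale a f : nilpotent a -> nilpotent (a *: f).
Proof.
rewrite (scale_cst a f) => /(nilp_morph cst).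
exact: nilpMr.
Qed.

(** Induction on the degree: once the lower terms, with coefficients already known to be nilpotent,
    are subtracted, the coefficient leads, and the leading coefficient of a power is the power of
    the leading one. *)
Lemma nilp_coef f : nilpotent f -> forall n, nilpotent (f n).
Proof.
move=> nf n; have [a Hf] := tpow_ex f.
suff H k : forall n, n < a + k%:Z -> nilpotent (f n) by apply: (H (absz (n - a + 1)%R)); lia.
elim: k => [|k IH] {}n lt; first by rewrite Hf; [exact: nilp0|lia].
have [->|ne] := eqVneq n (a + k%:Z); last by apply: IH; lia.
set g := f - \sum_(i <- iv a k) f i *: mono A i.
have Hg : tpow (a + k%:Z) g by exact: trunc_tpow.
have [N gN] : nilpotent g.
  apply: nilpB => //; apply: nilp_sum => i; rewrite mem_iv => ik.
  by apply/nilp_scale/IH; lia.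
have -> : f (a + k%:Z) = g (a + k%:Z).
  rewrite /g coefB coef_sum big_seq big1 ?subr0// => i; rewrite mem_iv => ik.
  by rewrite coefZ coef_mono (_ : (_ == _) = false) ?mulr0//; lia.
by exists N; rewrite -coefX_low// gN.
Qed.

Lemma nilp_low f i : low i f -> (forall n, nilpotent (f n)) -> nilpotent f.
Proof.
move=> Hl nf; have [a Hf] := tpow_ex f.
have -> : f = \sum_(j <- iv a (absz (Num.max i a - a)%R)) f j *: mono A j.
  have H := @trunc_tpow _ a (absz (Num.max i a - a)%R) f Hf; apply/eqP; rewrite -subr_eq0;
    apply/eqP.
  apply: (@low_tpow0 (Num.max i a)); last by apply: tpow_le H; lia.
  apply: lowB; first by apply: low_le Hl; lia.
  apply: low_sum => j; rewrite mem_iv => jk n le.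
  by rewrite coefZ coef_mono gt_eqF ?mulr0//; lia.
by apply: nilp_sum => j _; exact: nilp_scale.
Qed.

Lemma isQ_laurent : isQ A -> isQ (laurent A).
Proof.
exact: (isQ_morph cst). Qed.

End LaurentBasics.

(** * Geometric series of operators that raise the order *)

Section Neumann.
Variables (A : comPzRingType) (N : laurent A -> laurent A).
Hypothesis Nlin : linear N.
Hypothesis Nup : forall n f, tpow n f -> tpow (n + 1) (N f).
Implicit Types (f g : laurent A).

Let N' : {linear laurent A -> laurent A} :=
  HB.pack N (GRing.isLinear.Build _ _ _ _ N Nlin).
Let NB f g : N (f - g) = N f - N g. Proof. exact: (raddfB N'). Qed.
Let ND f g : N (f + g) = N f + N g. Proof. exact: (raddfD N'). Qed.
Let Nsum K (F : nat -> laurent A) : N (\sum_(k < K) F k) = \sum_(k < K) N (F k).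
Proof. exact: (raddf_sum N'). Qed.

Lemma iter_tpow a k f : tpow a f -> tpow (a + k%:Z) (iter k N f).
Proof.
move=> Hf; elim: k => [|k IH]; first by rewrite addr0.
by rewrite /= (_ : a + k.+1%:Z = a + k%:Z + 1); [exact: Nup|lia].
Qed.

Definition nsum K f : laurent A := \sum_(k < K) iter k N f.

Lemma nsum_eq a K K' f n : tpow a f -> n < a + K%:Z -> n < a + K'%:Z ->
  nsum K f n = nsum K' f n.
Proof.
wlog le : K K' / (K <= K')%N.
  by move=> H Hf lt lt'; have [/H->|/ltnW/H->] := leqP K K'.
move=> Hf lt _; rewrite /nsum -(subnKC le) big_split_ord /= coefD !coef_sum.
rewrite [X in _ + X]big1 ?addr0// => k _.
by rewrite (@iter_tpow _ (K + k) _ Hf)//; lia.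
Qed.

Let af f : int := xget 0 [set a | tpow a f].
Let afP f : tpow (af f) f.
Proof. by have := tpow_ex f; exact: (@xgetPex _ 0 [set a | tpow a f]). Qed.

Lemma ncoef_subproof f : exists M : int, forall n, n < M ->
  nsum (absz (n - af f)).+1 f n = 0.
Proof.
exists (af f) => n lt; rewrite /nsum coef_sum big1// => k _.
by rewrite (@iter_tpow _ k _ (@afP f))//; lia.
Qed.
(** The series $\sum_kN^kf$. Since $N$ raises the order, finitely many terms reach the coefficient
    at $t^n$; by [neumannE] the number of terms does not matter once it is large enough. *)
Definition neumann f : laurent A := Laurent (ncoef_subproof f).

Lemma neumannE a K f n : tpow a f -> n < a + K%:Z -> neumann f n = nsum K f n.
Proof.
move=> Hf lt /=; have le1 : Num.min a (af f) <= a by lia.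
have [K' [H1 H2 H3]] : exists K' : nat, [/\ n < Num.min a (af f) + K'%:Z, (K <= K')%N &
   n < af f + K'%:Z].
  by exists (K + absz (n - a)%R + absz (n - af f)%R + 1)%N; split; lia.
rewrite (@nsum_eq (af f) _ K')//; last by lia.
by rewrite (@nsum_eq a K K')//; lia.
Qed.

Lemma neumann_ex f n : exists K, neumann f n = nsum K f n.
Proof. by eexists. Qed.

Lemma neumann_tpow n f : tpow n f -> tpow n (neumann f).
Proof. by move=> Hf i lt; rewrite (@neumannE n 0 f i) ?addr0// /nsum big_ord0. Qed.

Lemma neumann_tail a K f : tpow a f -> tpow (a + K%:Z) (neumann f - nsum K f).
Proof. by move=> Hf n lt; rewrite coefB (@neumannE a K)// subrr. Qed.

Lemma nsum_linear K : linear (nsum K).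
Proof.
move=> a f g; rewrite /nsum scaler_sumr -big_split /=; apply: eq_bigr => k _.
elim: (k : nat) => //= m ->.
exact: Nlin.
Qed.

Lemma neumann_contlin : contlin neumann.
Proof.
split; last by move=> n; exists n => f; exact: neumann_tpow.
move=> c f g; apply: laurentP => n; rewrite coefD coefZ.
pose d := Num.min (af f) (af g); pose K := absz (n - d + 1)%R.
have Hf : tpow d f by apply: tpow_le (@afP f); lia.
have Hg : tpow d g by apply: tpow_le (@afP g); lia.
have lt : n < d + K%:Z by lia.
rewrite (neumannE (tpowD (tpowZ c Hf) Hg) lt) (neumannE Hf lt) (neumannE Hg lt).
by rewrite nsum_linear.
Qed.

Lemma neumannK f : neumann f - N (neumann f) = f.
Proof.
apply: laurentP => n; have Hf := @afP f.
pose K := absz (n - af f + 1)%R; have lt : n < af f + K%:Z by lia.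
rewrite coefB (@neumannE (af f) K.+1 f n)//; last by lia.
rewrite -[X in N X](subrK (nsum K f)) ND coefD.
rewrite (Nup (@neumann_tail _ K f Hf)) ?add0r//; last by lia.
rewrite /nsum Nsum !coef_sum big_ord_recl /= addrK//.
Qed.

Lemma neumannKV f : neumann (f - N f) = f.
Proof.
apply: laurentP => n; have Hf := @afP f.
pose K := absz (n - af f + 1)%R; have lt : n < af f + K%:Z by lia.
have HfN : tpow (af f) (f - N f).
  by apply: tpowB => //; apply: tpow_le (Nup Hf); lia.
rewrite (neumannE HfN lt).
have -> : nsum K (f - N f) = f - iter K N f.
  rewrite /nsum; elim: (K) => [|k IH]; first by rewrite big_ord0 subrr.
  rewrite big_ord_recr /= IH.
  suff -> : iter k N (f - N f) = iter k N f - iter k.+1 N f by rewrite addrA subrK.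
  by elim: (k) => //= m ->; rewrite NB.
by rewrite coefB (@iter_tpow _ (K) _ Hf)// subr0.
Qed.
End Neumann.

Section PowerSeriesInverse.
Variable A : comPzRingType.
(** $1-up$ has no constant term, so $\sum_k(1-up)^k$ converges, and $u$ times this sum is the
    inverse. *)
Lemma tpow_inv (p : laurent A) u : tpow 0 p -> u * p 0 = 1 ->
  exists q, [/\ tpow 0 q, p * q = 1 & q 0 = u].
Proof.
move=> Hp up; pose m := 1 - u *: p.
have Hm : tpow 1 m.
  move=> n lt; rewrite coefB coefZ; have [->|ne] := eqVneq n 0.
    by rewrite up -[(1 : laurent A) 0]/(mono A 0 0) coef_mono subrr.
  by rewrite Hp ?mulr0 ?subr0; [rewrite -[LHS]/(mono A 0 n) coef_mono (negPf ne)|lia].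
have lm : linear (fun f => m * f) by exact: (contlin_mull m).1.
have um n f : tpow n f -> tpow (n + 1) (m * f) by rewrite addrC; exact: tpowM.
pose q := neumann um 1.
have qP : q - m * q = 1 by exact: (neumannK lm).
have Hq : tpow 0 q by apply: neumann_tpow; exact: tpow1.
have E : u *: (p * q) = 1.
  by rewrite scale_laurentAl -[u *: p](subKr 1) -/m mulrBl mul1r.
exists (u *: q); split; first exact: tpowZ.
  by rewrite mulrC -scale_laurentAl mulrC.
rewrite coefZ.
have : (u *: (p * q)) 0 = 1 by rewrite E.
rewrite coefZ -[in X in X -> _](addr0 (0 : int)) coefM_low// mulrA up mul1r => ->.
by rewrite mulr1.
Qed.
End PowerSeriesInverse.

(** * The matrix of an automorphism: units on the diagonal, nilpotents below it *)

Section LautStructure.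
Variable A : comPzRingType.
Implicit Types (x y h k : laut A) (f g : laurent A) (i j n : int).

Lemma lautM x f g : x (f * g) = x f * x g. Proof. exact: (laut_morph x).2. Qed.
Lemma laut1r x : x 1 = 1. Proof. exact: (laut_morph x).1. Qed.
Lemma lautD x f g : x (f + g) = x f + x g. Proof. exact: (contlinD (laut_contlin x)). Qed.
Lemma lautZ x a f : x (a *: f) = a *: x f. Proof. exact: (contlinZ (laut_contlin x)). Qed.
Lemma laut_zmod x : zmod_morphism x.
Proof. by move=> f g; rewrite lautD -scaleN1r lautZ scaleN1r. Qed.
HB.instance Definition _ x := GRing.isZmodMorphism.Build _ _ (laut_fun x) (laut_zmod x).
HB.instance Definition _ x := GRing.isMonoidMorphism.Build _ _ (laut_fun x) (laut_morph x).

Lemma lautB x f g : x (f - g) = x f - x g. Proof. exact: laut_zmod. Qed.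
Lemma lautN x f : x (- f) = - x f. Proof. exact: (rmorphN x). Qed.
Lemma laut0r x : x 0 = 0. Proof. exact: (rmorph0 x). Qed.
Lemma lautX x f (n : nat) : x (f ^+ n) = x f ^+ n. Proof. exact: (rmorphXn x). Qed.

Definition tnil f := forall n, exists K : nat, forall k : nat, (K <= k)%N -> tpow n (f ^+ k).

Lemma tnilB f g : tnil f -> nilpotent g -> tnil (f - g).
Proof.
move=> Tf [N gN] n.
have [b Hb] : exists b, forall l : nat, (l < N)%N -> tpow b ((- g) ^+ l).
  elim: N {gN} => [|N [b Hb]]; first by exists 0.
  have [c Hc] := tpow_ex ((- g) ^+ N); exists (Num.min b c) => l.
  by rewrite ltnS leq_eqVlt => /orP[/eqP->|/Hb H]; [apply: tpow_le Hc|apply: tpow_le H]; lia.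
have [K HK] := Tf (n - b); exists (K + N)%N => k le.
rewrite exprDn; apply: tpow_sum => l _.
have [lt|le'] := ltnP l N; last first.
  rewrite [X in _ * X](_ : _ = 0) ?mulr0 ?mul0rn//.
  by apply: (@expr_le0 _ _ N) => //; rewrite exprNn gN mulr0.
suff : tpow n (f ^+ (k - l) * (- g) ^+ l).
  move=> H; elim: 'C(_, _) => [|m IH]; first by rewrite mulr0n.
  by rewrite mulrS; apply: tpowD.
rewrite -(subrK b n); apply: tpowM; last exact: Hb.
by apply: HK; lia.
Qed.

(** If the lowest term of $f$ has degree at most $0$, so does that of $f^k$, with coefficient the
    $k$-th power; it vanishes once $f^k\in tA[[t]]$. By [tnilB] the nilpotent term can be removed
    and the next one treated. This is how continuity of an automorphism yields nilpotent
    coefficients. *)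
Lemma tnil_nilS f : tnil f -> nilS 1 f.
Proof.
move=> Tf n lt1; have [a Hf] := tpow_ex f.
suff H (k : nat) : forall n, n < a + k%:Z -> n < 1 -> nilpotent (f n).
  by apply: (H (absz (n - a + 1)%R)); lia.
elim: k => [|k IH] {lt1}n lt lt1; first by rewrite Hf; [exact: nilp0|lia].
have [E|ne] := eqVneq n (a + k%:Z); last by apply: IH; lia.
rewrite {}E in lt1 *.
set g := f - \sum_(i <- iv a k) f i *: mono A i.
have Hg : tpow (a + k%:Z) g by exact: trunc_tpow.
have Tg : tnil g.
  apply: tnilB => //; apply: nilp_sum => i; rewrite mem_iv => ik.
  by apply/nilp_scale/IH; lia.
have -> : f (a + k%:Z) = g (a + k%:Z).
  rewrite /g coefB coef_sum big_seq big1 ?subr0// => i; rewrite mem_iv => ik.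
  by rewrite coefZ coef_mono (_ : (_ == _) = false) ?mulr0//; lia.
have [K HK] := Tg 1; exists K; rewrite -coefX_low//.
apply: HK => //; apply: (@le_lt_trans _ _ 0) => //.
by apply: mulr_le0_ge0; lia.
Qed.

Lemma laut_tilde_nilS x : nilS 1 (tilde x).
Proof.
apply: tnil_nilS => n; have [m Hm] := (laut_contlin x).2 n.
exists (absz m) => k le; rewrite -laut_monoX; apply: Hm; apply: tpow_mono.
lia.
Qed.

Lemma laut_mono_nilS_pos x (k : nat) : nilS k%:Z (x (mono A k%:Z)).
Proof. by rewrite laut_monoX -[k%:Z]mul1r; apply/nilSX/laut_tilde_nilS. Qed.

(** In the coefficient of $t$ in $x(x^{-1}(t))=t$ only the product of the two coefficients of $t$
    survives modulo nilpotents. *)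
Lemma laut_tilde_unit x : exists u, tilde x 1 * u = 1.
Proof.
pose b := laut_inv x (mono A 1).
apply: (@unit_modnil _ _ (b 1)).
have -> : tilde x 1 * b 1 - 1 = - (x (b - b 1 *: mono A 1)) 1.
  rewrite lautB coefB lautZ coefZ -/(tilde x) [x b](lautVK x) coef_mono eqxx.
  by rewrite opprB mulrC.
apply: nilpN; apply: (contlin_ind (laut_contlin x)) => [||i]; [exact: nilp0|exact: nilpD|].
rewrite coefB coefZ coef_mono; have [->|ne] := eqVneq i 1.
  by rewrite mulr1 subrr mul0r; exact: nilp0.
rewrite mulr0 subr0; have [lt|le] := ltP i 1.
  by apply: nilpMr; exact: (laut_tilde_nilS (x^-1)%g).
apply: nilpM; have -> : i = (absz i)%:Z by lia.
by apply: laut_mono_nilS_pos; lia.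
Qed.

Lemma laut_tildeV x : tilde x * x (mono A (-1)) = 1.
Proof. by rewrite -lautM -monoD mono0 laut1r. Qed.

(** At the lowest coefficient not yet known to be nilpotent, the equation $\widetilde x\cdot
    x(t^{-1})=1$ makes its product with the unit $\widetilde x_1$ nilpotent. *)
Lemma laut_mono_nilS_m1 x : nilS (-1) (x (mono A (-1))).
Proof.
set c := x _; have [a Hc] := tpow_ex c; move=> n.
suff H (k : nat) : forall n, n < a + k%:Z -> n < -1 -> nilpotent (c n).
  by move=> lt; apply: (H (absz (n - a + 1)%R)); lia.
elim: k => [|k IH] {}n lt lt1; first by rewrite Hc; [exact: nilp0|lia].
have [E|ne] := eqVneq n (a + k%:Z); last by apply: IH; lia.
have Hn : nilS n c by move=> m ltm; apply: IH; lia.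
have := nilS_coefM (@laut_tilde_nilS x) Hn.
rewrite laut_tildeV -mono0 coef_mono (_ : (_ == _) = false); last by lia.
rewrite sub0r => /nilpN; rewrite opprK => H.
have [u xu] := laut_tilde_unit x.
have := nilpM u H; rewrite mulrA (mulrC u) xu mul1r.
by [].
Qed.

Definition pwS (s : seq A) j f := forall n, n < j -> pw s 1 (f n).

Lemma pwSM s i j f g : pwS s i f -> pwS s j g -> pwS s (i + j) (f * g).
Proof.
move=> Hf Hg n lt; apply: coefM_ind => [||k]; [exact: pw_zero|exact: pw_add|].
have [lti|le] := ltP k i; first by rewrite mulrC; apply/pwMl/Hf.
by apply/pwMl/Hg; lia.
Qed.

Lemma pwSX s j (k : nat) f : pwS s j f -> pwS s (j * k%:Z) (f ^+ k).
Proof.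
move=> Hf; elim: k => [|k IH].
  by rewrite mulr0 expr0 => n lt; rewrite (@tpow1 A 0 (lexx 0) n lt); exact: pw_zero.
by rewrite exprS (_ : j * k.+1%:Z = j + j * k%:Z); [exact: pwSM|lia].
Qed.

Lemma pwS_sub s s' j f : {subset s <= s'} -> pwS s j f -> pwS s' j f.
Proof.
move=> ss Hf n /Hf; elim=> [a|k|k a b _ H1 _ H2|k z a zs _ IH].
- exact: pw_unit.
- exact: pw_zero.
- exact: pw_add.
- by apply: pw_mul => //; exact: ss.
Qed.

Lemma nilS_pwS j f : nilS j f ->
  exists2 s, forall a, a \in s -> nilpotent a & pwS s j f.
Proof.
move=> Hf; have [a Ha] := tpow_ex f; exists [seq f i | i <- iv a (absz (Num.max j a - a)%R)].
  by move=> b /mapP[i]; rewrite mem_iv => ij ->; apply: Hf; lia.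
move=> n lt; have [lta|le] := ltP n a; first by rewrite Ha//; exact: pw_zero.
by apply: pw_mem; apply: map_f; rewrite mem_iv; lia.
Qed.

(** One finite list serves every $j$, because $x(t^j)$ is a power of $x(t)$ or of $x(t^{-1})$. By
    this uniformity the part of $x$ below the diagonal is a nilpotent operator, not merely one with
    nilpotent entries. *)
Lemma laut_pwS x : exists2 s, forall a, a \in s -> nilpotent a &
  forall j, pwS s j (x (mono A j)).
Proof.
have [s1 ns1 H1] := nilS_pwS (@laut_tilde_nilS x).
have [s2 ns2 H2] := nilS_pwS (@laut_mono_nilS_m1 x).
exists (s1 ++ s2) => [a|[k|k]].
- by rewrite mem_cat => /orP[/ns1|/ns2].
- rewrite laut_monoX -[Posz k]mul1r; apply/pwSX/(pwS_sub _ H1) => a.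
  by rewrite mem_cat => ->.
have -> : x (mono A (Negz k)) = x (mono A (-1)) ^+ k.+1.
  rewrite -lautX; congr (x _); elim: k => [|k IH]; first by rewrite expr1.
  by rewrite exprS -IH -monoD; congr mono; lia.
rewrite (_ : Negz k = (-1) * k.+1%:Z); last by lia.
by apply/pwSX/(pwS_sub _ H2) => a; rewrite mem_cat orbC => ->.
Qed.

Lemma laut_nilS x j : nilS j (x (mono A j)).
Proof.
by have [s ns H] := laut_pwS x; move=> n lt; apply: (pw1_nilp ns); exact: H.
Qed.

(** The diagonal entries at $j$ and $-j$ have product $1$ modulo nilpotents. *)
Lemma laut_diag_unit x j : exists u, u * x (mono A j) j = 1.
Proof.
have [|u uP] := @unit_modnil _ (x (mono A j) j) (x (mono A (- j)) (- j)); last first.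
  by exists u; rewrite mulrC.
have := nilS_coefM (@laut_nilS x j) (@laut_nilS x (- j)).
rewrite -lautM -monoD subrr laut1r -mono0 coef_mono eqxx => /nilpN.
by rewrite opprB.
Qed.

End LautStructure.

(** * Triangular operators and their inverses *)

Section Upper.
Variables (A : comPzRingType) (c : int -> int -> A).
Hypothesis cup : forall j n, n < j -> c j n = 0.
Implicit Types (f g : laurent A) (i j n : int).

Lemma upE_subproof f : exists M : int, forall n, n < M ->
  \sum_(j \in setT) f j * c j n = 0.
Proof.
have [a Hf] := tpow_ex f; exists a => n lt; rewrite fsbig1// => j _.
have [ltj|le] := ltP j a; first by rewrite Hf// mul0r.
by rewrite cup ?mulr0//; lia.
Qed.
(** $\sum_j f_j \sum_n c_{jn} t^n$ *)
Definition upper f : laurent A := Laurent (upE_subproof f).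

Lemma upperE a K f n : tpow a f -> n < a + K%:Z ->
  upper f n = \sum_(j <- iv a K) f j * c j n.
Proof.
move=> Hf lt; apply: fsum_iv => j nj.
have [ltj|le] := ltP j a; first by rewrite Hf// mul0r.
by rewrite cup ?mulr0//; lia.
Qed.

Lemma upper_tpow n f : tpow n f -> tpow n (upper f).
Proof. by move=> Hf i lt; rewrite (@upperE n 0)// ?big_nil// addr0. Qed.

Lemma upper_contlin : contlin upper.
Proof.
split; last by move=> n; exists n => f; exact: upper_tpow.
move=> b f g; apply: laurentP => n; rewrite coefD coefZ.
have [a1 Hf1] := tpow_ex f; have [a2 Hg2] := tpow_ex g.
pose d := Num.min a1 a2; pose K := absz (n - d + 1)%R.
have Hf : tpow d f by apply: tpow_le Hf1; lia.
have Hg : tpow d g by apply: tpow_le Hg2; lia.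
have lt : n < d + K%:Z by lia.
rewrite (upperE (tpowD (tpowZ b Hf) Hg) lt) (upperE Hf lt) (upperE Hg lt).
rewrite big_distrr -big_split /=; apply: eq_bigr => j _.
by rewrite coefD coefZ mulrDl mulrA.
Qed.

Lemma upper_mono i n : upper (mono A i) n = c i n.
Proof.
have [lt|le] := ltP n i; first by rewrite (upper_tpow (tpow_mono A (lexx i))) ?cup.
rewrite (@upperE i (absz (n - i)%R).+1 _ _ (tpow_mono A (lexx i))); last by lia.
rewrite (bigD1_seq i) ?iv_uniq//=; last by rewrite mem_iv; lia.
rewrite eqxx mul1r big1 ?addr0// => j ne.
by rewrite /= (negPf ne) mul0r.
Qed.

Lemma upper_diag n f : tpow n f -> upper f n = f n * c n n.
Proof.
by move=> Hf; rewrite (@upperE n 1)//; [rewrite /iv /= big_seq1 addr0|lia].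
Qed.

Variable d : int -> A.
Hypothesis dc : forall n, d n * c n n = 1.

Lemma dg_subproof f : exists M : int, forall n, n < M -> d n * f n = 0.
Proof. by have [M H] := coefP f; exists M => n /H ->; rewrite mulr0. Qed.
Let dg f : laurent A := Laurent (dg_subproof f).

Let dgE f n : dg f n = d n * f n. Proof. by []. Qed.

Let N f := f - dg (upper f).

Let dg_linear : linear dg.
Proof. by move=> a f g; apply: laurentP => n; rewrite coefD coefZ /= coefD coefZ; ring. Qed.
Let dg_tpow n f : tpow n f -> tpow n (dg f).
Proof. by move=> Hf i /Hf /= ->; rewrite mulr0. Qed.

Let Nlin : linear N.
Proof.
move=> a f g; rewrite /N upper_contlin.1 dg_linear scalerBr.
by rewrite opprD addrACA.
Qed.

Let Nup n f : tpow n f -> tpow (n + 1) (N f).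
Proof.
move=> Hf i lt; rewrite coefB dgE; have [lti|le] := ltP i n.
  by rewrite Hf// (upper_tpow Hf)// mulr0 subr0.
have -> : i = n by lia.
by rewrite upper_diag// mulrCA dc mulr1 subrr.
Qed.

(** Divided by its diagonal, the operator is $1-N$ with $N$ raising the order, so the geometric
    series inverts it. *)
Definition upper_inv f : laurent A := neumann Nup (dg f).

Lemma upper_invK f : upper_inv (upper f) = f.
Proof. by rewrite /upper_inv -[dg _](subKr f) -/(N f) neumannKV. Qed.

Lemma upper_invVK f : upper (upper_inv f) = f.
Proof.
have E : dg (upper (upper_inv f)) = dg f.
  by have := neumannK Nlin Nup (dg f); rewrite -/(upper_inv f) /N subKr.
apply: laurentP => n; have := congr1 (fun g : laurent A => c n n * g n) E.
by rewrite !dgE !mulrA (mulrC (c n n)) dc !mul1r.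
Qed.

Lemma upper_inv_tpow n f : tpow n f -> tpow n (upper_inv f).
Proof. by move=> Hf; apply: neumann_tpow; exact: dg_tpow. Qed.

Lemma upper_inv_contlin : contlin upper_inv.
Proof.
split; last by move=> n; exists n => f; exact: upper_inv_tpow.
by move=> a f g; rewrite /upper_inv dg_linear (neumann_contlin Nlin Nup).1.
Qed.

Lemma upper_inv_pw s k f : (forall n, pw s k (f n)) -> forall n, pw s k (upper_inv f n).
Proof.
move=> Hf n; rewrite /upper_inv; have [K ->] := neumann_ex Nup (dg f) n.
rewrite /nsum coef_sum; apply: pw_sum => l _ /=.
elim: (l : nat) n => [|m IH] n /=; first by apply: pwMl.
rewrite coefB dgE; apply: pw_add => //; apply/pwN/pwMl.
apply: (contlin_ind upper_contlin) => [||j]; [exact: pw_zero|exact: pw_add|].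
by rewrite mulrC; exact: pwMl.
Qed.

End Upper.

(** * Birkhoff factorization *)

Section Subgroups.
Variable A : comPzRingType.
Implicit Types (x y h k : laut A) (f g : laurent A) (i j n : int).

(** The equivalence imposes the condition on the inverse as well. *)
Definition Gpos k := forall n f, tpow n (k f) <-> tpow n f.
(** Imposed on every power of $t$, so that the matrix is unitriangular by definition. *)
Definition Gneg h := forall i, low i (h (mono A i) - mono A i).

Lemma Gpos1 : Gpos 1%g. Proof. by []. Qed.
Lemma GposM k k' : Gpos k -> Gpos k' -> Gpos (k * k')%g.
Proof. by move=> Hk Hk' n f; rewrite laut_mulE Hk Hk'. Qed.
Lemma GposV k : Gpos k -> Gpos k^-1%g.
Proof. by move=> Hk n f; rewrite -Hk -laut_mulE mulgV. Qed.
Lemma GposP k : (forall i, tpow i (k (mono A i))) ->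
  (forall i, tpow i (k^-1%g (mono A i))) -> Gpos k.
Proof.
have H (x : laut A) : (forall i, tpow i (x (mono A i))) -> forall n f, tpow n f -> tpow n (x f).
  move=> Hx n f Hf m lt;
    apply: (@contlin_ind _ (fun c => c = 0) _ _ _ (laut_contlin x)) => [//|a b -> ->|i].
    exact: addr0.
  have [lti|le] := ltP i n; first by rewrite Hf// mul0r.
  by rewrite Hx ?mulr0//; lia.
move=> H1 H2 n f; split; last exact: H.
by move=> /(H _ H2); rewrite -laut_mulE mulVg.
Qed.

Lemma Gneg_low h : Gneg h -> forall i f, low (i + 1) f -> low i (h f - f).
Proof.
move=> Hh i f Hf n le.
have Lc : contlin (fun f => h f - f).
  split=> [a u v|m]; first by rewrite (laut_linear h) scalerBr opprD addrACA.
  have [b Hb] := (laut_contlin h).2 m; exists (Num.max b m) => g Hg.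
  by apply: tpowB; [apply: Hb; apply: tpow_le Hg; lia|apply: tpow_le Hg; lia].
apply: (@contlin_ind _ (fun c => c = 0) _ _ _ Lc) => [//|a b -> ->|j]; first exact: addr0.
have [lt|le'] := ltP i j; first by rewrite Hf ?mul0r//; lia.
by rewrite Hh ?mulr0//; lia.
Qed.

Lemma Gneg_low' h i f : Gneg h -> low i f -> low i (h f).
Proof.
move=> Hh Hf; rewrite -(subrK f (h f)); apply: lowD => //.
by have := @Gneg_low _ Hh (i - 1) f; rewrite subrK => /(_ Hf); apply: low_le; lia.
Qed.

Lemma Gneg1 : Gneg 1%g. Proof. by move=> i; rewrite laut1E subrr. Qed.

Lemma GnegM h h' : Gneg h -> Gneg h' -> Gneg (h * h')%g.
Proof.
move=> Hh Hh' i; rewrite laut_mulE -(subrKA (h (mono A i))); apply: lowD => //.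
by rewrite -lautB; apply: Gneg_low'.
Qed.

(** By [laut_pwS] the operator $1-h$ sends coefficients in one power of a nilpotent ideal to the
    next power. So $h^{-1}(t^i)$ is a finite sum of the $(1-h)^k(t^i)$, and all its terms but the
    first have degree below $i$. *)
Lemma GnegV h : Gneg h -> Gneg h^-1%g.
Proof.
move=> Hh i; have [s ns Hs] := laut_pwS h; have [N HN] := pw_nilp ns.
pose L f := f - h f.
have Lc : contlin L.
  split=> [a u v|m].
    by rewrite /L (laut_linear h) scalerBr opprD addrACA.
  have [b Hb] := (laut_contlin h).2 m; exists (Num.max b m) => g Hg.
  by apply: tpowB; [apply: tpow_le Hg; lia|apply: Hb; apply: tpow_le Hg; lia].
have Lpw (k : nat) f : (forall n, pw s k (f n)) -> forall n, pw s k.+1 (L f n).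
  move=> Hf n; apply: (contlin_ind Lc) => [||j]; [exact: pw_zero|exact: pw_add|].
  rewrite -addn1; apply: pwM => //; have [lt|le] := ltP n j.
    rewrite coefB coef_mono lt_eqF// sub0r; apply: pwN; exact: Hs.
  by rewrite -[L _]opprB coefN Hh// oppr0; exact: pw_zero.
have Liter (k : nat) f n : pw s k (iter k L f n).
  by elim: k n => [|k IH] n /=; [exact: pw_unit|exact: Lpw].
pose q := \sum_(k < N.+1) iter k L (mono A i).
have qE : h q = mono A i.
  have -> : h q = q - L q by rewrite /L subKr.
  have -> : L q = \sum_(k < N.+1) iter k.+1 L (mono A i).
    exact: (contlin_sum Lc).
  rewrite /q; have -> : forall F : nat -> laurent A,
     \sum_(k < N.+1) F k - \sum_(k < N.+1) F k.+1 = F 0%N - F N.+1.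
    move=> F; elim: (N.+1) => [|M IH]; first by rewrite !big_ord0 !subrr.
    by rewrite 2!big_ord_recr /= opprD addrACA IH addrA subrK.
  rewrite [X in _ - X](_ : _ = 0) ?subr0//; apply: laurentP => n.
  by apply: HN; apply: (@pw_le _ _ _ N.+1) => //; exact: Liter.
have -> : h^-1%g (mono A i) = q by rewrite -qE -laut_mulE mulVg.
rewrite /q big_ord_recl [iter _ _ _]/= addrAC subrr add0r; apply: low_sum => k _.
rewrite -[iter _ _ _]/(iter k.+1 L (mono A i)); elim: (k : nat) => [|m IH].
  by rewrite /= /L -opprB; apply: lowN; exact: Hh.
by rewrite iterS; apply: lowB => //; exact: Gneg_low'.
Qed.

Lemma Gposm_eq1 x : Gpos x -> Gneg x -> x = 1%g.
Proof.
move=> Hp Hm; apply: laut_ext => i; rewrite laut1E; apply/eqP.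
rewrite -subr_eq0; apply/eqP/(@low_tpow0 _ i); first exact: Hm.
by apply: tpowB; [apply/Hp|]; exact: tpow_mono.
Qed.

Lemma factor_uniq h k h' k' : Gneg h -> Gpos k -> Gneg h' -> Gpos k' ->
  (h * k = h' * k')%g -> h = h' /\ k = k'.
Proof.
move=> Hh Hk Hh' Hk' E.
have E1 : (h'^-1 * h = k' * k^-1)%g by apply: (mulIg k); rewrite mulgVK -mulgA E mulKg.
have E2 : (h'^-1 * h = 1)%g.
  by apply: Gposm_eq1; [rewrite E1; apply/GposM/GposV|apply: GnegM => //; exact: GnegV].
have hh : h = h' by rewrite -[RHS]mulg1 -E2 mulVKg.
split=> //; apply: (mulgI h); rewrite E.
by rewrite hh.
Qed.

Section Birkhoff.
Variable x : laut A.

Let c j n : A := if j <= n then x (mono A j) n else 0.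
Let cup j n : n < j -> c j n = 0.
Proof. by rewrite /c ltNge => /negPf ->. Qed.
Let d n : A := projT1 (cid (laut_diag_unit x n)).
Let dc n : d n * c n n = 1.
Proof. by rewrite /c lexx /d; case: cid. Qed.
Let U := upper cup.
Let Q := upper_inv cup dc.
Let R f := x f - U f.
Let E i f := hi i (R (Q f)).

Let R_contlin : contlin R.
Proof.
split=> [a u v|m].
  by rewrite /R /U (laut_linear x) (upper_contlin cup).1 scalerBr opprD addrACA.
have [b Hb] := (laut_contlin x).2 m; exists (Num.max b m) => g Hg.
by apply: tpowB; [apply: Hb|apply: upper_tpow]; apply: tpow_le Hg; lia.
Qed.

(** Let $\pi$ be the projection to $t^iA[[t]]$. There $\pi x=U+\pi R$, where $U$ is triangular with
    unit diagonal and $R$ has its entries in a nilpotent ideal. So the compression has the inverse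
    $U^{-1}\sum_k(-\pi RU^{-1})^k$, a finite sum. *)
Lemma birkhoff_solve : exists psi : int -> laurent A, forall i,
  [/\ tpow i (psi i), hi i (x (psi i)) = mono A i &
    forall f, tpow i f -> hi i (x f) = 0 -> f = 0].
Proof.
suff H i : exists p, [/\ tpow i p, hi i (x p) = mono A i &
    forall f, tpow i f -> hi i (x f) = 0 -> f = 0].
  by exists (fun i => projT1 (cid (H i))) => i; case: cid.
have [s ns Hs] := laut_pwS x; have [N HN] := pw_nilp ns.
have Ec : contlin (E i).
  exact: (contlin_comp (hi_contlin A i) (contlin_comp R_contlin (upper_inv_contlin cup dc))).
have Rpw (k : nat) f : (forall n, pw s k (f n)) -> forall n, pw s k.+1 (R f n).
  move=> Hf n; apply: (contlin_ind R_contlin) => [||j].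
  - exact: pw_zero.
  - exact: pw_add.
  - rewrite -addn1; apply: pwM => //; rewrite coefB upper_mono /c.
    have [lt|le] := ltP n j; first by rewrite subr0; exact: Hs.
    by rewrite subrr; exact: pw_zero.
have Epw (k : nat) f : (forall n, pw s k (f n)) -> forall n, pw s k.+1 (E i f n).
  move=> Hf n; rewrite /E /=; case: ifP => _; last exact: pw_zero.
  apply: Rpw => m; exact: upper_inv_pw.
have Eiter (k : nat) f n : pw s k (iter k (E i) f n).
  by elim: k n => [|k IH] n /=; [exact: pw_unit|exact: Epw].
have xE f : tpow i f -> hi i (x f) = U f + E i (U f).
  move=> Hf; rewrite /E /Q upper_invK -[x f](subrK (U f)) -/(R f).
  rewrite (raddfD (hi i)) /= [X in _ + X]hi_id 1?addrC//.
  exact: upper_tpow.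
have EiterN f : iter N (E i) f = 0 by apply: laurentP => n; exact: HN.
pose F (k : nat) := (-1) ^+ k *: iter k (E i) (mono A i).
pose q := \sum_(k < N) F k.
have EF (k : nat) : E i (F k) = - F k.+1.
  by rewrite /F contlinZ//= exprS mulN1r scaleNr opprK.
have Hq : tpow i q.
  rewrite /q; apply: tpow_sum => -[k _] _ /=; apply: tpowZ.
  by case: k => [|k]; [exact: tpow_mono|exact: hi_tpow].
exists (Q q); split; first exact: upper_inv_tpow.
  rewrite xE; last exact: upper_inv_tpow.
  rewrite /U /Q upper_invVK /q (contlin_sum Ec) -big_split /=.
  under eq_bigr do rewrite EF.
  have -> : forall M, \sum_(k < M) (F k - F k.+1) = F 0%N - F M.
    elim=> [|M IH]; first by rewrite big_ord0 subrr.
    by rewrite big_ord_recr /= IH addrA subrK.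
  by rewrite /F expr0 scale1r EiterN scaler0 subr0.
move=> f Hf; rewrite xE// => E0.
have E1 : U f = - E i (U f) by apply/eqP; rewrite -addr_eq0 E0.
have E2 (k : nat) : U f = (-1) ^+ k *: iter k (E i) (U f).
  elim: k => [|k IH]; first by rewrite scale1r.
  by rewrite {1}E1 {1}IH contlinZ//= exprS mulN1r scaleNr.
by rewrite -[f](upper_invK cup dc) -/(U f) (E2 N) EiterN scaler0 contlin0//;
  exact: upper_inv_contlin.
Qed.

(** Uniqueness forces $\psi_{i+j}=\psi_i\psi_j$, because [low] parts multiply to a [low] part. Hence
    $t^i\mapsto\psi_i$ defines an automorphism $y\in G_+$, and $xy\in G_-$ by construction. *)
Lemma birkhoff : exists h k, [/\ Gneg h, Gpos k & x = (h * k)%g].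
Proof.
have [psi Hpsi] := birkhoff_solve.
have p_tpow i : tpow i (psi i) by have [] := Hpsi i.
have p_hi i : hi i (x (psi i)) = mono A i by have [] := Hpsi i.
have p_uniq i f : tpow i f -> hi i (x f) = mono A i -> f = psi i.
  move=> Hf Ef; have [_ _ H] := Hpsi i; apply/eqP; rewrite -subr_eq0; apply/eqP/H.
    exact: tpowB.
  by rewrite lautB (raddfB (hi i)) /= Ef p_hi subrr.
have p0 : psi 0 = 1.
  by apply/esym/p_uniq; [exact: tpow1|rewrite laut1r hi_id; [|exact: tpow1]].
have pM i j : psi (i + j) = psi i * psi j.
  apply/esym/p_uniq; first exact: tpowM.
  have -> : x (psi i * psi j) = mono A (i + j) + (x (psi i) * x (psi j) - mono A i * mono A j).
    by rewrite -monoD addrC subrK lautM.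
  rewrite (raddfD (hi _)) /= hi_id; last exact: tpow_mono.
  rewrite hi_eq0 ?addr0//.
  have Hl m : low m (x (psi m) - mono A m) by rewrite -(p_hi m); exact: hi_low.
  have Hl1 m : low (m + 1) (x (psi m)).
    rewrite -(subrK (mono A m) (x _)); apply: lowD; last by apply: low_mono; lia.
    by apply: low_le (Hl m); lia.
  have -> : x (psi i) * x (psi j) - mono A i * mono A j =
      x (psi i) * (x (psi j) - mono A j) + mono A j * (x (psi i) - mono A i) by ring.
  apply: lowD; first exact: lowM.
  by rewrite (addrC i); apply: lowM => //; apply: low_mono; lia.
pose c' j n : A := psi j n.
have cup' j n : n < j -> c' j n = 0 by exact: p_tpow.
have dc' n : c' (- n) (- n) * c' n n = 1.
  rewrite /c' -coefM_low// -pM (addNr n) p0.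
  by rewrite -mono0 coef_mono eqxx.
pose V := upper cup'; pose V' := upper_inv cup' dc'.
have Vmono i : V (mono A i) = psi i.
  by apply: laurentP => n; rewrite upper_mono.
have VM : {morph V : f g / f * g}.
  by apply: contlin_morph (upper_contlin cup') _ => i j; rewrite -/V !Vmono pM.
have V1 : monoid_morphism V by split=> //; exact: etrans (Vmono 0) p0.
pose y := @Laut A V V' (upper_contlin cup').1 V1 (upper_invK cup' dc')
  (upper_invVK cup' dc') (contlin_continuous (upper_contlin cup'))
  (contlin_continuous (upper_inv_contlin cup' dc')).
have Hy : Gpos y.
  move=> n f; split; last exact: upper_tpow.
  by move=> Hf; rewrite -(upper_invK cup' dc' f); exact: upper_inv_tpow.
exists (x * y)%g, y^-1%g; split; last by rewrite mulgK.
  move=> i; rewrite laut_mulE.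
  have -> : y (mono A i) = psi i by exact: Vmono.
  by rewrite -(p_hi i); exact: hi_low.
exact: GposV.
Qed.
End Birkhoff.

Definition fac x : laut A * laut A :=
  xget (1%g, 1%g) [set p | [/\ Gneg p.1, Gpos p.2 & x = (p.1 * p.2)%g]].

Lemma facP x : [/\ Gneg (fac x).1, Gpos (fac x).2 & x = ((fac x).1 * (fac x).2)%g].
Proof.
have [h [k H]] := birkhoff x.
by apply: (@xgetPex _ _ [set p | [/\ Gneg p.1, Gpos p.2 & x = (p.1 * p.2)%g]]); exists (h, k).
Qed.

Lemma facE h k : Gneg h -> Gpos k -> fac (h * k)%g = (h, k).
Proof.
move=> Hh Hk; have [H1 H2 H3] := facP (h * k)%g.
by case: (fac _) H1 H2 H3 => h' k' /= H1 H2 /(factor_uniq Hh Hk H1 H2)[-> ->].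
Qed.

End Subgroups.

Section SubgroupsMorph.
Variables (A B : comPzRingType) (r : {rmorphism A -> B}).
Implicit Types x : laut A.

Lemma base_changeV x : base_change r x^-1%g = (base_change r x)^-1%g.
Proof.
apply: (mulIg (base_change r x)); rewrite -base_changeM !mulVg.
by apply: laut_ext => i; rewrite base_change_mono map_mono.
Qed.

Lemma Gpos_morph x : Gpos x -> Gpos (base_change r x).
Proof.
move=> Hx; apply: GposP => i; rewrite -?base_changeV base_change_mono;
  apply: tpow_map; [apply/Hx|apply/(GposV Hx)]; exact: tpow_mono.
Qed.

Lemma Gneg_morph x : Gneg x -> Gneg (base_change r x).
Proof.
move=> Hx i n le; rewrite base_change_mono -(map_mono r) coefB.
by rewrite -[RHS](rmorph0 r) -(Hx i n le) coefB rmorphB.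
Qed.

Lemma fac_morph x :
  fac (base_change r x) = (base_change r (fac x).1, base_change r (fac x).2).
Proof.
have [H1 H2 E] := facP x; rewrite {1}E base_changeM facE//.
  exact: Gneg_morph.
exact: Gpos_morph.
Qed.
End SubgroupsMorph.

(** * The Contou-Carrère symbol as a residue *)

Notation ddt := (@laurent_deriv _).

Section Deriv.
Variable A : comPzRingType.
Implicit Types (x : laut A) (f g : laurent A) (i j n : int).

Lemma derivE f n : ddt f n = f (n + 1) *~ (n + 1). Proof. by []. Qed.

Lemma deriv_linear : linear (ddt : laurent A -> laurent A).
Proof.
by move=> a f g; apply: laurentP => n; rewrite coefD coefZ !derivE coefD coefZ mulrzDl mulrzAr.
Qed.
HB.instance Definition _ := GRing.isLinear.Build A (laurent A) (laurent A) _ ddt deriv_linear.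

Lemma LderivD f g : ddt (f + g) = ddt f + ddt g. Proof. exact: (raddfD ddt). Qed.
Lemma LderivB f g : ddt (f - g) = ddt f - ddt g. Proof. exact: (raddfB ddt). Qed.
Lemma LderivZ a f : ddt (a *: f) = a *: ddt f. Proof. exact: (linearZ_LR ddt). Qed.

Lemma tpow_deriv n f : tpow n f -> tpow (n - 1) (ddt f).
Proof. by move=> Hf i lt; rewrite derivE Hf ?mul0rz//; lia. Qed.
Lemma tpow0_deriv f : tpow 0 f -> tpow 0 (ddt f).
Proof.
move=> Hf i lt; rewrite derivE; have [->|ne] := eqVneq i (-1); first by rewrite addNr mulr0z.
by rewrite Hf ?mul0rz//; lia.
Qed.
Lemma low_deriv n f : low n f -> low (n - 1) (ddt f).
Proof. by move=> Hf i lt; rewrite derivE Hf ?mul0rz//; lia. Qed.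

Lemma deriv_contlin : contlin (ddt : laurent A -> laurent A).
Proof.
split; first exact: deriv_linear.
by move=> n; exists (n + 1) => f /tpow_deriv; rewrite addrK.
Qed.

Lemma deriv_mono i : ddt (mono A i) = i%:~R *: mono A (i - 1).
Proof.
apply: laurentP => n; rewrite derivE coefZ !coef_mono (_ : (n == i - 1) = (n + 1 == i)).
  by case: eqP => [->|_]; rewrite ?mulr1 ?mulr0 ?mul0rz.
by apply/eqP/eqP; lia.
Qed.

Lemma LderivM f g : ddt (f * g) = ddt f * g + f * ddt g.
Proof.
have contlinD2 (L M : laurent A -> laurent A) : contlin L -> contlin M -> contlin (fun h => L h
  + M h).
  move=> LP MP; split=> [a u v|m]; first by rewrite LP.1 MP.1 scalerDr addrACA.
  have [b Hb] := LP.2 m; have [c Hc] := MP.2 m; exists (Num.max b c) => h Hh.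
  by apply: tpowD; [apply: Hb|apply: Hc]; apply: tpow_le Hh; lia.
have H j h : ddt (h * mono A j) = ddt h * mono A j + h * ddt (mono A j).
  apply: (@contlin_ext _ (ddt \o (fun h => h * mono A j))
    (fun h => ((fun h => h * mono A j) \o ddt) h + h * ddt (mono A j))).
  - exact: contlin_comp deriv_contlin (contlin_mulr _).
  - apply: contlinD2; last exact: contlin_mulr.
    exact: contlin_comp (contlin_mulr _) deriv_contlin.
  - move=> i /=; rewrite -monoD !deriv_mono -scale_laurentAl.
    rewrite (mulrC (mono A i)) -scale_laurentAl -!monoD intrD scalerDl.
    by congr (_ *: mono A _ + _ *: mono A _); lia.
apply: (@contlin_ext _ (ddt \o (fun h => f * h))
    (fun h => ddt f * h + ((fun h => f * h) \o ddt) h)).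
- exact: contlin_comp deriv_contlin (contlin_mull _).
- apply: contlinD2; first exact: contlin_mull.
  exact: contlin_comp (contlin_mull _) deriv_contlin.
- by move=> i /=; exact: H.
Qed.

Lemma Lderiv1 : ddt (1 : laurent A) = 0.
Proof. exact: (der1 LderivM). Qed.

Definition chain x f := ddt (x f) = ddt (tilde x) * x (ddt f).

Lemma chainM x f g : chain x f -> chain x g -> chain x (f * g).
Proof. by rewrite /chain => Hf Hg; rewrite lautM !LderivM Hf Hg lautD !lautM; ring. Qed.

Lemma chainV x f g : f * g = 1 -> chain x f -> chain x g.
Proof.
rewrite /chain => fg Hf.
have E : ddt f * g + f * ddt g = 0 by rewrite -LderivM fg Lderiv1.
have E' : ddt (x f) * x g + x f * ddt (x g) = 0 by rewrite -LderivM -lautM fg laut1r Lderiv1.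
have xfg : x f * x g = 1 by rewrite -lautM fg laut1r.
have E2 : x (ddt f) * x g + x f * x (ddt g) = 0 by rewrite -!lautM -lautD E laut0r.
have E3 : x f * (ddt (x g) - ddt (tilde x) * x (ddt g)) = 0.
  transitivity ((ddt (x f) * x g + x f * ddt (x g)) -
      ddt (tilde x) * (x (ddt f) * x g + x f * x (ddt g))); last by rewrite E' E2 mulr0 subr0.
  by rewrite Hf; ring.
apply/eqP; rewrite -subr_eq0 -[X in X == _]mul1r -xfg; apply/eqP.
by rewrite (mulrC (x f)) -mulrA E3 mulr0.
Qed.

Lemma chain_rule x f : ddt (x f) = ddt (tilde x) * x (ddt f).
Proof.
apply: (@contlin_ext _ (ddt \o x) ((fun h => ddt (tilde x) * h) \o (x \o ddt))).
- exact: contlin_comp deriv_contlin (laut_contlin x).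
- apply: contlin_comp (contlin_mull _) _.
  exact: contlin_comp (laut_contlin x) deriv_contlin.
move=> i /=; have H1 (k : nat) : chain x (mono A k%:Z).
  elim: k => [|k IH]; first by rewrite /chain mono0 laut1r Lderiv1 laut0r mulr0.
  rewrite (_ : Posz k.+1 = 1 + k%:Z); last by lia.
  rewrite monoD; apply: chainM => //.
  by rewrite /chain deriv_mono subrr mono0 scale1r laut1r mulr1.
case: i => k; first exact: H1.
apply: (@chainV _ (mono A k.+1%:Z)); last exact: H1.
by rewrite -monoD -mono0; congr mono; lia.
Qed.

Definition res f : A := f (-1).

Lemma resD f g : res (f + g) = res f + res g. Proof. exact: coefD. Qed.
Lemma resN f : res (- f) = - res f. Proof. exact: coefN. Qed.
Lemma resB f g : res (f - g) = res f - res g. Proof. exact: coefB. Qed.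
Lemma resZ a f : res (a *: f) = a * res f. Proof. exact: coefZ. Qed.
Lemma res_deriv f : res (ddt f) = 0.
Proof. by rewrite /res derivE addNr mulr0z. Qed.
Lemma res_tpow0 f : tpow 0 f -> res f = 0. Proof. exact. Qed.
Lemma res_low f : low (-1) f -> res f = 0. Proof. exact. Qed.

Lemma nilp_res f : nilpotent f -> nilpotent (res f).
Proof. by move/nilp_coef; exact. Qed.

Lemma res_lowM f g : low 0 f -> low (-1) g -> res (f * g) = 0.
Proof.
move=> Hf Hg; apply: res_low.
have := @lowM _ (-1) (-1) f g; rewrite addNr => /(_ Hf Hg).
exact: low_le.
Qed.

Implicit Types U V : units (laurent A).

Definition dlog U : laurent A := ddt (uval U) * uinv U.

Lemma uvalKV U : uinv U * uval U = 1. Proof. by rewrite mulrC uvalK. Qed.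

Lemma dlogM U V : dlog (U * V)%g = dlog U + dlog V.
Proof.
rewrite /dlog /= LderivM mulrDl; congr (_ + _).
  by rewrite mulrACA uvalK mulr1.
by rewrite mulrC mulrACA uvalKV mul1r mulrC.
Qed.

Lemma dlog_tpow U : tpow 0 (uval U) -> tpow 0 (uinv U) -> tpow 0 (dlog U).
Proof. by move=> H1 H2; apply: tpowM0 => //; exact: tpow0_deriv. Qed.

Definition lact x U : units (laurent A) := units_map (x : {rmorphism laurent A -> laurent A}) U.

Lemma lactM x U V : lact x (U * V)%g = (lact x U * lact x V)%g.
Proof. exact: units_mapM. Qed.
Lemma lact_mul x y U : lact (x * y)%g U = lact x (lact y U).
Proof. exact: unitsP. Qed.

Lemma dlog_lact x U : dlog (lact x U) = ddt (tilde x) * x (dlog U).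
Proof. by rewrite /dlog /= chain_rule lautM mulrA. Qed.

End Deriv.

(** * The residue pairing on units of winding number zero *)

Section Symbol.
Variable A : comPzRingType.
Hypothesis QA : isQ A.
Let QL : isQ (laurent A) := isQ_laurent QA.
Implicit Types (x : laut A) (f g l m : laurent A) (i j n : int) (U V P : units (laurent A)).

Lemma dexp l : nilpotent l -> ddt (exp l) = exp l * ddt l.
Proof. exact: (der_exp QL (@LderivD A) (@LderivM A)). Qed.

Lemma eU_subproof l : nilpotent l -> exp l * exp (- l) = 1.
Proof. by move=> nl; rewrite mulrC expNr. Qed.
Definition eU l (nl : nilpotent l) : units (laurent A) := Units (eU_subproof nl).

Lemma dlog_eU l (nl : nilpotent l) : dlog (eU nl) = ddt l.
Proof. by rewrite /dlog /= dexp// mulrAC eU_subproof// mul1r. Qed.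

Lemma tpow0_exp l : nilpotent l -> tpow 0 l -> tpow 0 (exp l).
Proof.
case=> N lN Hl; rewrite (expE lN) /expt; apply: tpow_sum => k _.
have -> : qinv (laurent A) k`! = cst (qinv A k`!).
  by rewrite (qinv_morph (@cst A) QA)// fact_gt0.
by rewrite -scale_cst; apply/tpowZ/tpowX0.
Qed.

Lemma low_exp l : nilpotent l -> low 0 l -> low 0 (exp l - 1).
Proof.
case=> N lN Hl; have lN1 : l ^+ N.+1 = 0 by exact: expr_le0 lN.
rewrite (expE lN1) /expt big_ord_recl fact0 qinv1// mul1r expr0 addrAC subrr add0r.
apply: low_sum => k _; rewrite -[lift _ _ : nat]/k.+1.
have -> : qinv (laurent A) k.+1`! = cst (qinv A k.+1`!).
  by rewrite (qinv_morph (@cst A) QA)// fact_gt0.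
rewrite -scale_cst => n le; rewrite coefZ.
suff H : low 0 (l ^+ k.+1) by rewrite H ?mulr0.
elim: (k : nat) => [|m IH]; first by rewrite expr1.
rewrite exprS -(addr0 (0 : int)); apply: lowM => //.
by apply: low_le Hl.
Qed.

(** [l] is the logarithm of the factor of [U] in $1 + t^{-1}A[t^{-1}]$. *)
Definition Wdec U l := [/\ nilpotent l, low 0 l & exists P, [/\ tpow 0 (uval P),
  tpow 0 (uinv P) & uval U = exp l * uval P]].

(** The quotient of two such exponentials lies in $1+t^{-1}A[t^{-1}]$ and is a power series, hence
    is $1$, and only $0$ has exponential $1$. *)
Lemma Wdec_uniq U l m : Wdec U l -> Wdec U m -> l = m.
Proof.
move=> [nl Hl [P [P1 P2 EP]]] [nm Hm [R [R1 R2 ER]]].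
have nlm := nilpB nl nm.
apply/eqP; rewrite -subr_eq0; apply/eqP/(exp_eq1 QL nlm)/eqP.
rewrite -subr_eq0; apply/eqP/(@low_tpow0 _ 0).
  by apply: low_exp => //; exact: lowB.
apply: tpowB; last exact: tpow1.
rewrite expD//; last exact: nilpN.
suff -> : exp l * exp (- m) = uval R * uinv P by exact: tpowM0.
have E : exp l * uval P = exp m * uval R by rewrite -EP -ER.
transitivity (exp l * uval P * exp (- m) * uinv P).
  rewrite [RHS](_ : _ = exp l * exp (- m) * (uval P * uinv P)); last by ring.
  by rewrite uvalK mulr1.
by rewrite E (mulrAC (exp m)) eU_subproof// mul1r.
Qed.

Lemma Wdec_unit P : tpow 0 (uval P) -> tpow 0 (uinv P) -> Wdec P 0.
Proof.
move=> H1 H2; split; [exact: nilp0|exact: low0|exists P; split=> //].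
by rewrite exp0// mul1r.
Qed.

Lemma WdecM U V l m : Wdec U l -> Wdec V m -> Wdec (U * V)%g (l + m).
Proof.
move=> [nl Hl [P [P1 P2 EP]]] [nm Hm [R [R1 R2 ER]]].
split; [exact: nilpD|exact: lowD|exists (P * R)%g; split].
- exact: tpowM0.
- exact: tpowM0.
- by rewrite /= EP ER expD// mulrACA.
Qed.

Lemma Wdec_eU l (nl : nilpotent l) : Wdec (eU nl) (l - hi 0 l).
Proof.
have n1 : nilpotent (l - hi 0 l).
  apply: nilp_low (@hi_low _ 0 l) _ => n; rewrite coefB; apply: nilpB; first exact: nilp_coef.
  by rewrite /=; case: ifP => _; [exact: nilp_coef|exact: nilp0].
have n2 : nilpotent (hi 0 l) by rewrite -[hi 0 l](subKr l); exact: nilpB.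
split=> //; first exact: hi_low.
exists (eU n2); split; first exact: (tpow0_exp n2 (@hi_tpow _ 0 l)).
  by apply: (tpow0_exp (nilpN n2)); apply: tpowN; exact: hi_tpow.
by rewrite /= -expD ?subrK.
Qed.

Definition isW U := exists l, Wdec U l.

(** Division by the unit power series [hi 0 f] leaves $1-c$ with $c$ nilpotent; the nonnegative part
    of its logarithm is then moved to the power series factor. *)
Lemma isW_coef U u : nilS 0 (uval U) -> u * uval U 0 = 1 -> isW U.
Proof.
set f := uval U => Hf uf.
have [|q [Hq pq _]] := @tpow_inv _ (hi 0 f) u (hi_tpow _); first by rewrite /= uf.
pose c := - (q * (f - hi 0 f)).
have nc : nilpotent c.
  apply/nilpN/nilpM/(nilp_low (@hi_low _ 0 f)) => n; rewrite coefB /=.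
  by case: leP => le; [rewrite subrr; exact: nilp0|rewrite subr0; exact: Hf].
have [N cN] := nc; pose l := - \sum_(i < N) qinv _ i.+1 * c ^+ i.+1.
have nl : nilpotent l by apply/nilpN/nilp_sum => i _; apply/nilpM/nilpX.
have El : exp l = 1 - c by exact: exp_log.
have fE : f = exp l * hi 0 f.
  by rewrite El /c opprK mulrDl mul1r mulrC mulrA pq mul1r addrC subrK.
pose P := Units pq; have [n1 n2 [R [R1 R2 ER]]] := Wdec_eU nl.
exists (l - hi 0 l); split=> //; exists (R * P)%g; split; [|exact: tpowM0|].
  by apply: tpowM0 => //; exact: hi_tpow.
by rewrite [LHS]fE [RHS]mulrA -ER.
Qed.

Definition lam U : laurent A := xget 0 [set l | Wdec U l].

Lemma lamP U : isW U -> Wdec U (lam U).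
Proof. exact: xgetPex. Qed.

Lemma lamE U l : Wdec U l -> lam U = l.
Proof. by move=> H; apply: Wdec_uniq (H); apply: lamP; exists l. Qed.

Lemma isWM U V : isW U -> isW V -> isW (U * V)%g.
Proof. by move=> [l Hl] [m Hm]; exists (l + m); exact: WdecM. Qed.
Lemma isW_eU l (nl : nilpotent l) : isW (eU nl).
Proof. by eexists; exact: Wdec_eU. Qed.
Lemma isW_unit P : tpow 0 (uval P) -> tpow 0 (uinv P) -> isW P.
Proof. by exists 0; exact: Wdec_unit. Qed.

Lemma lamM U V : isW U -> isW V -> lam (U * V)%g = lam U + lam V.
Proof. by move=> /lamP H1 /lamP H2; apply: lamE; exact: WdecM. Qed.

(** $\mathrm{CC}(U,V) = \exp(\mathtt{cca}\,U\,V)$ when $\nu(U) = \nu(V) = 0$. *)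
Definition cca U V : A := res (lam U * dlog V) - res (lam V * dlog U).

Lemma cca_nilp U V : isW U -> isW V -> nilpotent (cca U V).
Proof.
by move=> /lamP[nl _ _] /lamP[nm _ _]; apply: nilpB; apply/nilp_res/nilpMr.
Qed.

Lemma ccaC U V : cca V U = - cca U V. Proof. by rewrite /cca opprB. Qed.
Lemma ccaMl U U' V : isW U -> isW U' -> cca (U * U')%g V = cca U V + cca U' V.
Proof. by move=> H1 H2; rewrite /cca lamM// dlogM mulrDl mulrDr !resD opprD addrACA. Qed.
Lemma ccaMr U V V' : isW V -> isW V' -> cca U (V * V')%g = cca U V + cca U V'.
Proof. by move=> H1 H2; rewrite ccaC ccaMl// opprD -!ccaC. Qed.

Lemma cca_unit U V : tpow 0 (uval U) -> tpow 0 (uinv U) ->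
  tpow 0 (uval V) -> tpow 0 (uinv V) -> cca U V = 0.
Proof.
move=> U1 U2 V1 V2; rewrite /cca (lamE (Wdec_unit U1 U2)) (lamE (Wdec_unit V1 V2)).
by rewrite !mul0r subrr.
Qed.

Lemma Wdec_dlog U l : Wdec U l -> exists2 g, tpow 0 g & dlog U = ddt l + g.
Proof.
move=> [nl _ [P [P1 P2 E]]]; have -> : U = (eU nl * P)%g by exact: unitsP.
by exists (dlog P); [exact: dlog_tpow|rewrite dlogM dlog_eU].
Qed.

(** Integration by parts. Two power series, or two series in negative powers one of which is a
    derivative, have a product without residue, so the projection of $l$ to negative powers
    disappears. The resulting formula is visibly compatible with automorphisms. *)
Lemma cca_eU l (nl : nilpotent l) V : isW V -> cca (eU nl) V = res (l * dlog V).
Proof.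
move=> /lamP HV; have [nm Hm _] := HV; have [g Hg Eg] := Wdec_dlog HV.
rewrite /cca (lamE (Wdec_eU nl)) dlog_eU Eg.
have E1 : res (lam V * ddt l) = - res (l * ddt (lam V)).
  apply/eqP; rewrite -addr_eq0 -resD addrC (mulrC l) -[lam V * _]mulrC -(mulrC l).
  by rewrite [l * _]mulrC addrC [ddt l * _]mulrC addrC -LderivM res_deriv.
rewrite E1 opprK mulrBl !mulrDr resB !resD.
rewrite (@res_tpow0 _ (hi 0 l * g)); last by apply: tpowM0 => //; exact: hi_tpow.
have : res ((l - hi 0 l) * ddt (lam V)) = 0.
  by apply: res_lowM; [exact: hi_low|by have := low_deriv Hm; rewrite sub0r].
rewrite mulrBl resB => /eqP; rewrite subr_eq0 => /eqP ->.
by ring.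
Qed.

Lemma isW_lact x U : isW U -> isW (lact x U).
Proof.
move=> [l [nl _ [P [P1 P2 E]]]].
have nxl : nilpotent (x l) by exact: (nilp_morph x).
have -> : lact x U = (eU nxl * lact x P)%g.
  by apply: unitsP; rewrite /= E lautM (exp_morph x QL).
apply: isWM; first exact: isW_eU.
have Hn (f : laurent A) : tpow 0 f -> nilS 0 (x f).
  move=> Hf n lt; apply: (contlin_ind (laut_contlin x)) => [||i]; [exact: nilp0|exact: nilpD|].
  have [lti|le] := ltP i 0; first by rewrite Hf// mul0r; exact: nilp0.
  by apply: nilpM; apply: laut_nilS; lia.
have [|u uP] := @unit_modnil _ (x (uval P) 0) (x (uinv P) 0); last first.
  by apply: (@isW_coef _ u); [exact: Hn|rewrite mulrC].
have := nilS_coefM (Hn _ P1) (Hn _ P2).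
rewrite addr0 -lautM uvalK laut1r -mono0 coef_mono eqxx => /nilpN.
by rewrite opprB.
Qed.

Lemma mono_unit_subproof i : mono A i * mono A (- i) = 1.
Proof. by rewrite -monoD subrr. Qed.
Definition mU i : units (laurent A) := Units (mono_unit_subproof i).

Lemma tilde_decomp x : exists2 U, isW U & lact x (mU 1) = (mU 1 * U)%g.
Proof.
pose U := ((mU 1)^-1 * lact x (mU 1))%g; exists U; last by rewrite mulVKg.
have E n : uval U n = tilde x (n + 1).
  by rewrite [uval U]mulrC coefMmono opprK.
have [u xu] := laut_tilde_unit x; apply: (@isW_coef _ u).
  by move=> n lt; rewrite E; apply: laut_tilde_nilS; lia.
by rewrite E add0r mulrC.
Qed.

(** For $i\ne-1$ the monomial $t^i$ is a derivative over $\mathbb Q$, and then so is $\widetilde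
    x'\,x(t^i)$. For $i=-1$ this series is the logarithmic derivative of $\widetilde x$, which by
    [tilde_decomp] is $t^{-1}$ plus a derivative plus a power series. *)
Lemma res_invariant x f : res (ddt (tilde x) * x f) = res f.
Proof.
have Lc : contlin ((fun g => ddt (tilde x) * g) \o x).
  exact: contlin_comp (contlin_mull _) (laut_contlin x).
have E i : res (ddt (tilde x) * x (mono A i)) = (i == -1)%:R.
  have [->|ne] := eqVneq i (-1); last first.
    have [i1 E1] : exists r : A, r *~ (i + 1) = 1.
      have [k [E|E]] : exists k : nat, i + 1 = k.+1%:Z \/ i + 1 = - k.+1%:Z.
        by exists (absz (i + 1)%R).-1; lia.
      - by rewrite E; have [r rk] := QA k; exists r; rewrite -rk mulr_natr.
      - rewrite E; have [r rk] := QA k; exists (- r).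
        by rewrite mulrNz mulNrz opprK -rk mulr_natr.
    have -> : mono A i = ddt (i1 *: mono A (i + 1)).
      by rewrite LderivZ deriv_mono addrK scalerA mulrzr E1 scale1r.
    by rewrite -chain_rule res_deriv.
  have [U [l Hl] EU] := tilde_decomp x.
  have [g Hg Eg] := Wdec_dlog Hl.
  have -> : ddt (tilde x) * x (mono A (-1)) = dlog (lact x (mU 1)) by [].
  rewrite EU dlogM Eg !resD res_deriv (res_tpow0 Hg) !addr0.
  by rewrite /dlog /= deriv_mono subrr mono0 scale1r mul1r /res coef_mono.
rewrite /res (contlin_fsum (-1) f Lc) (@fsum_seq _ _ [:: -1])//.
  by rewrite big_seq1 [X in _ * X]E eqxx mulr1.
by move=> i; rewrite inE => /negPf ne; rewrite [X in _ * X]E ne mulr0.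
Qed.

Lemma cca_eU_lact x l (nl : nilpotent l) V : isW V ->
  cca (lact x (eU nl)) (lact x V) = cca (eU nl) V.
Proof.
move=> HV; have nxl : nilpotent (x l) by exact: (nilp_morph x).
have -> : lact x (eU nl) = eU nxl by apply: unitsP; rewrite /= (exp_morph x QL).
rewrite !cca_eU//; last exact: isW_lact.
by rewrite dlog_lact mulrCA -lautM res_invariant.
Qed.

End Symbol.

Lemma fsbig_list (R : Type) (idx : R) (op : Monoid.com_law idx) (T : choiceType)
    (B : set T) (r : seq T) (F : T -> R) : uniq r -> (forall i, i \in r -> B i) ->
  (forall i, B i -> i \notin r -> F i = idx) ->
  \big[op/idx]_(i \in B) F i = \big[op/idx]_(i <- r) F i.
Proof.
move=> ur Hr F0; rewrite (fsbigE r)//.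
by rewrite big_seq_cond [RHS]big_seq_cond; apply: eq_bigl => i;
  rewrite andbT andb_idr// => /Hr ?; rewrite inE.
Qed.

(** * Existence of the product decompositions *)

Section Factors.
Variable A : comPzRingType.
Hypothesis QA : isQ A.
Let QL : isQ (laurent A) := isQ_laurent QA.
Implicit Types (f g l m : laurent A) (U V P : units (laurent A)).

(** $\log(1 - ct^i)$ *)
Definition lg N (c : A) (i : int) : laurent A :=
  - \sum_(k < N) (qinv A k.+1 * c ^+ k.+1) *: mono A (i * k.+1%:Z).

Lemma monoX i k : mono A i ^+ k = mono A (i * k%:Z).
Proof.
elim: k => [|k IH]; first by rewrite mulr0 expr0.
by rewrite exprS IH -monoD; congr mono; lia.
Qed.

Lemma scaleXn (c : A) f k : (c *: f) ^+ k = c ^+ k *: f ^+ k.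
Proof. by rewrite !scale_cst exprMn rmorphXn. Qed.

Lemma lgE N c i : lg N c i = - \sum_(k < N) qinv (laurent A) k.+1 * (c *: mono A i) ^+ k.+1.
Proof.
congr (- _); apply: eq_bigr => k _; rewrite scaleXn monoX -(qinv_morph (@cst A) QA)//.
by rewrite -scale_cst scalerA.
Qed.

Lemma scaleX_eq0 N c i : c ^+ N = 0 -> (c *: mono A i) ^+ N = 0.
Proof. by rewrite scaleXn => ->; rewrite scale0r. Qed.

Lemma exp_lg N c i : c ^+ N = 0 -> exp (lg N c i) = 1 - c *: mono A i.
Proof. by move=> cN; rewrite lgE exp_log//; exact: scaleX_eq0. Qed.

Lemma nilp_lg N c i : c ^+ N = 0 -> nilpotent (lg N c i).
Proof.
move=> cN; rewrite lgE; apply/nilpN/nilp_sum => k _; apply/nilpM/nilpX.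
by exists N; exact: scaleX_eq0.
Qed.

Lemma low_lg N c (i : int) (n : int) : i < n -> i < 0 -> low n (lg N c i).
Proof.
move=> lt lt0; apply/lowN/low_sum => k _ j le; rewrite coefZ coef_mono gt_eqF ?mulr0//.
by apply: lt_le_trans le; nia.
Qed.

(** The coefficient at $t^{-n}$ is in the ideal power $\lceil n/m\rceil$. *)
Definition weighted (s : seq A) (m : nat) l := forall k n : nat, (k * m < n)%N -> pw s k.+1 (l
  (- n%:Z)).

(** Each step removes the factor $1-ct^{-n-1}$ that cancels the highest term of the logarithm. This
    changes lower degrees, but [weighted] persists, since $c$ in the $k$-th ideal power enters
    degree $-(n+1)q$ through $c^q$, which is in the $kq$-th. Hence nothing is left beyond
    $t^{-N_0m}$ and the process stops. *)
Lemma factor_steps s (m N0 : nat) l (n r : nat) : (0 < m)%N ->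
  (forall a, a \in s -> nilpotent a) ->
  (forall a, pw s N0.+1 a -> a = 0) -> weighted s m l -> low (- n%:Z) l -> nilpotent l ->
  (n + r = N0 * m)%N ->
  exists2 a : nat -> A, forall i, nilpotent (a i) &
    exp l = \prod_(n <= i < n + r) (1 - a i *: mono A (- i.+1%:Z)).
Proof.
move=> m0 ns HN; elim: r n l => [|r IH] n l Hw Hl nl E.
  exists (fun=> 0) => [i|]; first exact: nilp0.
  rewrite addn0 big_geq//.
  suff -> : l = 0 by rewrite exp0.
  apply: laurentP => i; have [le|lt] := leP (- n%:Z) i; first by rewrite Hl.
  have -> : i = - (absz i)%:Z by lia.
  by apply/HN/Hw; lia.
(* $\log(1-ct^{-n-1})$ begins with $-ct^{-n-1}$. *)
pose c := - l (- n.+1%:Z).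
have nc : nilpotent c by apply/nilpN/nilp_coef.
have [N cN] := nc.
pose l' := l - lg N.+1 c (- n.+1%:Z).
have Elg : exp (lg N.+1 c (- n.+1%:Z)) = 1 - c *: mono A (- n.+1%:Z).
  by apply: exp_lg; exact: expr_le0 cN.
have nlg : nilpotent (lg N.+1 c (- n.+1%:Z)).
  by apply: nilp_lg; exact: expr_le0 cN.
have lgc (j : int) : lg N.+1 c (- n.+1%:Z) j =
    - \sum_(k < N.+1) (qinv A k.+1 * c ^+ k.+1) * (j == - (n.+1 * k.+1)%:Z)%:R.
  rewrite coefN coef_sum; congr (- _); apply: eq_bigr => k _.
  rewrite coefZ coef_mono; congr (_ * (_ == _)%:R); lia.
have Hl' : low (- n.+1%:Z) l'.
  move=> j le; rewrite coefB lgc opprK big_ord_recl /= big1 ?addr0; last first.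
    by move=> k _; rewrite (_ : (_ == _) = false) ?mulr0//; rewrite /bump; nia.
  rewrite qinv1// mul1r expr1 muln1; have [->|ne] := eqVneq j (- n.+1%:Z).
    by rewrite mulr1 /c subrr.
  by rewrite mulr0 addr0 Hl//; lia.
have Hw' : weighted s m l'.
  move=> k j lt; rewrite coefB lgc opprK; apply: pw_add; first exact: Hw.
  apply: pw_sum => q _; case: eqP => [E1|_]; last by rewrite mulr0; exact: pw_zero.
  rewrite mulr1; apply: pwMl; pose k0 := (n %/ m)%N.
  have Hc : pw s k0.+1 c.
    by apply/pwN/Hw; rewrite ltnS; exact: leq_divM.
  apply: (pw_le _ (pwX q.+1 Hc)).
  have Ej : j = (n.+1 * q.+1)%N by lia.
  have : (n < k0.+1 * m)%N by exact: ltn_ceil.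
  move: lt; rewrite Ej => lt lt2.
  have : (k * m < k0.+1 * q.+1 * m)%N.
    by apply: leq_trans lt _; rewrite mulnAC leq_mul2r lt2 orbT.
  by rewrite ltn_mul2r => /andP[_]; rewrite mulnC.
have nl' : nilpotent l' by exact: nilpB.
have [|a na Ea] := IH n.+1 l' Hw' Hl' nl'; first by lia.
exists (fun i => if i == n then c else a i) => [i|]; first by case: ifP.
rewrite big_ltn; last by lia.
rewrite eqxx -Elg -[l](subrK (lg N.+1 c (- n.+1%:Z))) -/l' expD// Ea mulrC.
rewrite addSnnS; congr (_ * _); apply: eq_big_nat => i /andP[lt _].
by rewrite gtn_eqF.
Qed.

Lemma neg_factor l : nilpotent l -> low 0 l ->
  exists (a : nat -> A) M, (forall i, nilpotent (a i)) /\
    exp l = \prod_(0 <= i < M) (1 - a i *: mono A (- i.+1%:Z)).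
Proof.
move=> nl Hl; have [c Hc] := tpow_ex l; pose m := (absz c).+1.
pose s := [seq l i | i <- iv (- m%:Z) m].
have ns a : a \in s -> nilpotent a by move=> /mapP[i _ ->]; exact: nilp_coef.
have [N HN] := pw_nilp ns.
have Hw : weighted s m l.
  move=> k n lt; have [le|gt] := leqP n m; last by rewrite Hc; [exact: pw_zero|lia].
  have -> : k = 0%N by nia.
  by apply: pw_mem; apply/map_f; rewrite mem_iv; lia.
have HN' a : pw s N.+1 a -> a = 0 by move=> /pwW /HN.
have [//|||a na Ea] := @factor_steps s m N l 0 (N * m) _ ns HN' Hw _ nl; first by rewrite oppr0.
  by [].
by exists a, (N * m)%N.
Qed.

(** The factor of index $i$ is chosen to correct the coefficient at $t^i$ of the product of the
    earlier ones. No factor has index $0$. *)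
Fixpoint pprod (Q : laurent A) n : laurent A :=
  if n is n'.+1 then
    pprod Q n' * (if n' == 0%N then 1 else 1 - ((pprod Q n' - Q) n'%:Z) *: mono A n'%:Z)
  else 1.

Lemma pos_factor Q : tpow 0 Q -> Q 0 = 1 -> exists a : nat -> A,
  forall n, (0 < n)%N -> tpow n%:Z (Q - \prod_(1 <= i < n) (1 - a i *: mono A i%:Z)).
Proof.
move=> HQ Q0; exists (fun i => (pprod Q i - Q) i%:Z) => n n0.
have -> : \prod_(1 <= i < n) (1 - (pprod Q i - Q) i%:Z *: mono A i%:Z) = pprod Q n.
  case: n n0 => // n _; elim: n => [|n IH]; first by rewrite big_geq//= mul1r.
  by rewrite big_nat_recr//= IH.
suff [] : [/\ tpow n%:Z (Q - pprod Q n), tpow 0 (pprod Q n) & pprod Q n 0 = 1] by [].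
case: n n0 => // n _; elim: n => [|n [IH1 IH2 IH3]].
  rewrite /= mul1r; split; [|exact: tpow1|by rewrite -mono0 coef_mono].
  move=> i lt; have [->|ne] := eqVneq i 0.
    by rewrite coefB Q0 -mono0 coef_mono subrr.
  by rewrite coefB HQ ?(@tpow1 A 0)// ?subr0//; lia.
set p := pprod Q n.+1 in IH1 IH2 IH3 *.
have -> : pprod Q n.+2 = p - (p - Q) n.+1%:Z *: (mono A n.+1%:Z * p).
  rewrite -[LHS]/(p * (1 - (p - Q) n.+1%:Z *: mono A n.+1%:Z)).
  by rewrite mulrBr mulr1 scale_laurentAl (mulrC p).
set a := (p - Q) n.+1%:Z.
have Hmp : tpow n.+1%:Z (mono A n.+1%:Z * p).
  by have := tpowM (tpow_mono A (lexx n.+1%:Z)) IH2; rewrite addr0.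
split.
- move=> i lt; rewrite opprB addrCA addrC coefD.
  have [E|ne] := eqVneq i n.+1%:Z; last first.
    by rewrite IH1 ?coefZ ?Hmp ?mulr0 ?addr0//; lia.
  rewrite E coefZ [(mono A _ * p)]mulrC coefMmono subrr IH3 mulr1.
  by rewrite /a -opprB coefN addNr.
- by apply: tpowB => //; apply/tpowZ/(tpow_le _ Hmp).
- by rewrite coefB coefZ Hmp// mulr0 subr0.
Qed.

Lemma zero_lc_subproof : exists nu : locconst A,
  [/\ lc_idem nu 0 = 1 & forall n, n != 0 -> lc_idem nu n = 0].
Proof.
pose e (n : int) : A := (n == 0)%:R.
have e0 n : n != 0 -> e n = 0 by rewrite /e => /negPf ->.
unshelve eexists (@LocConst A (fun=> 0) e _ _ _ _ _) => /=.
- by move=> p; exists 1; [exact: primeN1|].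
- apply: (@sub_finite_set _ _ [set 0]); last exact: finite_set1.
  by move=> n /= H; apply: contrapT => /eqP /e0.
- move=> m n ne; have [m0|/e0 ->] := eqVneq m 0; last by rewrite mul0r.
  by rewrite (e0 n) ?mulr0// -m0 eq_sym.
- by rewrite (@fsum_seq _ _ [:: 0])// ?big_seq1 /e ?eqxx// => i; rewrite inE => /negPf ->.
- move=> n p; rewrite /e; case: eqP => [->|ne]; split=> // H.
  + exact: primeN1.
  + by case: H; exact: prime0.
  + by case: ne.
- by split; [rewrite /e eqxx|].
Qed.

Lemma locconst0 nu : [/\ lc_idem nu 0 = 1 :> A & forall n, n != 0 -> lc_idem nu n = 0 :> A] ->
  [/\ tpow_lc nu = 1, forall u, upow_lc u nu = 1 & forall mu, lc_idem mu 0 = 1 :> A ->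
    (forall n, n != 0 -> lc_idem mu n = 0 :> A) -> sign_lc nu mu = 1].
Proof.
move=> [e0 en]; split.
- rewrite /tpow_lc (@fsum_seq _ _ [:: 0])// ?big_seq1 ?e0 ?scale1r// => i.
  by rewrite inE => /en ->; rewrite scale0r.
- move=> u; rewrite /upow_lc (@fsum_seq _ _ [:: 0])// ?big_seq1 ?e0 ?mul1r// => i.
  by rewrite inE => /en ->; rewrite mul0r.
- move=> mu m0 mn; rewrite /sign_lc (@fsum_seq _ _ [:: 0])// ?big_seq1; last first.
    by move=> i; rewrite inE => /en E; rewrite fsbig1// => j _; rewrite E !mul0r.
  rewrite (@fsum_seq _ _ [:: 0])// ?big_seq1 ?e0 ?m0 ?mul1r// => i.
  by rewrite inE => /mn ->; rewrite mulr0 mul0r.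
Qed.

Lemma cvg_prod (a : nat -> A) (Q : laurent A) :
  ((fun n : nat => \prod_(1 <= i < n) (1 - a i *: mono A i%:Z)) @ \oo --> Q) <->
  forall n : nat, exists K : nat, forall k : nat, (K <= k)%N -> tpow n%:Z (Q - \prod_(1 <= i <
    k) (1 - a i *: mono A i%:Z)).
Proof.
split=> [H n|H S [n _ HS]].
  have : nbhs Q [set g | tpow n%:Z (g - Q)] by exists n%:Z.
  move=> /H [K _ HK]; exists K => k le; rewrite -opprB; apply: tpowN; exact: HK.
have [K HK] := H (absz n); exists K => // k /= le; apply: HS => /=.
by rewrite -opprB; apply/tpowN/(tpow_le _ (HK _ le)); lia.
Qed.

Lemma neg_big (a : int -> A) M : (forall i, i < - M%:Z -> a i = 0) ->
  \big[*%R/1]_(i \in [set i : int | i < 0]) (1 - a i *: mono A i) =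
  \prod_(0 <= i < M) (1 - a (- i.+1%:Z) *: mono A (- i.+1%:Z)).
Proof.
move=> a0; rewrite (@fsbig_list _ _ _ _ _ [seq - i.+1%:Z | i <- iota 0 M]).
- by rewrite big_map /index_iota subn0.
- by rewrite map_inj_uniq ?iota_uniq// => x y; lia.
- by move=> i /mapP[k _ ->] /=; lia.
- move=> i /= i0 ni; rewrite a0 ?scale0r ?subr0// ltNge; apply: contra ni => le.
  by apply/mapP; exists (absz i).-1; rewrite ?mem_iota; lia.
Qed.

Lemma CC_decomp_ex U : isW U -> exists nu u a, CC_decomp (uval U) nu u a.
Proof.
move=> [l [nl Hl [P [P1 P2 E]]]].
have [a1 [M [na1 E1]]] := neg_factor nl Hl.
have PP : uval P 0 * uinv P 0 = 1.
  by have := coefM_low P1 P2; rewrite addr0 uvalK -mono0 coef_mono eqxx.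
pose u := Units PP; pose Q := uinv P 0 *: uval P.
have HQ : tpow 0 Q by exact: tpowZ.
have [|a2 Ha2] := pos_factor HQ; first by rewrite coefZ mulrC.
have [nu Hnu] := zero_lc_subproof.
pose a (i : int) : A := if 0 < i then a2 (absz i) else if (absz i <= M)%N then a1 (absz i).-1
  else 0.
have Enat i : (0 < i)%N -> a i%:Z = a2 i by rewrite /a ltz_nat => ->.
exists nu, u, a, Q; split.
- by move=> i i0; rewrite /a; case: ifP => [|_]; [lia|case: ifP => _; [|exact: nilp0]].
- exists (- M%:Z) => i lt; rewrite /a; case: ifP => [|_]; first by lia.
  by case: ifP => //; lia.
- have -> : (fun n : nat => \prod_(1 <= i < n) (1 - a i%:Z *: mono A i%:Z)) =
    (fun n : nat => \prod_(1 <= i < n) (1 - a2 i *: mono A i%:Z)).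
    by apply/funext => n; apply: eq_big_nat => i /andP[i0 _]; rewrite Enat.
  apply/cvg_prod => n; exists n.+1 => k le.
  by apply: tpow_le (Ha2 k _); lia.
rewrite (@neg_big _ M); last first.
  by move=> i lt; rewrite /a; case: ifP => [|_]; [lia|case: ifP => //; lia].
have -> : \prod_(0 <= i < M) (1 - a (- i.+1%:Z) *: mono A (- i.+1%:Z)) = exp l.
  rewrite E1; apply: eq_big_nat => i /andP[_ lt]; rewrite /a (_ : (0 < - i.+1%:Z) = false);
    last by lia.
  by rewrite abszN /= lt.
have [-> _ _] := locconst0 Hnu.
rewrite E -mulrA; congr (_ * _); rewrite scale_cst mulr1 -scale_cst scalerA PP scale1r.
by [].
Qed.

End Factors.

(** * The residue pairing of two elementary factors *)

Section Pairing.
Variable A : comPzRingType.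
Hypothesis QA : isQ A.
Let QL : isQ (laurent A) := isQ_laurent QA.
Implicit Types (f g l m : laurent A) (U V P : units (laurent A)) (c : A).

Lemma pu_ex c (i : nat) : (0 < i)%N -> exists P,
  uval P = 1 - c *: mono A i%:Z /\ tpow 0 (uinv P).
Proof.
move=> i0; have H0 : tpow 0 (1 - c *: mono A i%:Z).
  by apply: tpowB; [exact: tpow1|apply/tpowZ/tpow_mono].
have [|q [Hq pq _]] := @tpow_inv _ _ 1 H0; last by exists (Units pq).
rewrite mul1r coefB coefZ -mono0 !coef_mono eqxx lt_eqF ?mulr0 ?subr0//.
Qed.

(** The logarithmic derivative is $-i\sum_{q>0}c^qt^{iq-1}$; its coefficients satisfy the recursion
    with step $i$ given by $(1-ct^i)L=-ict^{i-1}$. *)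
Lemma dlog_coef c (i : nat) P : (0 < i)%N -> uval P = 1 - c *: mono A i%:Z ->
  tpow 0 (uinv P) -> forall m : nat,
  dlog P (m%:Z - 1) = if (0 < m)%N && (i %| m)%N then - (c ^+ (m %/ i)) *+ i else 0.
Proof.
move=> i0 EP HP; set L := dlog P.
have HuP : tpow 0 (uval P).
  by rewrite EP; apply: tpowB; [exact: tpow1|apply/tpowZ/tpow_mono].
have HL : tpow 0 L by exact: dlog_tpow.
have E : L = c *: (L * mono A i%:Z) - (c *+ i) *: mono A (i%:Z - 1).
  have : uval P * L = ddt (uval P) by rewrite /L /dlog mulrCA uvalK mulr1.
  rewrite {1}EP mulrBl mul1r EP LderivB Lderiv1 sub0r LderivZ deriv_mono => E.
  rewrite -[LHS](subrK ((c *: mono A i%:Z) * L)) E addrC -scale_laurentAl.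
  by rewrite (mulrC L) scalerA mulr_natr.
have rec (m : nat) : L (m%:Z - 1) = c * L (m%:Z - 1 - i%:Z) - (c *+ i) * (m == i)%:R.
  rewrite {1}E coefB !coefZ coefMmono coef_mono; congr (_ - _ * _%:R).
  by congr nat_of_bool; apply/eqP/eqP; lia.
elim/ltn_ind => m IH; rewrite rec.
have [lt|le] := ltnP m i.
  rewrite HL ?mulr0; last by lia.
  rewrite ltn_eqF// mulr0 subr0; case: m lt {IH} => // m lt.
  by rewrite gtnNdvd.
have -> : m%:Z - 1 - i%:Z = (m - i)%N%:Z - 1 by lia.
rewrite IH; last by lia.
have -> : (0 < m)%N by lia.
have [->|ne] := eqVneq m i.
  by rewrite subnn /= mulr0 dvdnn divnn i0 expr1 sub0r mulr1 mulNrn.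
have -> : (0 < m - i)%N by lia.
rewrite mulr0 subr0 /= dvdn_subl//.
case: ifP => dv; last by rewrite mulr0.
rewrite -[in RHS](subnK le) divnDr ?dvdnn// divnn i0 addn1 exprS.
by rewrite mulrnAr mulrN.
Qed.

Lemma lg_N N N' c (i : int) : c ^+ N = 0 -> c ^+ N' = 0 -> lg N c i = lg N' c i.
Proof. by move=> cN cN'; apply: (exp_inj QL); [exact: nilp_lg|exact: nilp_lg|rewrite !exp_lg]. Qed.

Lemma sum_multiples (F : nat -> A) e M : (0 < e)%N ->
  \sum_(k < e * M) (if (e %| k.+1)%N then F (k.+1 %/ e)%N else 0) = \sum_(q < M) F q.+1.
Proof.
move=> e0; elim: M => [|M IH]; first by rewrite muln0 !big_ord0.
rewrite big_ord_recr /= -IH mulnS addnC big_split_ord /=; congr (_ + _).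
case: e e0 {IH} => // e _; rewrite big_ord_recr /= big1 ?add0r => [|k _].
  by rewrite -addnS -mulnSr dvdn_mulr// mulKn.
rewrite -addnS dvdn_addr ?dvdn_mulr// gtnNdvd//.
by rewrite ltnS ltn_ord.
Qed.

(** Only common multiples of $i$ and $j$ contribute to the residue. With $d=(i,j)$ and
    $c=a^{j/d}b^{i/d}$ they add up to $d\log(1-c)$. *)
Lemma pair_exp a b (i j N : nat) P : (0 < i)%N -> (0 < j)%N -> b ^+ N = 0 ->
  uval P = 1 - a *: mono A i%:Z -> tpow 0 (uinv P) ->
  exp (- res (lg N b (- j%:Z) * dlog P)) =
  (1 - a ^+ (j %/ gcdn i j) * b ^+ (i %/ gcdn i j)) ^+ gcdn i j.
Proof.
move=> i0 j0 bN EP HP; pose d := gcdn i j.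
have d0 : (0 < d)%N by rewrite gcdn_gt0 i0.
pose e := (i %/ d)%N; pose e' := (j %/ d)%N.
have Ei : i = (e * d)%N by rewrite divnK// dvdn_gcdl.
have Ej : j = (e' * d)%N by rewrite divnK// dvdn_gcdr.
have co : coprime e e'.
  have : (gcdn e e' * d = 1 * d)%N by rewrite muln_gcdl -Ei -Ej mul1n.
  by move/eqP; rewrite eqn_pmul2r.
have e0 : (0 < e)%N by rewrite divn_gt0// dvdn_leq// dvdn_gcdl.
pose c := a ^+ e' * b ^+ e.
(* The truncation is lengthened to a multiple of $e$, since only the terms with index divisible by
   $e$ survive. *)
have biN : b ^+ (e * (d * N)) = 0.
  by rewrite mulnA -Ei mulnC exprM bN expr0n eqn0Ngt i0.
have nc : c ^+ (d * N) = 0 by rewrite exprMn -[(b ^+ e) ^+ _]exprM biN mulr0.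
rewrite (lg_N _ bN biN) -/d -/e -/e' -/c.
have -> : - res (lg (e * (d * N)) b (- j%:Z) * dlog P) =
   (- \sum_(q < d * N) qinv A q.+1 * c ^+ q.+1) *+ d.
  rewrite /lg mulNr resN opprK mulr_suml /res coef_sum.
  rewrite mulNrn -sumrMnl -(@sum_multiples (fun q => qinv A q * c ^+ q *+ d) e)// -sumrN.
  apply: eq_bigr => k _; rewrite -scale_laurentAl [LHS]coefZ (mulrC (mono A _)) coefMmono.
  have -> : -1 - - j%:Z * k.+1%:Z = (j * k.+1)%N%:Z - 1 by lia.
  rewrite (dlog_coef i0 EP HP) muln_gt0 j0 /=.
  have -> : (i %| j * k.+1)%N = (e %| k.+1)%N.
    by rewrite {1}Ei {1}Ej mulnAC dvdn_pmul2r// Gauss_dvdr.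
  case: ifP => [/dvdnP[q Eq]|_]; last by rewrite mulr0 oppr0.
  have Edv : (j * (q * e) = e' * q * i)%N by rewrite {1}Ej [in RHS]Ei; ring.
  rewrite Eq (mulnK _ e0) Edv (mulnK _ i0).
  have q0 : (0 < q)%N by case: (q) Eq.
  have Ec : c ^+ q = a ^+ (e' * q) * b ^+ (q * e).
    by rewrite exprMn -!exprM (mulnC e).
  rewrite mulNrn mulrN Ec (qinvM QA)//; congr (- _).
  have Ei1 : a ^+ (e' * q) *+ i = a ^+ (e' * q) * e%:R *+ d.
    by rewrite [X in _ *+ X = _]Ei mulrnA mulr_natr.
  rewrite Ei1 mulrnAr; congr (_ *+ d).
  transitivity ((qinv A e * e%:R) * (qinv A q * (a ^+ (e' * q) * b ^+ (q * e)))).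
    by move: (qinv A e) (qinv A q) (e%:R) => *; rewrite !mulrA; ring.
  by rewrite qinvP// mul1r.
rewrite exp_mulrn ?exp_log//.
by apply/nilpN/nilp_sum => q _; apply/nilpM/nilpX; exists (d * N)%N.
Qed.
End Pairing.

(** * Independence of the symbol of the chosen decompositions *)

Section CCValue.
Variable A : comPzRingType.
Hypothesis QA : isQ A.
Let QL : isQ (laurent A) := isQ_laurent QA.
Implicit Types (f g l m : laurent A) (U V P : units (laurent A)) (c : A) (nu mu : locconst A).

Lemma lc_support nu : exists2 s : seq int, uniq s &
  forall i, i \notin s -> lc_idem nu i = 0.
Proof.
have [s Hs] := (finite_seqP _).1 (lc_finite nu); exists (undup s); first exact: undup_uniq.
move=> i; rewrite mem_undup => /negP iX; apply: contrapT => H; apply: iX.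
by have : [set i | lc_idem nu i <> 0] i by []; rewrite Hs.
Qed.

Lemma lc_idem_sq nu n : lc_idem nu n * lc_idem nu n = lc_idem nu n.
Proof.
have := lc_sum1 nu; have [s us H0] := lc_support nu.
rewrite (@fsum_seq _ _ s)//.
move=> E; have := congr1 (fun z => lc_idem nu n * z) E; rewrite mulr1 mulr_sumr.
have [nX|/H0 ->] := boolP (n \in s); last by rewrite mul0r.
rewrite (bigD1_seq n nX us) big1 /= ?addr0// => i ne.
by rewrite lc_orth// eq_sym.
Qed.

Lemma lc_tpow nu n : lc_idem nu n *: tpow_lc nu = lc_idem nu n *: mono A n.
Proof.
rewrite /tpow_lc; have [s us H0] := lc_support nu.
rewrite (@fsum_seq _ _ s)//; last by move=> i /H0 ->; rewrite scale0r.
rewrite scaler_sumr.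
have [nX|/H0 ->] := boolP (n \in s); last first.
  by rewrite scale0r big1// => i _; rewrite scale0r.
rewrite (bigD1_seq n nX us) big1 /= ?addr0 => [|i ne].
  by rewrite scalerA lc_idem_sq.
by rewrite scalerA lc_orth ?scale0r// eq_sym.
Qed.

Lemma limit_prod (a : nat -> A) (Q : laurent A) :
  (forall n : nat, exists K : nat, forall k : nat, (K <= k)%N ->
    tpow n%:Z (Q - \prod_(1 <= i < k) (1 - a i *: mono A i%:Z))) ->
  tpow 0 Q /\ Q 0 = 1.
Proof.
move=> H; have Hp k : tpow 0 (\prod_(1 <= i < k) (1 - a i *: mono A i%:Z)) /\
   (\prod_(1 <= i < k) (1 - a i *: mono A i%:Z)) 0 = 1.
  elim: k => [|k [IH1 IH2]]; first by rewrite big_geq//; split;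
    [exact: tpow1|rewrite -mono0 coef_mono].
  case: k IH1 IH2 => [|k] IH1 IH2; first by rewrite big_geq//; split;
    [exact: tpow1|rewrite -mono0 coef_mono].
  have H1 : tpow 0 (1 - a k.+1 *: mono A k.+1%:Z).
    by apply: tpowB; [exact: tpow1|apply/tpowZ/tpow_mono].
  rewrite big_nat_recr//=; split; first exact: tpowM0.
  have := coefM_low IH1 H1; rewrite addr0 => ->; rewrite IH2 mul1r.
  by rewrite coefB coefZ -mono0 !coef_mono mulr0 subr0.
have [K HK] := H 1%N; have H1 := HK K (leqnn K); have [H2 H3] := Hp K.
split; first by rewrite -(subrK (\prod_(1 <= i < K) (1 - a i *: mono A i%:Z)) Q);
  apply: tpowD => //; apply: tpow_le H1.
by rewrite -(subrK (\prod_(1 <= i < K) (1 - a i *: mono A i%:Z)) Q) coefD H1// add0r.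
Qed.

Lemma nilp_neg_prod (a : nat -> A) M : (forall i, (i < M)%N -> nilpotent (a i)) ->
  exists N l, [/\ forall i, (i < M)%N -> a i ^+ N = 0, nilpotent l, low 0 l,
    l = \sum_(0 <= i < M) lg N (a i) (- i.+1%:Z) &
    exp l = \prod_(0 <= i < M) (1 - a i *: mono A (- i.+1%:Z))].
Proof.
move=> na; have [N aN] : exists N, forall i, (i < M)%N -> a i ^+ N = 0.
  elim: M na => [|M IH] na; first by exists 0%N.
  have [|N HN] := IH; first by move=> i lt; apply: na; lia.
  have [N' HN'] := na M (ltnSn M); exists (N + N')%N => i.
  rewrite ltnS leq_eqVlt => /orP[/eqP ->|/HN aN].
    by apply: expr_le0 HN'; lia.
  by apply: expr_le0 aN; lia.
exists N, (\sum_(0 <= i < M) lg N (a i) (- i.+1%:Z)); split=> //.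
- apply: nilp_sum => i; rewrite mem_index_iota => /andP[_ lt].
  by apply: nilp_lg => //; exact: aN.
- by apply: low_sum => i _; apply: low_lg; lia.
- rewrite !big_mkord.
  pose F (i : 'I_M) := lg N (a i) (- i.+1%:Z).
  rewrite -[LHS]/(exp (\sum_(i < M) F i)) exp_sum//; last first.
    by move=> i; apply: nilp_lg => //; exact: aN.
  by apply: eq_bigr => i _; apply: exp_lg => //; exact: aN.
Qed.

Lemma CC_decomp_neg f nu u a : CC_decomp f nu u a -> exists (M N : nat) l Q,
  [/\ (forall i : int, i < - M%:Z -> a i = 0) /\ (forall i : int, i < 0 -> a i ^+ N = 0),
      [/\ nilpotent l, low 0 l & l = \sum_(0 <= i < M) lg N (a (- i.+1%:Z)) (- i.+1%:Z)],
      forall n : nat, exists K : nat, forall k : nat, (K <= k)%N ->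
        tpow n%:Z (Q - \prod_(1 <= i < k) (1 - a i%:Z *: mono A i%:Z)),
      f = exp l * (uval u *: tpow_lc nu) * Q & tpow 0 Q /\ Q 0 = 1].
Proof.
move=> [Q [na [B HB] /(cvg_prod (fun i => a i%:Z)) HQ ->]].
pose M := absz B.
have aM i : i < - M%:Z -> a i = 0 by move=> lt; apply: HB; lia.
have [|N [l [aN nl Hl El Ee]]] := @nilp_neg_prod (fun i => a (- i.+1%:Z)) M.
  by move=> i _; apply: na; lia.
exists M, N.+1, l, Q; split=> //.
- split=> // i lt; have [ltM|le] := ltP i (- M%:Z); first by rewrite aM// expr0n.
  have -> : i = - (absz i).-1.+1%:Z by lia.
  by apply: (@expr_le0 _ _ N) => //; apply: aN; lia.
- split=> //; rewrite El; apply: eq_big_nat => i /andP[_ lt].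
  by apply: lg_N => //; [exact: aN|apply: (@expr_le0 _ _ N) => //; exact: aN].
- by rewrite Ee (neg_big aM).
- exact: limit_prod HQ.
Qed.

(** On the factor where $\nu=n$, the unit $U$ is modulo nilpotents both a power series with
    invertible constant term and $t^n$ times such a series. For $n\ne0$ this makes the idempotent
    nilpotent, hence zero. *)
Lemma CC_decomp_nu0 U nu u a : isW U -> CC_decomp (uval U) nu u a ->
  lc_idem nu 0 = 1 /\ forall n, n != 0 -> lc_idem nu n = 0.
Proof.
move=> [m [nm Hm [R [R1 R2 ER]]]] /CC_decomp_neg [M [N [l [Q [_ [nl Hl _] _ E [HQ Q0]]]]]].
have RR : uval R 0 * uinv R 0 = 1.
  by have := coefM_low R1 R2; rewrite addr0 uvalK -mono0 coef_mono eqxx.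
have en n : n != 0 -> lc_idem nu n = 0.
  move=> ne; pose e := lc_idem nu n; apply: idem_nilp; first exact: lc_idem_sq.
  have Hn : nilpotent (e *: uval R - (e * uval u) *: (mono A n * Q)).
    have -> : (e * uval u) *: (mono A n * Q) = e *: ((uval u *: tpow_lc nu) * Q).
      rewrite -[in RHS]scale_laurentAl [RHS]scalerA (mulrC e) -[LHS]scalerA -[RHS]scalerA.
      by rewrite [e *: (mono A n * Q)]scale_laurentAl [e *: (tpow_lc nu * Q)]scale_laurentAl
        lc_tpow.
    rewrite -scalerBr scale_cst; apply: nilpM.
    set X := (uval u *: tpow_lc nu) * Q.
    have EX : exp m * uval R = exp l * X by rewrite -ER E mulrA.
    have -> : uval R - X = (exp l - 1) * X - (exp m - 1) * uval R.
      by rewrite !mulrBl !mul1r EX; ring.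
    by apply: nilpB; apply/nilpMr/exp_nilp.
  have Emq k : (mono A n * Q) k = Q (k - n) by rewrite (mulrC (mono A n)) coefMmono.
  have Hc k : nilpotent (e * uval R k - (e * uval u) * Q (k - n)).
    by have := nilp_coef Hn k; rewrite coefB [X in X - _]coefZ [X in _ - X]coefZ Emq.
  have [lt|gt] := ltP n 0.
    have := Hc n; rewrite R1// mulr0 sub0r subrr Q0 mulr1.
    move=> /nilpN /(nilpM (uinv u)); rewrite opprK mulrCA.
    by rewrite (mulrC (uinv u)) uvalK mulr1.
  have := Hc 0; rewrite (HQ (0 - n)); last by lia.
  by rewrite mulr0 subr0 => /(nilpM (uinv R 0)); rewrite mulrCA (mulrC (uinv R 0)) RR mulr1.
split=> //; have := lc_sum1 nu; rewrite (@fsum_seq _ _ [:: 0])// ?big_seq1//.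
by move=> i; rewrite inE => /en.
Qed.
End CCValue.

Section CCEq.
Variable A : comPzRingType.
Hypothesis QA : isQ A.
Let QL : isQ (laurent A) := isQ_laurent QA.
Implicit Types (f g l m : laurent A) (U V P Q : units (laurent A)) (c : A) (nu mu : locconst A).

Definition is_limit (a : nat -> A) (Q : laurent A) :=
  forall n : nat, exists K : nat, forall k : nat, (K <= k)%N ->
        tpow n%:Z (Q - \prod_(1 <= i < k) (1 - a i *: mono A i%:Z)).

Lemma CC_data U nu u a : isW U -> CC_decomp (uval U) nu u a ->
  exists (M N : nat) Q,
  [/\ (forall i : int, i < - M%:Z -> a i = 0) /\ (forall i : int, i < 0 -> a i ^+ N = 0),
      lam U = \sum_(0 <= i < M) lg N (a (- i.+1%:Z)) (- i.+1%:Z),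
      dlog U = ddt (lam U) + dlog Q,
      tpow 0 (uval Q) /\ tpow 0 (uinv Q) &
      is_limit (fun i => a i%:Z) (uval Q)].
Proof.
move=> HU Hd; have [e0 en] := CC_decomp_nu0 QA HU Hd.
have [T1 _ _] := locconst0 (conj e0 en).
have [M [N [l [q [Ha [nl Hl El] Hlim E [Hq q0]]]]]] := CC_decomp_neg QA Hd.
have [|q' [Hq' qq' _]] := @tpow_inv _ _ 1 Hq; first by rewrite q0 mulr1.
pose Q := Units qq'.
have uu : (uval u *: (1 : laurent A)) * (uinv u *: (1 : laurent A)) = 1.
  by rewrite -scale_laurentAl mul1r scalerA uvalK scale1r.
pose C := Units uu.
have EU : U = (eU QA nl * C * Q)%g by apply: unitsP; rewrite E T1.
have -> : lam U = l.
  apply: (lamE QA); split=> //; exists (C * Q)%g; split.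
  - by apply: tpowM0 => //; apply/tpowZ/tpow1.
  - by apply: tpowM0 => //; apply/tpowZ/tpow1.
  - by rewrite EU /= mulrA.
exists M, N, Q; split=> //.
rewrite EU !dlogM dlog_eU; congr (_ + _).
by rewrite /(dlog C) /= LderivZ Lderiv1 scaler0 mul0r addr0.
Qed.

(** The quotient of $Q$ by a long partial product is $1$ up to order $B+1$, so its logarithmic
    derivative has order at least $B$ and no residue against $l$. *)
Lemma res_limit (a : nat -> A) Q (pu : nat -> units (laurent A)) l (B : nat) :
  is_limit a (uval Q) -> tpow 0 (uval Q) -> tpow 0 (uinv Q) ->
  (forall i, (0 < i)%N -> uval (pu i) = 1 - a i *: mono A i%:Z /\ tpow 0 (uinv (pu i))) ->
  tpow (- B%:Z) l ->
  exists K : nat, forall k, (K <= k)%N ->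
    res (l * dlog Q) = \sum_(1 <= i < k) res (l * dlog (pu i)).
Proof.
move=> Hlim Q1 Q2 Hpu Hl; have [K HK] := Hlim B.+1; exists K => k /HK H.
pose Pi := (\prod_(1 <= i < k) pu i)%g.
have EPi : uval Pi = \prod_(1 <= i < k) (1 - a i *: mono A i%:Z).
  transitivity (\prod_(1 <= i < k) uval (pu i)).
    exact: (big_morph (@uval (laurent A)) (@uvalM _) erefl).
  by apply: eq_big_nat => i /andP[i0 _]; have [] := Hpu i i0.
have HPi : tpow 0 (uinv Pi).
  have -> : uinv Pi = \prod_(1 <= i < k) uinv (pu i).
    by apply: (big_morph (@uinv (laurent A)) (fun x y => erefl) erefl).
  rewrite big_nat; apply: big_ind => [|f g|i /andP[i0 _]]; [exact: tpow1|exact: tpowM0|].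
  by have [] := Hpu i i0.
have dPi : dlog Pi = \sum_(1 <= i < k) dlog (pu i).
  apply: (big_morph (@dlog A) (@dlogM A)).
  by rewrite /dlog Lderiv1 mul0r.
pose R := (Pi^-1 * Q)%g.
have ER : Q = (Pi * R)%g by rewrite mulVKg.
have HR : tpow B.+1%:Z (uval R - 1).
  have -> : uval R - 1 = uinv Pi * (uval Q - uval Pi) by rewrite mulrBr uvalKV.
  by apply: tpowM0 => //; rewrite EPi.
have HuPi : tpow 0 (uval Pi).
  rewrite -[uval Pi](subKr (uval Q)); apply: tpowB => //.
  by rewrite EPi; apply: tpow_le H.
have HR2 : tpow 0 (uinv R) by exact: tpowM0.
have HdR : tpow B%:Z (dlog R).
  rewrite /dlog mulrC; apply: tpowM0 => //.
  have -> : ddt (uval R) = ddt (uval R - 1) by rewrite LderivB Lderiv1 subr0.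
  by apply: tpow_le (tpow_deriv HR); lia.
rewrite ER dlogM mulrDr resD dPi [X in _ + X]res_tpow0 ?addr0; last first.
  by have := tpowM Hl HdR; rewrite addNr.
by rewrite mulr_sumr /res coef_sum.
Qed.

(** The logarithm [lam V] is a finite sum and the power series factor of $U$ a convergent product,
    so the residue splits into the elementary pairings of [pair_exp]. *)
Lemma CC_prod_val U V nu u a mu v b : isW U -> isW V ->
  CC_decomp (uval U) nu u a -> CC_decomp (uval V) mu v b ->
  CC_prod a b = exp (- res (lam V * dlog U)).
Proof.
move=> HU HV /(CC_data HU)[M' [N' [Q [_ _ EU [Q1 Q2] Hlim]]]].
move=> /(CC_data HV)[M [N [_ [[b0 bN] EV _ _ _]]]].
have [pu Hpu] : exists pu : nat -> units (laurent A), forall i, (0 < i)%N ->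
    uval (pu i) = 1 - a i%:Z *: mono A i%:Z /\ tpow 0 (uinv (pu i)).
  exists (fun i => if pselect (0 < i)%N is left i0 then projT1 (cid (pu_ex (a i%:Z) i0)) else 1%g).
  by move=> i i0; case: pselect => // i0'; case: cid.
have [_ Hlow _] := lamP HV.
have -> : res (lam V * dlog U) = res (lam V * dlog Q).
  rewrite EU mulrDr resD res_lowM ?add0r//.
  by have [_ H _] := lamP HU; have := low_deriv H; rewrite sub0r.
have [B HB] : exists B : nat, tpow (- B%:Z) (lam V).
  by have [c Hc] := tpow_ex (lam V); exists (absz c); apply: tpow_le Hc; lia.
have [K HK] := res_limit Hlim Q1 Q2 Hpu HB.
(* [K] ensures convergence. The summand [N * M] ensures that for $i\ge k$ and $j\le M$ the exponent
   $i/(i,j)$ is at least $N$, which kills the power of $b_{-j}$. *)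
pose k := (K + N * M).+1.
rewrite (HK k); last by rewrite /k; lia.
rewrite -sumrN; set F := fun i : nat => - res (lam V * dlog (pu i)).
have nF i : nilpotent (F i).
  by apply/nilpN/nilp_res/nilpMr; have [] := lamP HV.
rewrite -[X in exp X]/(\sum_(1 <= i < k) F i) exp_sum//.
have EF i : (0 < i)%N -> exp (F i) = \prod_(0 <= j < M)
   (1 - a i%:Z ^+ (j.+1 %/ gcdn i j.+1) * b (- j.+1%:Z) ^+ (i %/ gcdn i j.+1)) ^+ gcdn i j.+1.
  move=> i0; have [E1 E2] := Hpu i i0.
  rewrite /F EV mulr_suml /res coef_sum -sumrN -[X in exp X]/(\sum_(0 <= j < M)
     (fun j : nat => - res (lg N (b (- j.+1%:Z)) (- j.+1%:Z) * dlog (pu i))) j).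
  rewrite exp_sum//; last by move=> j; apply/nilpN/nilp_res/nilpMr/nilp_lg => //; apply: bN.
  by apply: eq_bigr => j _; apply: pair_exp => //; exact: bN.
rewrite [RHS]big_nat; under [RHS]eq_bigr => i /andP[i0 _] do rewrite EF//.
rewrite -big_nat /CC_prod.
pose r := [seq (i, j.+1) | i <- index_iota 1 k, j <- index_iota 0 M].
rewrite (@fsbig_list _ _ _ _ _ r).
- by rewrite /r big_allpairs_dep.
- apply: allpairs_uniq; [exact: iota_uniq|exact: iota_uniq|].
  by move=> [i j] [i' j'] _ _ /= [-> ->].
- move=> [i j] /allpairsP[[i' j'] /= [H1 _ [-> ->]]]; split=> //.
  by move: H1; rewrite mem_index_iota => /andP[].
move=> [i j] /= [i0 j0] nr; have [lt|le] := ltnP M j.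
  rewrite b0; last by lia.
  rewrite expr0n (_ : (_ %/ _ == 0)%N = false) ?mulr0 ?subr0 ?expr1n//.
  by apply/negbTE; rewrite -lt0n divn_gt0 ?gcdn_gt0 ?i0// dvdn_leq// dvdn_gcdl.
have ki : (k <= i)%N.
  rewrite leqNgt; apply: contra nr => lt; apply/allpairsP; exists (i, j.-1).
  by rewrite !mem_index_iota /= i0 lt prednK//; split=> //; lia.
rewrite (@expr_le0 _ (b _) N) ?mulr0 ?subr0 ?expr1n//; last by apply: bN; lia.
rewrite leq_divRL ?gcdn_gt0 ?i0//; apply: leq_trans (ltnW ki).
apply: (@leq_trans (N * M)); last by rewrite leq_addl.
by rewrite leq_mul2l (leq_trans _ le) ?orbT// dvdn_leq// dvdn_gcdr.
Qed.

(** As this holds for every pair of decompositions, the choice made in [CC] does not affect its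
    value. *)
Lemma CC_spec_val U V w : isW U -> isW V -> CC_spec (uval U) (uval V) w ->
  uval w = exp (cca U V).
Proof.
move=> HU HV [nu [u [a [mu [v [b [Ha Hb]]]]]]].
have [e0 en] := CC_decomp_nu0 QA HU Ha; have [f0 fn] := CC_decomp_nu0 QA HV Hb.
have [_ U1 S1] := locconst0 (conj e0 en); have [_ U2 _] := locconst0 (conj f0 fn).
rewrite U1 U2 S1// !mul1r.
rewrite (CC_prod_val HU HV Ha Hb) (CC_prod_val HV HU Hb Ha) => E.
have n1 : nilpotent (res (lam U * dlog V)).
  by apply/nilp_res/nilpMr; have [] := lamP HU.
have n2 : nilpotent (res (lam V * dlog U)).
  by apply/nilp_res/nilpMr; have [] := lamP HV.
rewrite /cca expD//; last exact: nilpN.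
by rewrite -E mulrCA (mulrC (exp _)) expNr// mulr1.
Qed.

Lemma eu_subproof c : nilpotent c -> exp c * exp (- c) = 1.
Proof. by move=> nc; rewrite mulrC expNr. Qed.
Definition eu c : units A :=
  if pselect (nilpotent c) is left nc then Units (eu_subproof nc) else 1%g.

Lemma euE c : nilpotent c -> uval (eu c) = exp c.
Proof. by rewrite /eu; case: pselect. Qed.

Lemma euD c c' : nilpotent c -> nilpotent c' -> eu (c + c') = (eu c * eu c')%g.
Proof. by move=> nc nc'; apply: unitsP; rewrite /= !euE ?expD//; exact: nilpD. Qed.
Lemma euN c : nilpotent c -> eu (- c) = (eu c)^-1%g.
Proof.
move=> nc; apply: (mulIg (eu c)); rewrite -euD ?mulVg ?addNr//; last exact: nilpN.
by apply: unitsP; rewrite euE ?exp0//; exact: nilp0.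
Qed.

Lemma CC_val U V : isW U -> isW V -> CC (uval U) (uval V) = eu (cca U V).
Proof.
move=> HU HV; have nc := cca_nilp HU HV.
apply: unitsP; rewrite euE//; apply: CC_spec_val => //.
apply: (@xgetPex _ _ (CC_spec (uval U) (uval V))).
have [nu [u [a Ha]]] := CC_decomp_ex QA HU.
have [mu [v [b Hb]]] := CC_decomp_ex QA HV.
exists (eu (cca U V)), nu, u, a, mu, v, b; split=> //.
have [e0 en] := CC_decomp_nu0 QA HU Ha; have [f0 fn] := CC_decomp_nu0 QA HV Hb.
have [_ U1 S1] := locconst0 (conj e0 en); have [_ U2 _] := locconst0 (conj f0 fn).
rewrite U1 U2 S1// !mul1r.
rewrite (CC_prod_val HU HV Ha Hb) (CC_prod_val HV HU Hb Ha) euE// /cca.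
have n1 : nilpotent (res (lam U * dlog V)).
  by apply/nilp_res/nilpMr; have [] := lamP HU.
have n2 : nilpotent (res (lam V * dlog U)).
  by apply/nilp_res/nilpMr; have [] := lamP HV.
rewrite expD//; last exact: nilpN.
by rewrite mulrAC (mulrC (exp (res _))) expNr// mul1r.
Qed.
End CCEq.

(** * The determinantal cocycle *)

(** Sylvester's identity: one block matrix is factored into triangular ones in two ways. It compares
    matrices of different sizes, which [isdet_conj] needs. *)
Lemma det_add1_mulC (A : comPzRingType) m n (X : 'M[A]_(m, n)) (Y : 'M[A]_(n, m)) :
  \det (1%:M + X *m Y) = \det (1%:M + Y *m X).
Proof.
have E1 : block_mx 1%:M (- X) Y 1%:M =
   block_mx (1%:M + X *m Y) (- X) 0 1%:M *m block_mx 1%:M 0 Y 1%:M.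
  by rewrite mulmx_block !mulmx1 !mulmx0 !mul1mx !add0r mulNmx addrK.
have E2 : block_mx 1%:M (- X) Y 1%:M =
   block_mx 1%:M 0 Y 1%:M *m block_mx 1%:M (- X) 0 (1%:M + Y *m X).
  by rewrite mulmx_block !mulmx1 !mul0mx !mul1mx !addr0 mulmxN addrCA addNr addr0.
have := congr1 determinant (etrans (esym E1) E2).
by rewrite !det_mulmx !det_ublock !det_lblock !det1 !mulr1 !mul1r.
Qed.

Section Det.
Variable A : comPzRingType.
Implicit Types (f g : laurent A) (T S R : laurent A -> laurent A).

Definition fixn (n : nat) T := forall f, tpow n%:Z f -> T f = f.
Definition detn n T : A := \det (\matrix_(i < n, j < n) T (mono A j%:Z) i%:Z).
Definition op T := contlin T /\ forall f, tpow 0 f -> tpow 0 (T f).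
Definition isdet T (c : A) := exists2 n, fixn n T & c = detn n T.

Lemma big_iv0 (n : nat) (F : int -> A) : \sum_(i <- iv 0 n) F i = \sum_(i < n) F i%:Z.
Proof. by rewrite /iv big_map -(big_mkord xpredT (fun i : nat => F i%:Z)) /index_iota subn0;
  apply: eq_bigr => i _; rewrite add0r. Qed.

Lemma fixn_le n m T : (n <= m)%N -> fixn n T -> fixn m T.
Proof. by move=> le H f Hf; apply: H; apply: tpow_le Hf; lia. Qed.

Lemma detnS n T : fixn n T -> detn n.+1 T = detn n T.
Proof.
move=> H; rewrite /detn (expand_det_col _ ord_max) (bigD1 ord_max)//= big1 ?addr0 => [|i ne].
  rewrite !mxE H; last exact: tpow_mono.
  rewrite coef_mono eqxx mul1r /cofactor /= -signr_odd oddD addbb expr0 mul1r.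
  congr (\det _); apply/matrixP => i j; rewrite !mxE.
  by rewrite !lift_max.
rewrite !mxE H; last exact: tpow_mono.
rewrite coef_mono (_ : (_ == _) = false) ?mul0r//.
by apply/negbTE; apply: contra ne => /eqP[Hi]; apply/eqP/val_inj; exact: Hi.
Qed.

Lemma detn_le n m T : (n <= m)%N -> fixn n T -> detn m T = detn n T.
Proof.
move=> le H; rewrite -(subnKC le); elim: (m - n)%N => [|k IH]; first by rewrite addn0.
by rewrite addnS detnS//; apply: fixn_le H; lia.
Qed.

Lemma isdetE T c n : isdet T c -> fixn n T -> c = detn n T.
Proof.
move=> [m Hm ->] Hn; rewrite -(detn_le (leq_maxl m n) Hm).
exact: (detn_le (leq_maxr m n)).
Qed.

Lemma isdet_uniq T c c' : isdet T c -> isdet T c' -> c = c'.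
Proof. by move=> H [n Hn ->]; exact: isdetE. Qed.

Lemma isdet_ext T S c : (forall f, tpow 0 f -> T f = S f) -> isdet T c -> isdet S c.
Proof.
move=> E [n Hn ->]; exists n.
  by move=> f Hf; rewrite -E ?Hn//; apply: tpow_le Hf; lia.
by congr (\det _); apply/matrixP => i j; rewrite !mxE E//; exact: tpow_mono.
Qed.

Lemma isdet1 T : (forall f, tpow 0 f -> T f = f) -> isdet T 1.
Proof.
move=> H; exists 0%N; last by rewrite /detn det_mx00.
by move=> f Hf; apply: H; apply: tpow_le Hf.
Qed.

Lemma op_comp T S : op T -> op S -> op (T \o S).
Proof.
move=> [T1 T2] [S1 S2]; split; first exact: contlin_comp.
by move=> f Hf; apply/T2/S2.
Qed.

Lemma isdetM T S c d : op T -> op S -> isdet T c -> isdet S d -> isdet (T \o S) (c * d).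
Proof.
move=> [T1 T2] [S1 S2] Hc Hd; have [n Hn _] := Hc; have [m Hm _] := Hd.
pose k := maxn n m; have HT : fixn k T by exact: fixn_le (leq_maxl n m) Hn.
have HS : fixn k S by exact: fixn_le (leq_maxr n m) Hm.
exists k; first by move=> f Hf /=; rewrite HS// HT.
rewrite (isdetE Hc HT) (isdetE Hd HS) /detn -det_mulmx; congr (\det _).
apply/matrixP => i j; rewrite !mxE /=.
have HSj : tpow 0 (S (mono A j%:Z)) by apply: S2; exact: tpow_mono.
rewrite (contlinE (K := k) T1 HSj).
  by rewrite big_iv0; apply: eq_bigr => l _; rewrite !mxE mulrC.
by move=> g; rewrite add0r => Hg; rewrite HT//; apply: tpow_le Hg; have := ltn_ord i; lia.
Qed.

Lemma isdet_inv T S : op T -> op S -> (forall f, tpow 0 f -> T (S f) = f) ->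
  (exists n, fixn n T) -> (forall f, tpow 0 f -> S (T f) = f) ->
  exists c d, [/\ isdet T c, isdet S d & c * d = 1].
Proof.
move=> HT HS TS [n Hn] ST.
have Hn' : fixn n S by move=> f Hf; rewrite -{1}(Hn f Hf) ST//; apply: tpow_le Hf; lia.
have H1 : isdet T (detn n T) by exists n.
have H2 : isdet S (detn n S) by exists n.
exists (detn n T), (detn n S); split=> //.
apply: (isdet_uniq (isdetM HT HS H1 H2)); exact: isdet1.
Qed.

(** This is not conjugation of matrices, as $R$ need not respect any truncation. With $N=T-1$ the
    determinants are those of $1+NR'R$ and $1+RNR'$, and [det_add1_mulC] applies to their
    truncations. *)
Lemma isdet_conj T R R' c : op T -> op R -> op R' ->
  (forall f, tpow 0 f -> R (R' f) = f) -> (forall f, tpow 0 f -> R' (R f) = f) ->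
  isdet T c -> isdet (R \o T \o R') c.
Proof.
move=> [T1 T2] [R1 R2] [Q1 Q2] RQ QR Hc; have [n Hn _] := Hc.
(* $R'$ maps $t^mA[[t]]$ into $t^nA[[t]]$, where $T-1$ vanishes, and $R$ maps $t^MA[[t]]$ into
   $t^mA[[t]]$; so [X] and [Y] contain all entries that matter. *)
have [m0 Hm0] := Q1.2 n%:Z; pose m := (n + absz m0)%N.
have Hm f : tpow m%:Z f -> tpow n%:Z (R' f) by move=> Hf; apply: Hm0; apply: tpow_le Hf; lia.
have [M0 HM0] := R1.2 m%:Z; pose M := (m + absz M0)%N.
have HM f : tpow M%:Z f -> tpow m%:Z (R f) by move=> Hf; apply: HM0; apply: tpow_le Hf; lia.
exists m.
  move=> f Hf /=; rewrite Hn; last exact: Hm.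
  by rewrite RQ//; apply: tpow_le Hf; lia.
rewrite (@isdetE _ _ M Hc); last by apply: fixn_le Hn; lia.
pose N f := T f - f.
have Nc : contlin (N \o R').
  apply: contlin_comp Q1; split=> [a u v|k]; first by rewrite /N T1.1 scalerBr opprD addrACA.
  have [b Hb] := T1.2 k; exists (Num.max b k) => g Hg.
  by apply: tpowB; [apply: Hb; apply: tpow_le Hg; lia|apply: tpow_le Hg; lia].
have N0 f : tpow m%:Z f -> N (R' f) = 0 by move=> /Hm Hf; rewrite /N Hn// subrr.
have Npos f : tpow 0 f -> tpow 0 (N f) by move=> Hf; apply: tpowB => //; exact: T2.
pose X : 'M[A]_(m, M) := \matrix_(i, l) R (mono A l%:Z) i%:Z.
pose Y : 'M[A]_(M, m) := \matrix_(l, j) N (R' (mono A j%:Z)) l%:Z.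
have t0 (j : nat) : tpow 0 (mono A j%:Z) by exact: tpow_mono.
transitivity (\det (1%:M + Y *m X)).
  congr (\det _); apply/matrixP => l l'; rewrite !mxE.
  have -> : T (mono A l'%:Z) l%:Z = (l == l')%:R + (N (R' (R (mono A l'%:Z)))) l%:Z.
    by rewrite QR// /N coefB coef_mono -[(l == l')%:R]/((l%:Z == l'%:Z)%:R) addrC subrK.
  congr (_ + _); rewrite -[LHS]/((N \o R') (R (mono A l'%:Z)) l%:Z).
  rewrite (contlinE (K := m) Nc (R2 _ (t0 l'))).
    by rewrite big_iv0; apply: eq_bigr => i _; rewrite !mxE mulrC.
  by move=> g; rewrite add0r => Hg; rewrite /= N0.
rewrite -det_add1_mulC; congr (\det _); apply/matrixP => i j; rewrite !mxE /=.
have -> : R (T (R' (mono A j%:Z))) i%:Z = (i == j)%:R + R (N (R' (mono A j%:Z))) i%:Z.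
  have -> : N (R' (mono A j%:Z)) = T (R' (mono A j%:Z)) + (-1) *: R' (mono A j%:Z).
    by rewrite scaleN1r.
  rewrite (contlinD R1) (contlinZ R1) RQ// coefD coefZ coef_mono.
  by rewrite -[(i == j)%:R]/((i%:Z == j%:Z)%:R) mulN1r addrC subrK.
congr (_ + _).
rewrite (contlinE (K := M) R1 (Npos _ (Q2 _ (t0 j)))).
  by rewrite big_iv0; apply: eq_bigr => l _; rewrite !mxE mulrC.
move=> g; rewrite add0r => Hg; apply: tpow_le (HM _ Hg); have := ltn_ord i; lia.
Qed.

End Det.

(** A permutation other than the identity moves at least two indices, and two off-diagonal entries
    already contribute $c^2=0$. *)
Lemma det_add1_sq0 (A : comPzRingType) n (c : A) (M : 'M[A]_n) : c * c = 0 ->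
  \det (1%:M + c *: M) = 1 + c * \tr M.
Proof.
move=> cc; rewrite /determinant (bigD1 (1%g : 'S_n))//= [X in _ + X]big1 ?addr0 => [|s s1].
  rewrite odd_perm1 expr0 mul1r.
  transitivity (\prod_i (1 + c * M i i)).
    by apply: eq_bigr => i _; rewrite perm1 !mxE eqxx.
  rewrite /mxtrace mulr_sumr; elim: (index_enum _) => [|i r IH].
    by rewrite !big_nil addr0.
  rewrite !big_cons IH mulrDr mulr1 mulrDl mul1r.
  suff -> : c * M i i * \sum_(j <- r) c * M j j = 0 by rewrite addr0 addrA addrAC.
  by rewrite -mulr_sumr mulrACA cc mul0r.
have [i si] : exists i, s i != i.
  apply/existsP; apply: contraNT s1; rewrite negb_exists => /forallP H.
  by apply/eqP/permP => i; rewrite perm1; apply/eqP; have := H i; rewrite negbK.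
have ssi : s (s i) != s i by apply: contra si => /eqP/perm_inj ->.
rewrite (bigD1 i)//= (bigD1 (s i))//= !mxE (eq_sym i) (negPf si) (eq_sym (s i)) (negPf ssi) !add0r.
by rewrite mulrCA -!mulrA !(mulrCA _ c) !mulrA cc !mul0r ?mulr0.
Qed.

(** * Compressions to $A[[t]]$ and the cocycle $D$ *)

Section DetCocycle.
Variable A : comPzRingType.
Implicit Types (f g : laurent A) (x y z h k : laut A).

Lemma dmapE x f : dmap x f = hi 0 (x f). Proof. exact: prE. Qed.

Lemma dmap_op x : op (dmap x).
Proof.
split; last by move=> f _; rewrite dmapE; exact: hi_tpow.
have [H1 H2] := contlin_comp (hi_contlin A 0) (laut_contlin x).
split=> [a f g|n]; first by rewrite !dmapE; exact: H1.
by have [m Hm] := H2 n; exists m => f /Hm; rewrite dmapE.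
Qed.

(** If $x = hk$ is the Birkhoff factorization, then $d_x = d_h d_k$ with
    $d_h^{-1} = d_{h^{-1}}$ and $d_k$ the restriction of $k$. *)
Definition dinv x f : laurent A := (fac x).2^-1%g (hi 0 ((fac x).1^-1%g f)).

Lemma dinv_op x : op (dinv x).
Proof.
have [_ Hp _] := facP x.
split; last by move=> f _; apply/(GposV Hp); exact: hi_tpow.
exact: (contlin_comp (laut_contlin _) (contlin_comp (hi_contlin A 0) (laut_contlin _))).
Qed.

Lemma hi_hi x f : (forall g, low 0 g -> low 0 (x g)) -> hi 0 (x (hi 0 f)) = hi 0 (x f).
Proof.
move=> Hx; apply/eqP; rewrite -subr_eq0 -(raddfB (hi 0)) -lautB.
by apply/eqP/hi_eq0; rewrite -opprB lautN; apply/lowN/Hx; exact: hi_low.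
Qed.

Lemma dmapK x f : tpow 0 f -> dinv x (dmap x f) = f.
Proof.
move=> Hf; have [Hm Hp E] := facP x; rewrite dmapE /dinv hi_hi; last first.
  by move=> g; apply: Gneg_low'; exact: GnegV.
rewrite -[X in hi 0 X]laut_mulE [X in (_^-1 * X)%g]E mulKg hi_id; last exact/Hp.
by rewrite -laut_mulE mulVg.
Qed.

Lemma dmapVK x f : tpow 0 f -> dmap x (dinv x f) = f.
Proof.
move=> Hf; have [Hm Hp E] := facP x; rewrite dmapE /dinv {1}E laut_mulE.
rewrite -[X in (fac x).1 X]laut_mulE mulgV laut1E hi_hi; last by move=> g; exact: Gneg_low'.
by rewrite -laut_mulE mulgV laut1E hi_id.
Qed.

Lemma dinv_uniq x f g : tpow 0 f -> tpow 0 g -> dmap x f = g -> f = dinv x g.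
Proof. by move=> Hf Hg <-; rewrite dmapK. Qed.

Definition Tdet x y f : laurent A := dmap x (dmap y (dinv (x * y)%g f)).

Lemma Tdet_op x y : op (Tdet x y).
Proof. exact: (op_comp (dmap_op x) (op_comp (dmap_op y) (dinv_op _))). Qed.

Lemma dmapM_fix x y : exists n : nat, forall f, tpow n%:Z f -> dmap x (dmap y f) = dmap (x * y)%g f.
Proof.
have [m Hm] := (laut_contlin y).2 0; exists (absz m) => f Hf.
rewrite !dmapE [hi 0 (y f)]hi_id//; apply: Hm; apply: tpow_le Hf; lia.
Qed.

Lemma Tdet_fix x y : exists n, fixn n (Tdet x y).
Proof.
have [n Hn] := dmapM_fix x y; have [[_ H] _] := dinv_op (x * y)%g.
have [m Hm] := H n%:Z; exists (absz m) => f Hf.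
rewrite /Tdet Hn; last by apply: Hm; apply: tpow_le Hf; lia.
by rewrite dmapVK//; apply: tpow_le Hf; lia.
Qed.

Lemma Tdet_unit x y : exists c d, isdet (Tdet x y) c /\ c * d = 1.
Proof.
pose S f := dmap (x * y)%g (dinv y (dinv x f)).
have HS : op S by exact: (op_comp (dmap_op _) (op_comp (dinv_op y) (dinv_op x))).
have [|||c [d [H1 _ H2]]] := @isdet_inv _ (Tdet x y) S (Tdet_op x y) HS; last by exists c, d.
- move=> f Hf; rewrite /Tdet /S dmapK ?dmapVK//; last by apply: (dinv_op y).2; apply: (dinv_op x).2.
  exact: (dinv_op x).2.
- exact: Tdet_fix.
- move=> f Hf; rewrite /Tdet /S dmapK; last first.
    by apply: (dmap_op y).2; exact: (dinv_op _).2.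
  by rewrite dmapK ?dmapVK//; exact: (dinv_op _).2.
Qed.

(** The inverse of $d_{xy}$ on $A[[t]]$ is unique, so any witness in [det_spec] agrees there with
    [dinv]. *)
Lemma detc_spec x y : isdet (Tdet x y) (uval (det_cocycle x y)).
Proof.
have : det_spec x y (det_cocycle x y).
  apply: (@xgetPex _ _ (det_spec x y)).
  have [c [d [[n Hn Ec] cd]]] := Tdet_unit x y.
  exists (Units cd), (dinv (x * y)%g), n; split=> //; split.
  - exact: (dinv_op _).2.
  - exact: dmapVK.
  - exact: dmapK.
move=> [e [n [[H1 H2 H3] Hn ->]]].
have Ee f : tpow 0 f -> e f = dinv (x * y)%g f.
  by move=> Hf; apply: dinv_uniq; [exact: H1| |exact: H2].
exists n; first by move=> f Hf; rewrite /Tdet -Ee ?Hn//; apply: tpow_le Hf; lia.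
congr (\det _); apply/matrixP => i j; rewrite !mxE /Tdet Ee//.
exact: tpow_mono.
Qed.

Lemma detc_uniq x y w : isdet (Tdet x y) (uval w) -> det_cocycle x y = w.
Proof. by move=> H; apply: unitsP; exact: isdet_uniq (detc_spec x y) H. Qed.

(** Both sides are the determinant of $d_xd_yd_zd_{xyz}^{-1}$; on the right $d_yd_zd_{yz}^{-1}$
    enters conjugated by $d_x$, which does not change its determinant. *)
Lemma detc_cocycle x y z :
  (det_cocycle x y * det_cocycle (x * y) z = det_cocycle y z * det_cocycle x (y * z))%g.
Proof.
apply: unitsP; rewrite /=.
have H1 := isdetM (Tdet_op _ _) (Tdet_op _ _) (detc_spec x y) (detc_spec (x * y)%g z).
have HC : isdet (dmap x \o Tdet y z \o dinv x) (uval (det_cocycle y z)).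
  apply: isdet_conj (detc_spec y z); [exact: Tdet_op|exact: dmap_op|exact: dinv_op| |].
    exact: dmapVK.
  exact: dmapK.
have HCop : op (dmap x \o Tdet y z \o dinv x).
  exact: (op_comp (op_comp (dmap_op x) (Tdet_op y z)) (dinv_op x)).
have H2 := isdetM HCop (Tdet_op _ _) HC (detc_spec x (y * z)%g).
apply: isdet_uniq H1 _; apply: isdet_ext H2 => f Hf.
have P1 u g : tpow 0 g -> tpow 0 (dinv u g) by exact: (dinv_op u).2.
have P2 u g : tpow 0 g -> tpow 0 (dmap u g) by exact: (dmap_op u).2.
by rewrite /= /Tdet mulgA !dmapK//; do ?[apply: P1|apply: P2].
Qed.

(** $d_xd_y=d_{xy}$ as soon as $x$ preserves $t^{-1}A[t^{-1}]$. This form covers diagonal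
    automorphisms together with $G_-$. *)
Lemma detc_low x y : (forall g, low 0 g -> low 0 (x g)) -> det_cocycle x y = 1%g.
Proof.
move=> Hx; apply: detc_uniq; apply: isdet1 => f Hf; rewrite /Tdet.
suff -> : forall g, dmap x (dmap y g) = dmap (x * y)%g g by exact: dmapVK.
by move=> g; rewrite !dmapE hi_hi.
Qed.

Lemma detc_Gpos x y : Gpos y -> det_cocycle x y = 1%g.
Proof.
move=> Hy; apply: detc_uniq; apply: isdet1 => f Hf; rewrite /Tdet.
suff -> : forall g, tpow 0 g -> dmap x (dmap y g) = dmap (x * y)%g g.
  exact: dmapVK.
  exact: (dinv_op _).2.
by move=> g Hg; rewrite !dmapE [hi 0 (y g)]hi_id//; apply/Hy.
Qed.

End DetCocycle.

Section DetMorph.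
Variables (A B : comPzRingType) (r : {rmorphism A -> B}).
Implicit Types (x y : laut A) (f : laurent A).

Lemma hi_map i f : hi i (map_laurent r f) = map_laurent r (hi i f).
Proof. by apply: laurentP => n /=; case: ifP; rewrite ?rmorph0. Qed.

Lemma dmap_morph x f : dmap (base_change r x) (map_laurent r f) = map_laurent r (dmap x f).
Proof. by rewrite !dmapE base_change_map hi_map. Qed.

Lemma dinv_morph x f : dinv (base_change r x) (map_laurent r f) = map_laurent r (dinv x f).
Proof. by rewrite /dinv fac_morph [fst _]/= [snd _]/= -!base_changeV base_change_map hi_map
  base_change_map. Qed.

Lemma detc_morph x y :
  det_cocycle (base_change r x) (base_change r y) = units_map r (det_cocycle x y).
Proof.
apply: detc_uniq; rewrite /=; have [n Hn ->] := detc_spec x y.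
have ET f : Tdet (base_change r x) (base_change r y) (map_laurent r f) = map_laurent r (Tdet x y f).
  by rewrite /Tdet -base_changeM dinv_morph !dmap_morph.
have [m Hm] := Tdet_fix (base_change r x) (base_change r y).
have Hk : fixn (maxn n m) (Tdet (base_change r x) (base_change r y)).
  exact: fixn_le (leq_maxr _ _) Hm.
exists (maxn n m) => //.
rewrite -(detn_le (leq_maxl n m) Hn) /detn -det_map_mx; congr (\det _).
by apply/matrixP => i j; rewrite !mxE -(map_mono r) ET.
Qed.
End DetMorph.

(** * Deformations and infinitesimal automorphisms *)

Section MapLaurent.
Variables (A B : comPzRingType) (r : {rmorphism A -> B}).
Hypothesis QA : isQ A.
Let QB : isQ B := isQ_morph r QA.
Implicit Types (f g l : laurent A) (U V : units (laurent A)) (x : laut A).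

Lemma map_laurent_zmod : zmod_morphism (map_laurent r).
Proof. by move=> f g; apply: laurentP => n; rewrite coefB /= -rmorphB -coefB. Qed.
Lemma map_laurent_monoid : monoid_morphism (map_laurent r).
Proof. by split; [rewrite -mono0 map_mono|exact: map_laurentM]. Qed.
HB.instance Definition _ :=
  GRing.isZmodMorphism.Build _ _ (map_laurent r) map_laurent_zmod.
HB.instance Definition _ :=
  GRing.isMonoidMorphism.Build _ _ (map_laurent r) map_laurent_monoid.

Definition mapU U : units (laurent B) := units_map (map_laurent r) U.

Lemma map_deriv f : ddt (map_laurent r f) = map_laurent r (ddt f).
Proof. by apply: laurentP => n; rewrite !derivE /= -rmorphMz. Qed.

Lemma map_low i f : low i f -> low i (map_laurent r f).
Proof. by move=> Hf n /Hf /= ->; exact: rmorph0. Qed.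

Lemma dlog_map U : dlog (mapU U) = map_laurent r (dlog U).
Proof. by rewrite /dlog /= map_deriv map_laurentM. Qed.

Lemma res_map f : res (map_laurent r f) = r (res f). Proof. by []. Qed.

Lemma Wdec_map U l : Wdec U l -> Wdec (mapU U) (map_laurent r l).
Proof.
move=> [nl Hl [P [P1 P2 E]]]; split; [exact: (nilp_morph (map_laurent r))|exact: map_low|].
exists (mapU P); split; [exact: tpow_map|exact: tpow_map|].
by rewrite /= E map_laurentM (exp_morph (map_laurent r) (isQ_laurent QA)).
Qed.

Lemma lam_map U : isW U -> lam (mapU U) = map_laurent r (lam U).
Proof. by move=> /lamP /Wdec_map; exact: lamE. Qed.

Lemma cca_map U V : isW U -> isW V -> cca (mapU U) (mapU V) = r (cca U V).
Proof.
by move=> HU HV; rewrite /cca !lam_map// !dlog_map -!map_laurentM !res_map -rmorphB.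
Qed.

Lemma lact_map x U : lact (base_change r x) (mapU U) = mapU (lact x U).
Proof. by apply: unitsP; exact: base_change_map. Qed.
End MapLaurent.

(** * Scaling of triangular automorphisms *)

Section Twist.
Variables (A : comPzRingType) (s : A).
Implicit Types (f g : laurent A) (L M : laurent A -> laurent A) (x : laut A) (i j n : int).

(** The value [true] is for $G_+$, [false] for $G_-$. *)
Definition tri (b : bool) L := forall i n, (if b then n < i else i < n) -> L (mono A i) n = 0.

Section TwistMap.
Variable L : laurent A -> laurent A.
Hypothesis LP : contlin L.
Hypothesis LM : {morph L : f g / f * g}.

(** Scaling by an invertible $s$ would give the exponent $n-i$ or $i-n$. On a triangular map it has
    a constant sign, so the absolute value makes sense of it for every $s$. *)
Definition twc f n : A := \sum_(i \in setT) f i * (s ^+ absz (n - i)%R * L (mono A i) n).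

Lemma tw_zero a n f N : tpow a f -> (forall g, tpow a g -> tpow N (L g)) ->
  n < N -> twc f n = 0.
Proof.
move=> Hf HN lt; rewrite /twc fsbig1// => i _.
have [lti|le] := ltP i a; first by rewrite Hf// mul0r.
by rewrite (HN (mono A i)) ?mulr0//; exact: tpow_mono.
Qed.

Lemma tw_subproof f : exists N : int, forall i, i < N -> twc f i = 0.
Proof.
have [a Hf] := tpow_ex f; have [N HN] := contlin_bound a LP LM.
by exists N => i lt; exact: tw_zero HN lt.
Qed.
(** The conjugate of [L] by $t \mapsto st$ or $t \mapsto s^{-1}t$. *)
Definition twl f : laurent A := Laurent (tw_subproof f).

Lemma twE n : exists m, forall a K f, tpow a f -> m <= a + K%:Z ->
  twl f n = \sum_(i <- iv a K) f i * (s ^+ absz (n - i)%R * L (mono A i) n).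
Proof.
have [m Hm] := LP.2 (n + 1); exists m => a K f Hf le.
apply: fsum_iv => i ni.
have [lt|lei] := ltP i a; first by rewrite Hf// mul0r.
rewrite (Hm (mono A i)) ?mulr0//; last by lia.
by apply: tpow_mono; lia.
Qed.

Lemma twl_contlin : contlin twl.
Proof.
split=> [c f g|n].
  apply: laurentP => n; rewrite coefD coefZ.
  have [m Hm] := twE n; have [a Hf] := tpow_ex f; have [b Hg] := tpow_ex g.
  pose d := Num.min a b; have le1 : d <= a by lia.
  have le2 : d <= b by lia.
  have Hf' := tpow_le le1 Hf; have Hg' := tpow_le le2 Hg.
  have le : m <= d + (absz (m - d)%R)%:Z by lia.
  rewrite (Hm _ _ _ (tpowD (tpowZ c Hf') Hg') le) (Hm _ _ _ Hf' le).
  rewrite (Hm _ _ _ Hg' le) big_distrr -big_split /=.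
  by apply: eq_bigr => i _; rewrite coefD coefZ mulrDl -mulrA.
have [m Hm] := LP.2 n; exists m => f Hf i lt; exact: tw_zero Hm lt.
Qed.

Lemma twl_mono i n : twl (mono A i) n = s ^+ absz (n - i)%R * L (mono A i) n.
Proof.
rewrite /= /twc (@fsum_seq _ _ [:: i])//.
  by rewrite big_seq1 coef_mono eqxx mul1r.
by move=> j; rewrite inE coef_mono => /negPf ->; rewrite mul0r.
Qed.

Variable b : bool.
Hypothesis Lb : tri b L.

(** In each nonzero term the differences of degrees have the same sign, so their absolute values
    add. *)
Lemma twl_morph : {morph twl : f g / f * g}.
Proof.
apply: contlin_morph twl_contlin _ => i j; apply: laurentP => n.
have [a Ha] := tpow_ex (L (mono A i)); have [c Hc] := tpow_ex (L (mono A j)).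
have Ha' : tpow a (twl (mono A i)) by move=> m lt; rewrite twl_mono Ha ?mulr0.
have Hc' : tpow c (twl (mono A j)) by move=> m lt; rewrite twl_mono Hc ?mulr0.
pose ss := iv a (absz (n - c + 1 - a)%R).
have Hs m : a <= m <= n - c -> m \in ss by rewrite mem_iv; lia.
rewrite twl_mono monoD LM.
rewrite [(L _ * L _) n](convE Ha Hc (iv_uniq _ _) Hs).
rewrite [RHS](convE Ha' Hc' (iv_uniq _ _) Hs) mulr_sumr.
apply: eq_bigr => m _; rewrite !twl_mono mulrACA.
have [lt1|le1] := boolP (if b then m < i else i < m).
  by rewrite Lb// !(mul0r, mulr0).
have [lt2|le2] := boolP (if b then n - m < j else j < n - m).
  by rewrite (Lb (i := j))// !(mul0r, mulr0).
rewrite -exprD; congr (_ ^+ _ * _).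
by move: le1 le2; case: b; lia.
Qed.
End TwistMap.

Lemma twl_comp b L M (LP : contlin L) (MP : contlin M) LM MM f :
  tri b L -> tri b M -> L \o M =1 id -> twl LP LM (twl MP MM f) = f.
Proof.
move=> Lb Mb LMid.
have := contlin_ext (contlin_comp (twl_contlin LP LM) (twl_contlin MP MM)) (@contlin_id A).
apply=> i; apply: laurentP => n.
suff: twl LP LM (twl MP MM (mono A i)) n = mono A i n by [].
have E : L (M (mono A i)) n = mono A i n by exact: (congr1 (fun g : laurent A => g n) (LMid
  (mono A i))).
have [m Hm] := twE LP LM n; have [a Hf] := tpow_ex (M (mono A i)).
have Hf' : tpow a (twl MP MM (mono A i)) by move=> k lt; rewrite twl_mono Hf ?mulr0.
have [m' Hm'] := LP.2 (n + 1).
pose K := absz (Num.max m m' - a)%R.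
have le : m <= a + K%:Z by lia.
rewrite (Hm _ _ _ Hf' le).
rewrite (contlinE (K := K) LP Hf) in E; last first.
  by move=> g Hg; apply: Hm'; apply: tpow_le Hg; lia.
transitivity (s ^+ absz (n - i)%R * (mono A i) n); last first.
  by rewrite coef_mono; case: eqP => [->|_]; rewrite ?mulr0// subrr expr0 mul1r.
rewrite -E mulr_sumr; apply: eq_bigr => k _; rewrite twl_mono.
have [lt1|le1] := boolP (if b then k < i else i < k).
  by rewrite Mb// !(mul0r, mulr0).
have [lt2|le2] := boolP (if b then n < k else k < n).
  by rewrite (Lb k)// !(mul0r, mulr0).
rewrite mulrACA -exprD [M _ _ * _]mulrC (mulrC (L _ _)); congr (_ ^+ _ * _).
by move: le1 le2; case: b {Lb Mb}; lia.
Qed.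

Section TwLaut.
Variables (b : bool) (x : laut A).
Hypothesis xb : tri b x.
Hypothesis xb' : tri b (laut_inv x).

Let xM : {morph x : f g / f * g} := (laut_morph x).2.
Let xM' : {morph laut_inv x : f g / f * g} := (laut_inv_morph x).2.

Lemma tw_monoid : monoid_morphism (twl (laut_contlin x) xM).
Proof.
split; last exact: twl_morph xb.
apply: laurentP => n; rewrite -[X in twl _ _ X]mono0 twl_mono mono0 laut1r subr0.
by rewrite -mono0 coef_mono; case: eqP => [->|_]; rewrite ?mulr0// expr0 mul1r.
Qed.

Definition tw : laut A := @Laut A (twl (laut_contlin x) xM) (twl (laut_inv_contlin x) xM')
  (twl_contlin _ _).1 tw_monoid
  (fun f => twl_comp _ _ _ _ f xb' xb (@lautK _ x))
  (fun f => twl_comp _ _ _ _ f xb xb' (@lautVK _ x))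
  (contlin_continuous (twl_contlin _ _)) (contlin_continuous (twl_contlin _ _)).

Lemma tw_mono i n : tw (mono A i) n = s ^+ absz (n - i)%R * x (mono A i) n.
Proof. exact: twl_mono. Qed.
Lemma twV_mono i n : (tw^-1)%g (mono A i) n = s ^+ absz (n - i)%R * (x^-1)%g (mono A i) n.
Proof. exact: twl_mono. Qed.
End TwLaut.

Lemma tri_Gpos x : Gpos x -> tri true x.
Proof. by move=> Hx i n lt; have := (Hx i (mono A i)).2 (tpow_mono A (lexx i)); apply. Qed.

Lemma tri_Gneg x : Gneg x -> tri false x.
Proof.
move=> Hx i n lt; have := Hx i n (ltW lt); rewrite coefB coef_mono gt_eqF// subr0.
by [].
Qed.

Definition twp x (Hx : Gpos x) : laut A := tw (tri_Gpos Hx) (tri_Gpos (GposV Hx)).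
Definition twm x (Hx : Gneg x) : laut A := tw (tri_Gneg Hx) (tri_Gneg (GnegV Hx)).

Lemma Gpos_twp x (Hx : Gpos x) : Gpos (twp Hx).
Proof.
apply: GposP => i n lt.
  by apply: etrans (tw_mono (tri_Gpos Hx) (tri_Gpos (GposV Hx)) i n) _; rewrite tri_Gpos ?mulr0.
apply: etrans (twV_mono (tri_Gpos Hx) (tri_Gpos (GposV Hx)) i n) _.
by rewrite (tri_Gpos (GposV Hx)) ?mulr0.
Qed.

Lemma Gneg_twm x (Hx : Gneg x) : Gneg (twm Hx).
Proof.
move=> i n le; have := Hx i n le; rewrite !coefB tw_mono coef_mono.
case: eqP => [->|_]; first by rewrite subrr expr0 mul1r.
by rewrite !subr0 => ->; rewrite mulr0.
Qed.

End Twist.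

(** * Automorphisms infinitely near the identity *)

Section Infinitesimal.
Variable A : comPzRingType.
Implicit Types (f g u v w : laurent A) (x y z : laut A) (i j n : int) (e d : A).

Lemma laut_ext_t x y : x (mono A 1) = y (mono A 1) -> x = y.
Proof.
move=> E; have H1 (k : nat) : x (mono A k%:Z) = y (mono A k%:Z).
  by rewrite !laut_monoX /tilde E.
apply: laut_ext => -[k|k]; first exact: H1.
have -> : Negz k = - k.+1%:Z by [].
have E2 : y (mono A (- k.+1%:Z)) * y (mono A k.+1%:Z) = 1.
  by rewrite -lautM -monoD addNr mono0 laut1r.
rewrite -[LHS]mulr1 -E2 mulrCA -H1 -lautM -monoD addNr mono0 laut1r.
by rewrite mulr1.
Qed.

Definition inflf e w f := f + e *: (w * ddt f).

Lemma inflf_linear e w : linear (inflf e w).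
Proof.
move=> a f g; rewrite /inflf LderivD LderivZ mulrDr (mulrC w (a *: _)) -scale_laurentAl.
rewrite (mulrC (ddt f)) !scalerDr [LHS]addrACA; congr (_ + _ + _).
by rewrite !scalerA (mulrC e).
Qed.

Lemma inflf_contlin e w : contlin (inflf e w).
Proof.
split=> [|n]; first exact: inflf_linear.
have [m Hm] := (contlin_comp (contlin_mull w) (@deriv_contlin A)).2 n.
exists (Num.max n m) => f Hf; apply: tpowD; first by apply: tpow_le Hf; lia.
by apply/tpowZ/Hm; apply: tpow_le Hf; lia.
Qed.

Section Infl.
Variables (e : A) (w : laurent A).
Hypothesis ee : e * e = 0.

Lemma scale_ee f : e *: (e *: f) = 0.
Proof. by rewrite scalerA ee scale0r. Qed.

Lemma inflf_comp v f : inflf e w (inflf e v f) = inflf e (w + v) f.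
Proof.
rewrite /inflf LderivD LderivZ mulrDr scalerDr.
rewrite (mulrC w (e *: _)) -scale_laurentAl scale_ee addr0 mulrDl scalerDr.
by rewrite -addrA; congr (_ + _); rewrite addrC.
Qed.

Lemma inflf_morph : monoid_morphism (inflf e w).
Proof.
split=> [|f g]; first by rewrite /inflf Lderiv1 mulr0 scaler0 addr0.
rewrite /inflf LderivM !scale_cst; have EE : cst e * cst e = 0 by rewrite -rmorphM ee rmorph0.
by move: (cst e) (ddt f) (ddt g) EE => E f' g' EE; ring: EE.
Qed.
End Infl.

Lemma inflfK e w (ee : e * e = 0) : cancel (inflf e w) (inflf e (- w)).
Proof. by move=> f; rewrite inflf_comp// addNr /inflf mul0r scaler0 addr0. Qed.
Lemma inflfVK e w (ee : e * e = 0) : cancel (inflf e (- w)) (inflf e w).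
Proof. by move=> f; rewrite inflf_comp// addrN /inflf mul0r scaler0 addr0. Qed.

(** The automorphism $1 + e w \partial_t$, where $e^2 = 0$. *)
Definition infl e w (ee : e * e = 0) : laut A :=
  @Laut A (inflf e w) (inflf e (- w)) (inflf_linear e w) (inflf_morph w ee)
    (inflfK w ee) (inflfVK w ee) (contlin_continuous (inflf_contlin e w))
    (contlin_continuous (inflf_contlin e (- w))).

Lemma inflE e w (ee : e * e = 0) f : infl w ee f = f + e *: (w * ddt f). Proof. by []. Qed.

Lemma Dt : ddt (mono A 1) = 1.
Proof. by rewrite deriv_mono subrr mono0 scale1r. Qed.

Lemma infl_t e w (ee : e * e = 0) : infl w ee (mono A 1) = mono A 1 + e *: w.
Proof. by rewrite inflE Dt mulr1. Qed.

Lemma infl_uniq e w (ee : e * e = 0) x : x (mono A 1) = mono A 1 + e *: w -> x = infl w ee.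
Proof. by move=> E; apply: laut_ext_t; rewrite infl_t. Qed.

Lemma inflD e v w (ee : e * e = 0) : infl (v + w) ee = (infl v ee * infl w ee)%g.
Proof. by apply: lautP => f; rewrite laut_mulE [RHS]inflf_comp. Qed.

Lemma inflV e w (ee : e * e = 0) : (infl w ee)^-1%g = infl (- w) ee.
Proof. by apply: lautP. Qed.

Lemma infl_Gpos e w (ee : e * e = 0) : tpow 1 w -> Gpos (infl w ee).
Proof.
move=> Hw; have H v f n : tpow 1 v -> tpow n f -> tpow n (infl v ee f).
  move=> Hv Hf; rewrite inflE; apply: tpowD => //; apply: tpowZ.
  rewrite (_ : n = 1 + (n - 1)); last by lia.
  by apply: tpowM => //; exact: tpow_deriv.
apply: GposP => i; first by apply: H => //; exact: tpow_mono.
by rewrite inflV; apply: H; [exact: tpowN|exact: tpow_mono].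
Qed.

Lemma infl_Gneg e w (ee : e * e = 0) : low 1 w -> Gneg (infl w ee).
Proof.
move=> Hw i; rewrite inflE (addrC (mono A i)) addrK => n le; rewrite coefZ.
have Hd : low i (ddt (mono A i)).
  have lt : i < i + 1 by lia.
  by have := low_deriv (@low_mono A _ _ lt); rewrite addrK.
have := @lowM _ 0 i w (ddt (mono A i)); rewrite !add0r => -> //.
exact: mulr0.
Qed.

(** Quotients are chosen coefficientwise, and as $0$ where both series are known to vanish, so that
    they form a Laurent series. *)
Lemma cong_coef e f g : (forall n, exists q, f n = g n + e * q) ->
  exists w, f = g + e *: w.
Proof.
move=> H; have [a Hf] := tpow_ex f; have [b Hg] := tpow_ex g.
pose q n := if (n < a) && (n < b) then 0 else projT1 (cid (H n)).
have q0 : exists N : int, forall n, n < N -> q n = 0.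
  by exists (Num.min a b) => n lt; rewrite /q ifT//; lia.
exists (Laurent q0); apply: laurentP => n; rewrite coefD coefZ /= /q.
case: ifP => [/andP[l1 l2]|_]; first by rewrite Hf// Hg// mulr0 addr0.
by case: cid.
Qed.

Lemma cong_laut e x y : (forall i n, exists q, y (mono A i) n = x (mono A i) n + e * q) ->
  forall f, exists w, y f = x f + e *: w.
Proof.
move=> H f; apply: cong_coef => n.
have Lc : contlin (fun f => y f - x f).
  split=> [a g h|m].
    by rewrite (laut_linear x) (laut_linear y) scalerBr opprD addrACA.
  have [b Hb] := (laut_contlin x).2 m; have [c Hc] := (laut_contlin y).2 m.
  by exists (Num.max b c) => g Hg; apply: tpowB; [apply: Hc|apply: Hb]; apply: tpow_le Hg; lia.
suff [q Hq] : exists q, (y f - x f) n = e * q.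
  by exists q; rewrite -Hq coefB addrC subrK.
apply: (@contlin_ind _ (fun c => exists q, c = e * q) _ _ _ Lc).
- by exists 0; rewrite mulr0.
- by move=> a b [q ->] [q' ->]; exists (q + q'); rewrite mulrDr.
- move=> i; have [q Hq] := H i n; exists (f i * q).
  by rewrite coefB Hq addrAC subrr add0r mulrCA.
Qed.

Lemma cong_inflr e (ee : e * e = 0) x y :
  (forall i n, exists q, y (mono A i) n = x (mono A i) n + e * q) ->
  exists v, (x^-1 * y)%g = infl v ee.
Proof.
move=> /cong_laut /(_ (mono A 1))[w Hw]; exists (x^-1%g w); apply: infl_uniq.
by rewrite laut_mulE Hw lautD lautZ -laut_mulE mulVg.
Qed.

Lemma cong_infll e (ee : e * e = 0) x y :
  (forall i n, exists q, y (mono A i) n = x (mono A i) n + e * q) ->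
  exists v, (y * x^-1)%g = infl v ee.
Proof.
move=> /cong_laut /(_ (x^-1%g (mono A 1)))[w Hw]; exists w; apply: infl_uniq.
by rewrite laut_mulE Hw -laut_mulE mulgV.
Qed.

(** The vector field is determined only up to what $e$ annihilates. Membership in $G_-$ says that
    $e$ annihilates [hi 1 v], which can therefore be dropped. *)
Lemma infl_Gneg_repr e (ee : e * e = 0) v : Gneg (infl v ee) ->
  exists2 v', low 1 v' & infl v ee = infl v' ee.
Proof.
move=> /(_ 1); rewrite infl_t (addrC (mono A 1)) addrK => H; exists (v - hi 1 v);
  first exact: hi_low.
apply: infl_uniq; rewrite infl_t scalerBr; congr (_ + _).
rewrite (_ : e *: hi 1 v = 0) ?subr0//; apply: laurentP => n; rewrite coefZ /=.
by case: leP => [le|_]; [exact: H|rewrite mulr0].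
Qed.

Lemma infl_Gpos_repr e (ee : e * e = 0) v : Gpos (infl v ee) ->
  exists2 v', tpow 1 v' & infl v ee = infl v' ee.
Proof.
move=> Hp; have /(Hp 1) := tpow_mono A (lexx 1); rewrite infl_t => H.
exists (hi 1 v); first exact: hi_tpow.
apply: infl_uniq; rewrite infl_t; congr (_ + _); apply: laurentP => n; rewrite !coefZ /=.
case: leP => [//|lt]; rewrite mulr0; have := H n lt.
by rewrite coefD coef_mono lt_eqF// add0r coefZ.
Qed.

Lemma conj_infl e (ee : e * e = 0) u z :
  exists w, (z^-1 * infl u ee * z)%g = infl w ee.
Proof.
exists (z^-1%g (u * ddt (z (mono A 1)))); apply: infl_uniq.
by rewrite !laut_mulE inflE lautD lautZ -[_ (z _)]laut_mulE mulVg.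
Qed.

End Infinitesimal.

Section InflMorph.
Variables (A B : comPzRingType) (r : {rmorphism A -> B}).
Lemma infl_morph_subproof (e : A) : e * e = 0 -> r e * r e = 0.
Proof. by move=> ee; rewrite -rmorphM ee rmorph0. Qed.
Lemma infl_morph (e : A) (ee : e * e = 0) w :
  base_change r (infl w ee) = infl (map_laurent r w) (infl_morph_subproof ee).
Proof.
apply: infl_uniq; rewrite base_change_mono infl_t.
by apply: laurentP => n; rewrite coefD coefZ /= coefD coefZ rmorphD rmorphM rmorph_nat.
Qed.
End InflMorph.

Section DeformLaut.
Variables (A : comPzRingType) (dd : deformation A).
Implicit Types (x h k : laut A).

Lemma df1_map (f : laurent A) : map_laurent (df1 dd) (map_laurent (dfc dd) f) = f.
Proof. by apply: laurentP => n; exact: df1c. Qed.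
Lemma df0_map (f : laurent A) : map_laurent (df0 dd) (map_laurent (dfc dd) f) = f.
Proof. by apply: laurentP => n; exact: df0c. Qed.
Lemma dftc_map (f : laurent A) :
  map_laurent (dft dd) (map_laurent (dfc dd) f) = map_laurent (dfi dd) (map_laurent (dfc dd) f).
Proof. by apply: laurentP => n; exact: dftc. Qed.

Lemma df1_bc x : base_change (df1 dd) (base_change (dfc dd) x) = x.
Proof. by apply: laut_ext => i; rewrite !base_change_mono df1_map. Qed.
Lemma df0_bc x : base_change (df0 dd) (base_change (dfc dd) x) = x.
Proof. by apply: laut_ext => i; rewrite !base_change_mono df0_map. Qed.
Lemma dftc_bc x :
  base_change (dft dd) (base_change (dfc dd) x) = base_change (dfi dd) (base_change (dfc dd) x).
Proof. by apply: laut_ext => i; rewrite !base_change_mono dftc_map. Qed.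

Lemma dfit_bc (y : laut (dfS dd)) i n : exists q,
  base_change (dft dd) y (mono _ i) n = base_change (dfi dd) y (mono _ i) n + dfe dd * q.
Proof. by rewrite !base_change_mono; exact: dfit. Qed.

Definition defm h (Hh : Gneg h) := twm (dfs dd) (Gneg_morph (dfc dd) Hh).
Definition defp k (Hk : Gpos k) := twp (dfs dd) (Gpos_morph (dfc dd) Hk).

Lemma defm_mono h (Hh : Gneg h) i n :
  defm Hh (mono _ i) n = dfs dd ^+ absz (n - i)%R * dfc dd (h (mono A i) n).
Proof. by apply: etrans (tw_mono _ _ _ i n) _; rewrite base_change_mono. Qed.
Lemma defp_mono k (Hk : Gpos k) i n :
  defp Hk (mono _ i) n = dfs dd ^+ absz (n - i)%R * dfc dd (k (mono A i) n).
Proof. by apply: etrans (tw_mono _ _ _ i n) _; rewrite base_change_mono. Qed.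

Lemma df1_defm h (Hh : Gneg h) : base_change (df1 dd) (defm Hh) = h.
Proof.
apply: laut_ext => i; rewrite base_change_mono; apply: laurentP => n.
by rewrite -[LHS]/(df1 dd (defm Hh (mono _ i) n)) defm_mono rmorphM rmorphXn df1s expr1n mul1r df1c.
Qed.

Lemma df1_defp k (Hk : Gpos k) : base_change (df1 dd) (defp Hk) = k.
Proof.
apply: laut_ext => i; rewrite base_change_mono; apply: laurentP => n.
by rewrite -[LHS]/(df1 dd (defp Hk (mono _ i) n)) defp_mono rmorphM rmorphXn df1s expr1n mul1r df1c.
Qed.

Lemma df0_defm h (Hh : Gneg h) : base_change (df0 dd) (defm Hh) = 1%g.
Proof.
apply: laut_ext => i; rewrite base_change_mono laut1E; apply: laurentP => n.
rewrite -[LHS]/(df0 dd (defm Hh (mono _ i) n)) defm_mono rmorphM rmorphXn df0s df0c;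
  have [->|ne] := eqVneq n i.
  rewrite subrr expr0 mul1r; have := Hh i i (lexx i); rewrite coefB coef_mono eqxx.
  by move/eqP; rewrite subr_eq0 => /eqP.
rewrite expr0n (_ : (_ == 0)%N = false) ?mul0r ?coef_mono ?(negPf ne)//; lia.
Qed.

Lemma df0_defp k (Hk : Gpos k) : forall i, exists c, base_change (df0 dd) (defp Hk) (mono A i)
  = c *: mono A i.
Proof.
move=> i; exists (k (mono A i) i); rewrite base_change_mono; apply: laurentP => n.
rewrite -[LHS]/(df0 dd (defp Hk (mono _ i) n)) defp_mono rmorphM rmorphXn df0s df0c coefZ;
  have [->|ne] := eqVneq n i.
  by rewrite subrr expr0 mul1r coef_mono eqxx mulr1.
by rewrite coef_mono (negPf ne) mulr0 expr0n (_ : (_ == 0)%N = false) ?mul0r//; lia.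
Qed.

Lemma Gneg_defm h (Hh : Gneg h) : Gneg (defm Hh). Proof. exact: Gneg_twm. Qed.
Lemma Gpos_defp k (Hk : Gpos k) : Gpos (defp Hk). Proof. exact: Gpos_twp. Qed.

(** The infinitesimal factor stands on the right here and on the left in [dft_defp]: the deformed
    $h$ is a second argument and the deformed $k$ a first one, and the cocycle identity splits off
    the outer factor. *)
Lemma dft_defm h (Hh : Gneg h) : exists2 v, low 1 v &
  base_change (dft dd) (defm Hh) = (base_change (dfi dd) (defm Hh) * infl v (dfee dd))%g.
Proof.
have [v Hv] := cong_inflr (dfee dd) (@dfit_bc (defm Hh)).
have [|v' Hv' Ev] := @infl_Gneg_repr _ _ (dfee dd) v.
  by rewrite -Hv; apply: GnegM; [apply/GnegV|]; apply/Gneg_morph/Gneg_defm.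
by exists v'; rewrite // -Ev -Hv mulVKg.
Qed.

Lemma dft_defp k (Hk : Gpos k) : exists2 u, tpow 1 u &
  base_change (dft dd) (defp Hk) = (infl u (dfee dd) * base_change (dfi dd) (defp Hk))%g.
Proof.
have [v Hv] := cong_infll (dfee dd) (@dfit_bc (defp Hk)).
have [|v' Hv' Ev] := @infl_Gpos_repr _ _ (dfee dd) v.
  by rewrite -Hv; apply: GposM; [|apply/GposV]; apply/Gpos_morph/Gpos_defp.
by exists v'; rewrite // -Ev -Hv mulgVK.
Qed.
End DeformLaut.

(** * Invariance of the pairing under automorphisms *)

Section Invariance.
Variable A : comPzRingType.
Hypothesis QA : isQ A.
Implicit Types (U V P Q : units (laurent A)) (x y z h k : laut A) (l : laurent A).

Lemma nilp_sq0 (R : comPzRingType) (a : R) : a * a = 0 -> nilpotent a.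
Proof. by move=> aa; exists 2%N. Qed.

Lemma scale_sq0 e l : e * e = 0 -> nilpotent (e *: l).
Proof.
move=> ee; apply: nilp_sq0; rewrite -scale_laurentAl mulrC -scale_laurentAl.
by rewrite scalerA ee scale0r.
Qed.

Lemma exp_scale e (ee : e * e = 0) l : exp (e *: l) = 1 + e *: l.
Proof.
apply: exp_sq; first exact: isQ_laurent.
by rewrite -scale_laurentAl mulrC -scale_laurentAl scalerA ee scale0r.
Qed.

Lemma lact_infl e w (ee : e * e = 0) P :
  lact (infl w ee) P = (P * eU QA (@scale_sq0 e (w * dlog P)%R ee))%g.
Proof.
apply: unitsP; rewrite /= exp_scale// mulrDr mulr1; congr (_ + _).
rewrite (mulrC (uval P)) -scale_laurentAl; congr (_ *: _).
by rewrite /dlog -!mulrA uvalKV mulr1.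
Qed.

Definition unit0 P := tpow 0 (uval P) /\ tpow 0 (uinv P).

Lemma unit0_Gpos k P : Gpos k -> unit0 P -> unit0 (lact k P).
Proof. by move=> Hk [H1 H2]; split; apply/Hk. Qed.

(** The automorphism multiplies $P$ by $\exp(e\,w\,P'/P)$, and $Q$ likewise. The two changes of the
    pairing are $\pm e\operatorname{res}(w\,(P'/P)(Q'/Q))$ and cancel. *)
Lemma cca_infl z e w (ee : e * e = 0) P Q : unit0 P -> unit0 Q ->
  cca (lact z (lact (infl w ee) P)) (lact z (lact (infl w ee) Q)) = cca (lact z P) (lact z Q).
Proof.
move=> [P1 P2] [Q1 Q2]; have WP := isW_unit QA P1 P2; have WQ := isW_unit QA Q1 Q2.
rewrite !lact_infl !lactM.
set a := scale_sq0 (w * dlog P) ee; set b := scale_sq0 (w * dlog Q) ee.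
have Wa := isW_eU QA a; have Wb := isW_eU QA b.
have Wz U : isW U -> isW (lact z U) by exact: isW_lact.
rewrite ccaMl ?ccaMr//; try by apply: Wz.
rewrite !cca_eU_lact// [cca (lact z P) (lact z (eU QA b))]ccaC cca_eU_lact//.
rewrite !cca_eU// dlog_eU -!scale_laurentAl LderivZ.
rewrite (mulrC (w * dlog P) (e *: _)) -scale_laurentAl !resZ mulrA ee mul0r addr0.
by rewrite mulrAC subrK.
Qed.

Lemma cca_unit0 P Q : unit0 P -> unit0 Q -> cca P Q = 0.
Proof. by move=> [P1 P2] [Q1 Q2]; exact: (cca_unit QA). Qed.

Lemma isW_unit0 P : unit0 P -> isW P.
Proof. by move=> [P1 P2]; exact: (isW_unit QA). Qed.
End Invariance.

Lemma unit0_map (A B : comPzRingType) (r : {rmorphism A -> B}) (P : units (laurent A)) :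
  unit0 P -> unit0 (mapU r P).
Proof. by move=> [H1 H2]; split; exact: tpow_map. Qed.

Section PairingInvariance.
Variable A : comPzRingType.
Hypothesis QA : isQ A.
Implicit Types (U V P Q : units (laurent A)) (x y z h k : laut A) (l : laurent A).

Lemma mapU_comp1 (dd : deformation A) U : mapU (df1 dd) (mapU (dfc dd) U) = U.
Proof. by apply: unitsP; exact: df1_map. Qed.
Lemma mapU_comp0 (dd : deformation A) U : mapU (df0 dd) (mapU (dfc dd) U) = U.
Proof. by apply: unitsP; exact: df0_map. Qed.
Lemma mapU_ti (dd : deformation A) U :
  mapU (dft dd) (mapU (dfc dd) U) = mapU (dfi dd) (mapU (dfc dd) U).
Proof. by apply: unitsP; exact: dftc_map. Qed.

(** Without logarithms of $P$ and $Q$, the invariance of residues does not apply. Instead $h$ is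
    joined to $1$ by scaling; [cca_infl] shows that the pairing does not vary, and at $1$ it
    vanishes. *)
Lemma cca_Gneg h P Q : Gneg h -> unit0 P -> unit0 Q -> cca (lact h P) (lact h Q) = 0.
Proof.
move=> Hh HP HQ; pose dd := deform QA.
have QS : isQ (dfS dd) := isQ_morph (dfc dd) QA.
have QT : isQ (dfT dd) := isQ_morph (dfi dd) QS.
pose hs := defm dd Hh; pose Ps := mapU (dfc dd) P; pose Qs := mapU (dfc dd) Q.
have HPs : unit0 Ps by exact: unit0_map.
have HQs : unit0 Qs by exact: unit0_map.
have WP : isW (lact hs Ps) by apply: (isW_lact QS); exact: (isW_unit0 QS).
have WQ : isW (lact hs Qs) by apply: (isW_lact QS); exact: (isW_unit0 QS).
pose G := cca (lact hs Ps) (lact hs Qs).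
have E : dft dd G = dfi dd G.
  rewrite -!(cca_map _ QS)// -!lact_map !mapU_ti.
  have [v _ ->] := dft_defm dd Hh; rewrite !lact_mul (cca_infl QT)//.
    exact: unit0_map.
  exact: unit0_map.
have := df_const E; rewrite -!(cca_map _ QS)// -!lact_map df0_defm df1_defm.
rewrite !mapU_comp1 !mapU_comp0 => <-.
have l1 U : lact 1%g U = U by exact: unitsP.
by rewrite !l1; exact: cca_unit0.
Qed.

(** Exponential factors are split off and handled by the invariance of residues. For two unit power
    series, the $G_+$ factor of $x$ keeps them so, and [cca_Gneg] treats the $G_-$ factor. *)
Lemma cca_lact x U V : isW U -> isW V -> cca (lact x U) (lact x V) = cca U V.
Proof.
move=> HU HV; have [l [nl _ [P [P1 P2 EU]]]] := HU; have [m [nm _ [Q [Q1 Q2 EV]]]] := HV.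
have -> : U = (eU QA nl * P)%g by exact: unitsP.
have -> : V = (eU QA nm * Q)%g by exact: unitsP.
have WP := isW_unit QA P1 P2; have WQ := isW_unit QA Q1 Q2.
have Wl := isW_eU QA nl; have Wm := isW_eU QA nm.
have Wx U' : isW U' -> isW (lact x U') by exact: isW_lact.
have PQ : cca (lact x P) (lact x Q) = cca P Q.
  have HP : unit0 P by []; have HQ : unit0 Q by [].
  rewrite [RHS]cca_unit0//; have [Hm Hp ->] := facP x; rewrite !lact_mul.
  by apply: cca_Gneg => //; exact: unit0_Gpos.
rewrite !lactM !ccaMl ?ccaMr//; do ?[exact: Wx|exact: isWM|apply: isWM; exact: Wx].
rewrite PQ !cca_eU_lact// ![cca _ (lact x (eU QA nm))]ccaC cca_eU_lact// -ccaC.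
by [].
Qed.

(** $\widetilde\varphi'$ *)
Lemma jac_subproof x : ddt (tilde x) * x (ddt (tilde x^-1%g)) = 1.
Proof.
rewrite -chain_rule /tilde -laut_mulE mulgV laut1E.
exact: Dt.
Qed.
Definition jac x : units (laurent A) := Units (jac_subproof x).

Lemma jacM x y : jac (x * y)%g = (jac x * lact x (jac y))%g.
Proof. by apply: unitsP; rewrite /= -chain_rule. Qed.

Lemma jac1 : jac 1%g = 1%g.
Proof. by apply: unitsP; exact: Dt. Qed.

Lemma isW_jac x : isW (jac x).
Proof.
have [u xu] := laut_tilde_unit x; apply: (@isW_coef _ QA _ u).
  move=> n lt; rewrite /= -mulrzr; apply: nilpMr.
  by apply: laut_tilde_nilS; lia.
by rewrite /= add0r mulr1z mulrC.
Qed.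

Definition bcoc x y : A := cca (jac x) (lact x (jac y)).

Lemma bcoc_nilp x y : nilpotent (bcoc x y).
Proof. by apply: cca_nilp; [exact: isW_jac|apply: isW_lact => //; exact: isW_jac]. Qed.

Lemma bottE x y : bott x y = eu QA (bcoc x y).
Proof. by rewrite -(CC_val QA) //; [exact: isW_jac|apply: isW_lact => //; exact: isW_jac]. Qed.

(** By the chain rule [jac] is a crossed homomorphism; its cup square under an invariant
    bimultiplicative pairing is a cocycle. *)
Lemma bcoc_cocycle x y z :
  bcoc x y + bcoc (x * y)%g z = bcoc y z + bcoc x (y * z)%g.
Proof.
have Wj := isW_jac; have Wx u U : isW U -> isW (lact u U) by exact: isW_lact.
have W1 := Wj x; have W2 := Wx x _ (Wj y); have W3 := Wx x _ (Wx y _ (Wj z)).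
rewrite /bcoc !jacM lactM (ccaMl QA)// (ccaMr QA)// lact_mul.
rewrite [cca (lact x (jac y)) (lact x _)](cca_lact x (Wj y) (Wx y _ (Wj z))).
by ring.
Qed.

Lemma bcoc1l y : bcoc 1%g y = 0.
Proof.
rewrite /bcoc jac1 /cca (lamE QA (_ : Wdec 1%g 0)).
  by rewrite /dlog Lderiv1 !(mul0r, mulr0) subrr.
by apply: (Wdec_unit QA); exact: tpow1.
Qed.

Lemma bcoc1r x : bcoc x 1%g = 0.
Proof.
have -> : bcoc x 1%g = cca (jac x) 1%g.
  by rewrite /bcoc jac1; congr cca; apply: unitsP; exact: laut1r.
rewrite ccaC /cca (lamE QA (_ : Wdec 1%g 0)).
  by rewrite /dlog Lderiv1 !(mul0r, mulr0) subrr oppr0.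
by apply: (Wdec_unit QA); exact: tpow1.
Qed.

Definition lowU U := low 0 (uval U - 1).

Lemma lowU_Wdec U : isW U -> lowU U -> uval U = exp (lam U).
Proof.
move=> HU H; have [nl Hl [P [P1 P2 E]]] := lamP HU.
have EP : uval P = exp (- lam U) * uval U.
  by rewrite E mulrA expNr ?mul1r//; exact: isQ_laurent.
suff P1' : uval P = 1 by rewrite E P1' mulr1.
apply/eqP; rewrite -subr_eq0; apply/eqP/(@low_tpow0 _ 0); last by apply: tpowB => //; exact: tpow1.
have Hn : low 0 (exp (- lam U) - 1).
  by apply: (low_exp QA); [exact: nilpN|exact: lowN].
have -> : uval P - 1 = (exp (- lam U) - 1) * (uval U - 1) + (exp (- lam U) - 1) + (uval U - 1).
  by rewrite EP; ring.
apply: lowD => //; apply: lowD => //; rewrite -(addr0 (0 : int)); apply: lowM => //.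
by apply: low_le Hn.
Qed.

(** Both are exponentials of series in negative powers, and the residue of one such series times the
    derivative of another is zero. *)
Lemma cca_lowU U V : isW U -> isW V -> lowU U -> lowU V -> cca U V = 0.
Proof.
move=> HU HV LU LV.
have [nl Hl _] := lamP HU; have [nm Hm _] := lamP HV.
have EU : U = eU QA nl by apply: unitsP; exact: lowU_Wdec.
have EV : V = eU QA nm by apply: unitsP; exact: lowU_Wdec.
have dU : dlog U = ddt (lam U) by rewrite {1}EU dlog_eU.
have dV : dlog V = ddt (lam V) by rewrite {1}EV dlog_eU.
rewrite /cca dU dV.
have H l n : low 0 l -> low 0 n -> res (l * ddt n) = 0.
  by move=> H1 /low_deriv; rewrite sub0r; exact: res_lowM.
by rewrite !H// subrr.
Qed.

Lemma lowU_jac h : Gneg h -> lowU (jac h).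
Proof.
move=> Hh; rewrite /lowU /= -Dt -LderivB -[(0 : int)](subrr 1); apply: low_deriv.
exact: Hh.
Qed.

Lemma lowU_lact h U : Gneg h -> lowU U -> lowU (lact h U).
Proof.
by move=> Hh HU; rewrite /lowU /= -(laut1r h) -lautB; exact: Gneg_low'.
Qed.

Lemma bcoc_Gneg h h' : Gneg h -> Gneg h' -> bcoc h h' = 0.
Proof.
move=> H H'; apply: cca_lowU; [exact: isW_jac|apply: isW_lact => //;
  exact: isW_jac|exact: lowU_jac|].
by apply: lowU_lact => //; exact: lowU_jac.
Qed.

Lemma unit0_jac k : Gpos k -> unit0 (jac k).
Proof.
move=> Hk; split; first by apply/tpow0_deriv/Hk; exact: tpow_mono.
by apply/Hk/tpow0_deriv/(GposV Hk); exact: tpow_mono.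
Qed.

Lemma bcoc_Gpos k k' : Gpos k -> Gpos k' -> bcoc k k' = 0.
Proof. by move=> H H'; apply: cca_unit0 => //; [|apply: unit0_Gpos => //]; exact: unit0_jac. Qed.

End PairingInvariance.

Section BcocMorph.
Variables (A B : comPzRingType) (r : {rmorphism A -> B}).
Hypothesis QA : isQ A.
Lemma jac_map (x : laut A) : jac (base_change r x) = mapU r (jac x).
Proof. apply: unitsP; rewrite -[LHS]/(ddt (base_change r x (mono B 1))).
by rewrite base_change_mono map_deriv. Qed.
Lemma bcoc_map (x y : laut A) : bcoc (base_change r x) (base_change r y) = r (bcoc x y).
Proof.
rewrite /bcoc !jac_map lact_map (cca_map _ QA)//; first exact: isW_jac.
by apply: isW_lact => //; exact: isW_jac.
Qed.
End BcocMorph.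

(** * Comparison of the two cocycles *)

Section Beta.
Variable A : comPzRingType.
Hypothesis QA : isQ A.
Implicit Types (U V P Q : units (laurent A)) (x y z h k g : laut A) (l : laurent A).

(** With the coboundary of [beta] added, [bcoc] vanishes on
    $G_- \times \mathcal G$ and on $\mathcal G \times G_+$, as $D$ does. *)
Definition beta x : A := bcoc (fac x).1 (fac x).2.
Definition bp x y : A := bcoc x y + beta x + beta y - beta (x * y)%g.

Lemma beta_nilp x : nilpotent (beta x). Proof. exact: bcoc_nilp. Qed.
Lemma bp_nilp x y : nilpotent (bp x y).
Proof.
by apply: nilpB; [apply: nilpD; [apply: nilpD; [exact: bcoc_nilp|]|]|]; exact: beta_nilp.
Qed.

Lemma bp_cocycle x y z : bp x y + bp (x * y)%g z = bp y z + bp x (y * z)%g.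
Proof.
rewrite /bp -mulgA.
transitivity ((bcoc x y + bcoc (x * y)%g z) + (beta x + beta y + beta z - beta (x * (y * z))%g)).
  by ring.
by rewrite (bcoc_cocycle QA); ring.
Qed.

Lemma facE_Gneg h : Gneg h -> fac h = (h, 1%g).
Proof. by move=> Hh; rewrite -[in LHS](mulg1 h) facE//; exact: Gpos1. Qed.
Lemma facE_Gpos k : Gpos k -> fac k = (1%g, k).
Proof. by move=> Hk; rewrite -[in LHS](mul1g k) facE//; exact: Gneg1. Qed.

Lemma beta_Gneg h : Gneg h -> beta h = 0.
Proof. by move=> Hh; rewrite /beta facE_Gneg//= bcoc1r. Qed.
Lemma beta_Gpos k : Gpos k -> beta k = 0.
Proof. by move=> Hk; rewrite /beta facE_Gpos//= bcoc1l. Qed.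

Lemma bp_fac h k : Gneg h -> Gpos k -> bp h k = 0.
Proof.
by move=> Hh Hk; rewrite /bp beta_Gneg// beta_Gpos// /beta facE//= !addr0 subrr.
Qed.

(** With $g=mp$, the cocycle identity for $h,m,p$ reduces the claim to [bp h m], all of whose terms
    vanish because $h$, $m$ and $hm$ lie in $G_-$. *)
Lemma bp_Gneg h g : Gneg h -> bp h g = 0.
Proof.
move=> Hh; have [Hm Hp ->] := facP g; set m := (fac g).1; set p := (fac g).2.
have := bp_cocycle h m p; rewrite (bp_fac (GnegM Hh Hm) Hp) (bp_fac Hm Hp) add0r => <-.
by rewrite addr0 /bp !beta_Gneg//; [rewrite bcoc_Gneg// !addr0 subrr|exact: GnegM].
Qed.

Lemma bp_Gpos g k : Gpos k -> bp g k = 0.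
Proof.
move=> Hk; have [Hm Hp ->] := facP g; set m := (fac g).1; set p := (fac g).2.
have := bp_cocycle m p k; rewrite (bp_fac Hm Hp) (bp_fac Hm (GposM Hp Hk)) add0r addr0 => ->.
by rewrite /bp !beta_Gpos//; [rewrite bcoc_Gpos// !addr0 subrr|exact: GposM].
Qed.

Lemma unitsXM (x y : units A) n : ((x * y) ^+ n = x ^+ n * y ^+ n)%g.
Proof.
elim: n => [|n IH]; first by rewrite !expg0 mulg1.
rewrite !expgS IH !mulgA; congr (_ * _)%g; rewrite -!mulgA; congr (_ * _)%g.
exact: units_mulC.
Qed.

Definition defect x y : units A := ((det_cocycle x y) ^+ 12 * eu QA (- bp x y))%g.

Lemma units_mulACA (x y z t : units A) : ((x * y) * (z * t) = (x * z) * (y * t))%g.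
Proof. by apply: unitsP; rewrite /= mulrACA. Qed.

Lemma defect_cocycle x y z : (defect x y * defect (x * y) z = defect y z * defect x (y * z))%g.
Proof.
rewrite /defect units_mulACA -unitsXM detc_cocycle unitsXM [RHS]units_mulACA; congr (_ * _)%g.
rewrite -!euD; try by apply/nilpN/bp_nilp.
by congr eu; rewrite -!opprD bp_cocycle.
Qed.

Lemma eu0 : eu QA 0 = 1%g.
Proof. by apply: unitsP; rewrite euE ?exp0//; exact: nilp0. Qed.

Lemma defect_low x y : (forall f : laurent A, low 0 f -> low 0 (x f)) -> bp x y = 0 -> defect x
  y = 1%g.
Proof. by move=> H E; rewrite /defect detc_low// E oppr0 eu0 mulg1 expg1n. Qed.

Lemma defect_Gneg h y : Gneg h -> defect h y = 1%g.
Proof. by move=> H; apply: defect_low (bp_Gneg _ H) => f; exact: Gneg_low'. Qed.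

Lemma defect_Gpos x k : Gpos k -> defect x k = 1%g.
Proof. by move=> H; rewrite /defect detc_Gpos// bp_Gpos// oppr0 eu0 mulg1 expg1n. Qed.

Lemma defect_Gnegl h g y : Gneg h -> defect (h * g)%g y = defect g y.
Proof. by move=> H; have := defect_cocycle h g y; rewrite !(defect_Gneg _ H) mul1g mulg1. Qed.

Lemma defect_Gposr x y k : Gpos k -> defect x (y * k)%g = defect x y.
Proof. by move=> H; have := defect_cocycle x y k; rewrite !(defect_Gpos _ H) mul1g mulg1. Qed.

Lemma defect_fac x y : defect x y = defect (fac x).2 (fac y).1.
Proof.
have [Hm Hp E] := facP x; have [Hm' Hp' E'] := facP y.
by rewrite {1}E {1}E' defect_Gnegl// defect_Gposr.
Qed.

Lemma cca_const U V : unit0 U -> ddt (uval U) = 0 -> cca U V = 0.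
Proof.
move=> [H1 H2] DU; rewrite /cca (lamE QA (Wdec_unit QA H1 H2)) mul0r.
by rewrite /(dlog U) DU mul0r mulr0 subrr.
Qed.

Lemma defect_diag x h : Gpos x -> (forall i, exists c, x (mono A i) = c *: mono A i) ->
  Gneg h -> defect x h = 1%g.
Proof.
move=> Hx Hd Hh.
have xlow i (f : laurent A) : low i f -> low i (x f).
  move=> Hf n le; apply: (@contlin_ind _ (fun c => c = 0) _ _ _ (laut_contlin x)) => [//|a b ->
    ->|j].
    exact: addr0.
  have [c ->] := Hd j; rewrite coefZ coef_mono; case: eqP => [<-|_]; last by rewrite !mulr0.
  by rewrite Hf// mul0r.
have [c Ec] := Hd 1.
have Dc : ddt (tilde x) = c *: (1 : laurent A) by rewrite /tilde Ec LderivZ Dt.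
have DDc : ddt (ddt (tilde x)) = 0 by rewrite Dc LderivZ Lderiv1 scaler0.
apply: defect_low; first exact: xlow.
pose h' := (x * h * x^-1)%g.
have Hh' : Gneg h'.
  move=> i; have [a Ea] := Hd i; have [u uP] := laut_diag_unit x i.
  have ua : u * a = 1 by rewrite -[RHS]uP Ea coefZ coef_mono eqxx mulr1.
  have xV : x^-1%g (mono A i) = u *: mono A i.
    have -> : mono A i = x (u *: mono A i) by rewrite lautZ Ea scalerA ua scale1r.
    by rewrite -laut_mulE mulVg laut1E lautZ Ea scalerA ua scale1r.
  rewrite /h' !laut_mulE xV lautZ lautZ.
  have -> : x (h (mono A i)) = x (h (mono A i) - mono A i) + a *: mono A i.
    by rewrite -Ea -lautD subrK.
  rewrite scalerDr scalerA ua scale1r addrK => n le; rewrite coefZ.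
  by rewrite (xlow i) ?mulr0.
have E : (x * h = h' * x)%g by rewrite /h' mulgVK.
rewrite /bp (beta_Gpos Hx) (beta_Gneg Hh) !addr0 /beta E (facE Hh' Hx) [fst _]/= [snd _]/=.
have ux := unit0_jac Hx.
rewrite /bcoc cca_const// sub0r ccaC.
have -> : lact h' (jac x) = jac x.
  by apply: unitsP; rewrite -[LHS]/(h' (ddt (tilde x))) Dc lautZ laut1r -Dc.
by rewrite cca_const// !oppr0.
Qed.

End Beta.

Section BetaMorph.
Variables (A B : comPzRingType) (r : {rmorphism A -> B}).
Hypotheses (QA : isQ A) (QB : isQ B).
Implicit Types x y : laut A.

Lemma beta_map x : beta (base_change r x) = r (beta x).
Proof. by rewrite /beta fac_morph /= bcoc_map. Qed.

Lemma bp_map x y : bp (base_change r x) (base_change r y) = r (bp x y).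
Proof. by rewrite /bp bcoc_map// -base_changeM !beta_map -!rmorphD -rmorphB. Qed.

Lemma units_mapX (u : units A) n : (units_map r (u ^+ n) = (units_map r u) ^+ n)%g.
Proof.
elim: n => [|n IH]; last by rewrite !expgS units_mapM IH.
by apply: unitsP; rewrite /= rmorph1.
Qed.

Lemma eu_map c : nilpotent c -> units_map r (eu QA c) = eu QB (r c).
Proof.
move=> nc; apply: unitsP; rewrite euE; last exact: (nilp_morph r).
by rewrite /= euE// exp_morph.
Qed.

Lemma defect_map x y : defect QB (base_change r x) (base_change r y) = units_map r (defect QA x y).
Proof.
rewrite /defect units_mapM units_mapX detc_morph bp_map -rmorphN eu_map//.
by apply/nilpN/bp_nilp.
Qed.
End BetaMorph.

(** * The quotient at infinitesimal arguments *)

Section InfinitesimalDefect.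
Variable A : comPzRingType.
Hypothesis QA : isQ A.
Implicit Types (u v w f g : laurent A) (c : A).

Lemma hiZ i (a : A) f : hi i (a *: f) = a *: hi i f. Proof. exact: (linearZ_LR (hi i)). Qed.
Lemma hiD i f g : hi i (f + g) = hi i f + hi i g. Proof. exact: (raddfD (hi i)). Qed.
Lemma hiB i f g : hi i (f - g) = hi i f - hi i g. Proof. exact: (raddfB (hi i)). Qed.

Lemma cstM (a b : A) : cst (a * b) = cst a * cst b. Proof. exact: rmorphM. Qed.

Lemma jac_infl e (ee : e * e = 0) w : jac (infl w ee) = eU QA (scale_sq0 (ddt w) ee).
Proof.
apply: unitsP; rewrite -[LHS]/(ddt (infl w ee (mono A 1))) infl_t LderivD Dt LderivZ.
by rewrite [RHS]exp_scale.
Qed.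

Lemma bcoc_infl e d (ee : e * e = 0) (dd : d * d = 0) u v :
  bcoc (infl u ee) (infl v dd) = (e * d) * res (ddt u * ddt (ddt v)).
Proof.
rewrite /bcoc !jac_infl cca_eU//; last by apply: isW_lact => //; exact: isW_eU.
rewrite dlog_lact dlog_eU LderivZ inflE LderivZ.
rewrite -[ddt (tilde _)]/(ddt (infl u ee (mono A 1))) infl_t LderivD Dt LderivZ.
rewrite !scale_cst -resZ scale_cst cstM; congr res.
have EE : cst e * cst e = 0 by rewrite -rmorphM ee rmorph0.
by move: (cst e) (cst d) (ddt u) (ddt (ddt v)) (ddt (ddt (ddt v))) EE => E defect u' v' v'' EE;
  ring: EE.
Qed.

Lemma ed_sq0 (e d : A) : e * e = 0 -> (e * d) * (e * d) = 0.
Proof. by move=> ee; rewrite mulrACA ee mul0r. Qed.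

(** One half of the value is [bcoc]; the other is [beta] of the product, where $u$ and $v$ have
    exchanged places and $\operatorname{res}(v'u'')=-\operatorname{res}(u'v'')$. *)
Lemma bp_infl e d (ee : e * e = 0) (dd : d * d = 0) u v : tpow 1 u -> low 1 v ->
  bp (infl u ee) (infl v dd) = (e * d) * res (ddt u * ddt (ddt v)) *+ 2.
Proof.
move=> Hu Hv; have Hx := infl_Gpos ee Hu; have Hy := infl_Gneg dd Hv.
rewrite /bp beta_Gpos// beta_Gneg// !addr0.
(* The commutator of $u\partial_t$ and $v\partial_t$ is the cost of exchanging the factors; [ka] is
   absorbed by $G_+$ and [eta] by $G_-$. *)
pose w := u * ddt v - v * ddt u; pose ka := hi 1 w; pose eta := w - ka.
have Heta : low 1 (v + e *: eta).
  by apply: lowD => // n le; rewrite coefZ (@hi_low _ 1 w)// mulr0.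
have Hka : tpow 1 (u + d *: ka) by apply: tpowD => //; apply/tpowZ/hi_tpow.
have EE : cst e * cst e = 0 by rewrite -rmorphM ee rmorph0.
have DD : cst d * cst d = 0 by rewrite -rmorphM dd rmorph0.
have E : (infl u ee * infl v dd = infl (v + e *: eta) dd * infl (u + d *: ka) ee)%g.
  apply: laut_ext_t; rewrite !laut_mulE !infl_t !inflE !LderivD !LderivZ !Dt LderivD LderivZ.
  have Ew : eta = u * ddt v - v * ddt u - ka by [].
  rewrite Ew !scale_cst.
  move: (cst e) (cst d) (ddt u) (ddt v) (ddt ka) (mono A 1) EE DD => e' d' u' v' k' t EE DD.
  by ring: EE DD.
rewrite /beta E facE//=; last exact: infl_Gpos.
  rewrite !bcoc_infl.
  have -> : res (ddt (v + e *: eta) * ddt (ddt (u + d *: ka))) =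
     res (ddt v * ddt (ddt u)) + e * res (ddt eta * (ddt (ddt u) + d *: ddt (ddt ka))) + d *
       res (ddt v * ddt (ddt ka)).
    rewrite !(LderivD, LderivZ) -!resZ -!resD; congr res.
    by rewrite !scale_cst; ring.
  have R : res (ddt v * ddt (ddt u)) = - res (ddt u * ddt (ddt v)).
    apply/eqP; rewrite -addr_eq0 -resD (mulrC (ddt v)) (mulrC (ddt u)) addrC.
    by rewrite -(mulrC (ddt u)) addrC -LderivM res_deriv.
  rewrite R; move: (res _) (res _) (res _) => r1 r2 r3.
  by ring: ee dd.
exact: infl_Gneg.
Qed.

(** $d_x d_y d_{xy}^{-1} = 1 + ed\,S$ for $x = 1 + eu\partial_t$ and
    $y = 1 + dv\partial_t$. *)
Definition Sop u v f := - hi 0 (u * ddt (v * ddt f - hi 0 (v * ddt f))).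

Lemma SopZ u v a f : Sop u v (a *: f) = a *: Sop u v f.
Proof.
rewrite /Sop LderivZ (mulrC v) -scale_laurentAl (mulrC (ddt f)).
rewrite hiZ -scalerBr LderivZ (mulrC u) -scale_laurentAl (mulrC _ u).
by rewrite hiZ scalerN.
Qed.

(** $d_xd_y$ and $d_{xy}$ differ only by what $x$ brings back to $A[[t]]$ from the negative part of
    $y(g)$, a multiple of $ed$. In this term $g=d_{xy}^{-1}f$ may be replaced by $f$, since
    $edf=edg$. *)
Lemma Tdet_infl e d (ee : e * e = 0) (dd : d * d = 0) u v f : tpow 0 f ->
  Tdet (infl u ee) (infl v dd) f = f + (e * d) *: Sop u v f.
Proof.
move=> Hf; set x := infl u ee; set y := infl v dd.
have EE : cst e * cst e = 0 by rewrite -rmorphM ee rmorph0.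
have DD : cst d * cst d = 0 by rewrite -rmorphM dd rmorph0.
pose g := dinv (x * y)%g f; have Hg : tpow 0 g by exact: (dinv_op _).2.
have Ef : f = hi 0 (x (y g)) by rewrite -laut_mulE -dmapE dmapVK.
have E1 : (e * d) *: f = (e * d) *: g.
  rewrite {1}Ef -hiZ -[RHS](@hi_id _ 0); last exact: tpowZ.
  congr (hi 0 _); rewrite /y /x !inflE LderivD LderivZ !scale_cst cstM.
  move: (cst e) (cst d) (ddt g) (ddt (v * ddt g)) EE DD => E defect g' w EE DD.
  by ring: EE DD.
rewrite -SopZ E1 SopZ; rewrite /Tdet -/g.
have -> : dmap y g = y g - d *: (v * ddt g - hi 0 (v * ddt g)).
  rewrite dmapE /y inflE hiD (hi_id Hg) hiZ.
  by rewrite scalerBr; move: (d *: _) (d *: _) => p q; ring.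
set l := v * ddt g - hi 0 (v * ddt g).
have Hl : hi 0 l = 0 by rewrite /l hi_eq0//; exact: hi_low.
rewrite dmapE lautB lautZ hiB -Ef; congr (_ + _).
rewrite /x inflE scalerDr hiD !hiZ Hl scaler0 add0r.
by rewrite scalerA (mulrC d) /Sop scalerN.
Qed.

Definition tau u v n : A := \sum_(i < n) Sop u v (mono A i%:Z) i%:Z.

Lemma detc_infl e d (ee : e * e = 0) (dd : d * d = 0) u v : exists n0, forall n, (n0 <= n)%N ->
  uval (det_cocycle (infl u ee) (infl v dd)) = 1 + (e * d) * tau u v n.
Proof.
have [n0 Hn0] := Tdet_fix (infl u ee) (infl v dd); exists n0 => n le.
rewrite (isdetE (detc_spec _ _) (fixn_le le Hn0)) /detn.
pose M : 'M[A]_n := \matrix_(i, j) Sop u v (mono A j%:Z) i%:Z.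
have -> : \matrix_(i < n, j < n) Tdet (infl u ee) (infl v dd) (mono A j%:Z) i%:Z =
    1%:M + (e * d) *: M.
  apply/matrixP => i j; rewrite !mxE Tdet_infl; last exact: tpow_mono.
  by rewrite coefD coefZ coef_mono.
rewrite det_add1_sq0; last exact: ed_sq0.
by congr (1 + _ * _); apply: eq_bigr => i _; rewrite mxE.
Qed.

Lemma SopDv u v v' f : Sop u (v + v') f = Sop u v f + Sop u v' f.
Proof.
rewrite /Sop -opprD -hiD -mulrDr -LderivD; congr (- hi 0 (_ * ddt _)).
by rewrite mulrDl hiD opprD addrACA.
Qed.

Lemma SopZv u v a f : Sop u (a *: v) f = a *: Sop u v f.
Proof.
rewrite /Sop -scale_laurentAl hiZ -scalerBr LderivZ.
by rewrite (mulrC u) -scale_laurentAl (mulrC _ u) hiZ scalerN.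
Qed.

Lemma tauD u v v' n : tau u (v + v') n = tau u v n + tau u v' n.
Proof. by rewrite /tau -big_split /=; apply: eq_bigr => i _; rewrite SopDv coefD. Qed.
Lemma tauZ u v a n : tau u (a *: v) n = a * tau u v n.
Proof. by rewrite /tau mulr_sumr; apply: eq_bigr => i _; rewrite SopZv coefZ. Qed.

(** The upper limit is independent of $c$ for the sake of the induction; $m=c$ gives $c^3-c$. *)
Lemma sum_jc (c m : nat) :
  (\sum_(j < m) (j%:Z * (c%:Z - j%:Z))) * 6 = m%:Z * (m%:Z - 1) * (3 * c%:Z - 2 * m%:Z + 1).
Proof.
elim: m => [|m IH]; first by rewrite big_ord0 !mul0r.
by rewrite big_ord_recr mulrDl IH intS; ring.
Qed.

(** $v\partial_t$ maps $t^j$ to $jt^{j-c}$, whose negative part is nonzero only for $j<c$;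
    $u\partial_t$ returns from there to $t^j$ through the coefficient of $t^{c+1}$ in $u$. *)
Lemma Sop_mono u (c j : nat) :
  Sop u (mono A (1 - c%:Z)) (mono A j%:Z) j%:Z =
  if (j < c)%N then (j%:Z * (c%:Z - j%:Z))%:~R * u (c%:Z + 1) else 0.
Proof.
rewrite /Sop deriv_mono (mulrC (mono A (1 - _))) -scale_laurentAl -monoD.
have -> : j%:Z - 1 + (1 - c%:Z) = j%:Z - c%:Z by ring.
set m := j%:Z - c%:Z; case: ifP => lt.
  rewrite [hi 0 (_ *: _)]hi_eq0 ?subr0; last first.
    have lm : m < 0 by rewrite /m; lia.
    by move=> n le; rewrite coefZ (@low_mono A m 0 lm n le) mulr0.
  rewrite LderivZ deriv_mono scalerA (mulrC u) -scale_laurentAl coefN (mulrC (mono A _)) /=.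
  rewrite coefZ coefMmono -mulNr -intrM -mulrNz; congr (_%:~R * u _).
    by rewrite /m; ring.
  by rewrite /m; ring.
rewrite [hi 0 (_ *: _)]hi_id ?subrr ?raddf0 ?mulr0; last first.
  by apply/tpowZ/tpow_mono; rewrite /m; lia.
by rewrite hi_id// oppr0.
Qed.

(** On the right, $v''=c(c-1)t^{-c-1}$ meets the term $(c+1)u_{c+1}t^c$ of $u'$, which gives the
    integer $c^3-c$ of [sum_jc]. *)
Lemma tau_mono u (c n : nat) : (c <= n)%N ->
  tau u (mono A (1 - c%:Z)) n *+ 6 = res (ddt u * ddt (ddt (mono A (1 - c%:Z)))).
Proof.
move=> le; rewrite /tau; under eq_bigr => j _ do rewrite Sop_mono.
have -> : \sum_(j < n) (if (j < c)%N then (j%:Z * (c%:Z - j%:Z))%:~R * u (c%:Z + 1) else 0) =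
   (\sum_(j < c) (j%:Z * (c%:Z - j%:Z)))%:~R * u (c%:Z + 1).
  rewrite rmorph_sum mulr_suml -big_mkcond.
  by rewrite (big_ord_widen _ (fun j : nat => (j%:Z * (c%:Z - j%:Z))%:~R * u (c%:Z + 1)) le).
have -> : (\sum_(j < c) (j%:Z * (c%:Z - j%:Z)))%:~R * u (c%:Z + 1) *+ 6 =
    ((\sum_(j < c) (j%:Z * (c%:Z - j%:Z))) * 6)%:~R * u (c%:Z + 1).
  by rewrite intrM -mulrnAl -mulr_natr.
rewrite sum_jc deriv_mono LderivZ deriv_mono scalerA (mulrC (ddt u)) -scale_laurentAl resZ.
rewrite (mulrC (mono A _)) /res coefMmono -intrM.
have -> : -1 - (1 - c%:Z - 1 - 1) = c%:Z by ring.
rewrite derivE -[u _ *~ _]mulrzr mulrCA -intrM mulrC; congr (_ * _%:~R).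
by ring.
Qed.

Lemma tau_res u v : low 1 v -> exists n0, forall n, (n0 <= n)%N ->
  tau u v n *+ 6 = res (ddt u * ddt (ddt v)).
Proof.
move=> Hv; have [a Ha] := tpow_ex v; pose K := absz (Num.max 1 a - a)%R.
have Ev : v = \sum_(i <- iv a K) v i *: mono A i.
  apply/eqP; rewrite -subr_eq0; apply/eqP/(@low_tpow0 _ (Num.max 1 a)); last first.
    by have := trunc_tpow (K := K) Ha; apply: tpow_le; rewrite /K; lia.
  apply: lowB; first by apply: low_le Hv; lia.
  apply: low_sum => i; rewrite mem_iv => iK n le.
  have lt : i < Num.max 1 a by rewrite /K in iK; lia.
  by rewrite coefZ (@low_mono A i _ lt n le) mulr0.
exists (absz (1 - a)%R) => n le; rewrite Ev.
suff H s : (forall i, i \in s -> a <= i) ->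
    tau u (\sum_(i <- s) v i *: mono A i) n *+ 6 =
    res (ddt u * ddt (ddt (\sum_(i <- s) v i *: mono A i))).
  by apply: H => i; rewrite mem_iv => /andP[].
elim: s => [|i s IH] Hs; rewrite ?big_nil.
  have D0 : ddt (0 : laurent A) = 0 by exact: (raddf0 ddt).
  have -> : tau u 0 n = 0 by rewrite -(scale0r (0 : laurent A)) tauZ mul0r.
  by rewrite D0 D0 mulr0 mul0rn.
rewrite !big_cons tauD tauZ mulrnDl IH => [|j js]; last by apply: Hs; rewrite inE js orbT.
rewrite !LderivD !LderivZ mulrDr resD; congr (_ + _).
rewrite (mulrC (ddt u) (_ *: _)) -scale_laurentAl resZ -mulrnAr; have ai := Hs i (mem_head _ _).
have [le1|gt] := leP i 1; last by rewrite Hv ?mul0r//; lia.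
have -> : i = 1 - (absz (1 - i)%R)%:Z by lia.
rewrite tau_mono; last by lia.
by rewrite (mulrC (ddt u)).
Qed.

Lemma defect_infl e d (ee : e * e = 0) (dd : d * d = 0) u v : tpow 1 u -> low 1 v ->
  defect QA (infl u ee) (infl v dd) = 1%g.
Proof.
move=> Hu Hv; have [n0 H0] := detc_infl ee dd u v; have [n1 H1] := tau_res u Hv.
pose n := maxn n0 n1.
have ED := H0 n (leq_maxl _ _); have ET := H1 n (leq_maxr _ _).
have EX (w : units A) (c : A) m : c * c = 0 -> uval w = 1 + c -> uval (w ^+ m)%g = 1 + c *+ m.
  move=> cc E; elim: m => [|m IH]; first by rewrite expg0 mulr0n addr0.
  rewrite expgS uvalM E IH mulrS mulrDr mulr1 mulrDl mul1r mulrnAr cc mul0rn addr0.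
  by rewrite addrA.
apply: unitsP; rewrite /defect uvalM (EX _ _ _ _ ED); last first.
  by rewrite mulrACA ed_sq0 ?mul0r.
rewrite euE; last by apply/nilpN/bp_nilp.
rewrite (bp_infl ee dd Hu Hv) -ET.
have -> : e * d * tau u v n *+ 12 = e * d * (tau u v n *+ 6) *+ 2 by rewrite mulrnAr -mulrnA.
set c := e * d * _ *+ 2; have cc : c * c = 0.
  by rewrite /c -!mulrnAr mulrACA ed_sq0// mul0r.
rewrite exp_sq//; last by rewrite mulrNN.
by rewrite mulrDl mul1r mulrDr mulr1 mulrN cc oppr0 addr0 subrK.
Qed.
End InfinitesimalDefect.

(** * Triviality of the quotient *)

Section DefectTrivial.
Implicit Types A : comPzRingType.

(** By naturality one element of [dfS] specializes to all four quotients, so [df_const] applies to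
    it. *)
Lemma defect_deform A (QA : isQ A) (dd : deformation A) (QS : isQ (dfS dd)) (QT : isQ (dfT dd))
    (x y : laut (dfS dd)) :
  defect QT (base_change (dft dd) x) (base_change (dft dd) y) =
    defect QT (base_change (dfi dd) x) (base_change (dfi dd) y) ->
  defect QA (base_change (df0 dd) x) (base_change (df0 dd) y) =
    defect QA (base_change (df1 dd) x) (base_change (df1 dd) y).
Proof.
rewrite !(defect_map _ QS) => E; apply: unitsP; apply: df_const.
exact: (congr1 (@uval _) E).
Qed.

Lemma defect_infl_Gneg A (QA : isQ A) (e : A) (ee : e * e = 0) u h :
  tpow 1 u -> Gneg h -> defect QA (infl u ee) h = 1%g.
Proof.
move=> Hu Hh; pose dd := deform QA.
have QS : isQ (dfS dd) := isQ_morph (dfc dd) QA.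
have QT : isQ (dfT dd) := isQ_morph (dfi dd) QS.
have := @defect_deform _ QA dd QS QT (base_change (dfc dd) (infl u ee)) (defm dd Hh).
rewrite df0_defm df1_defm df0_bc df1_bc (defect_Gpos QA _ (@Gpos1 A)).
move=> <- //; rewrite dftc_bc !infl_morph; have [v Hv ->] := dft_defm dd Hh.
set z := base_change (dfi dd) (defm dd Hh); have Hz : Gneg z by apply/Gneg_morph/Gneg_defm.
set ee' := infl_morph_subproof _ _; set X := infl _ ee'.
(* The term with first argument $z\in G_-$ is trivial, so the variation in $s$ is the quotient at
   $Xz$ and the infinitesimal factor. *)
have := defect_cocycle QT X z (infl v (dfee dd)).
rewrite (defect_Gneg QT (infl v (dfee dd)) Hz) mul1g => <-.
suff -> : defect QT (X * z)%g (infl v (dfee dd)) = 1%g by rewrite mulg1.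
(* Moved across $z$, the automorphism $X$ stays infinitesimal; then $z$ and the $G_-$ part of the
   conjugate are dropped on the left. *)
have [w Ew] := conj_infl ee' (map_laurent (dfi dd) (map_laurent (dfc dd) u)) z.
have -> : (X * z = z * (z^-1 * X * z))%g by rewrite !mulgA mulgV mul1g.
rewrite defect_Gnegl// Ew -(subrK (hi 1 w) w) inflD defect_Gnegl; last by apply/infl_Gneg/hi_low.
by apply: defect_infl => //; exact: hi_tpow.
Qed.

Lemma defect_Gpos_Gneg A (QA : isQ A) (k h : laut A) : Gpos k -> Gneg h -> defect QA k h = 1%g.
Proof.
move=> Hk Hh; pose dd := deform QA.
have QS : isQ (dfS dd) := isQ_morph (dfc dd) QA.
have QT : isQ (dfT dd) := isQ_morph (dfi dd) QS.
have := @defect_deform _ QA dd QS QT (defp dd Hk) (base_change (dfc dd) h).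
have E0 : defect QA (base_change (df0 dd) (defp dd Hk)) h = 1%g.
  apply: defect_diag => //; last exact: df0_defp.
  by apply: Gpos_morph; apply: Gpos_defp.
rewrite df1_defp df0_bc df1_bc E0 => E; rewrite -E ?dftc_bc// => {E E0}.
have [u Hu ->] := dft_defp dd Hk.
set z := base_change (dfi dd) (defp dd Hk); have Hz : Gpos z by apply/Gpos_morph/Gpos_defp.
set H := base_change _ _; set X := infl u _.
(* The variation in $s$ is the quotient at $X$ and $zH$, which depends only on the $G_-$ factor of
   $zH$. *)
have := defect_cocycle QT X z H; rewrite (defect_Gpos QT X Hz) mul1g => ->.
suff -> : defect QT X (z * H)%g = 1%g by rewrite mulg1.
have [Hm Hp ->] := facP (z * H)%g; rewrite defect_Gposr//.
exact: defect_infl_Gneg.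
Qed.

Lemma defect_eq1 A (QA : isQ A) (x y : laut A) : defect QA x y = 1%g.
Proof.
by rewrite defect_fac; have [_ Hp _] := facP x; have [Hm _ _] := facP y; exact: defect_Gpos_Gneg.
Qed.

Lemma D12_val A (QA : isQ A) (x y : laut A) :
  (det_cocycle x y ^+ 12 = bott x y * (eu QA (beta x) * eu QA (beta y) * (eu QA (beta (x *
    y)))^-1))%g.
Proof.
have Hb := beta_nilp QA.
have := defect_eq1 QA x y; rewrite /defect euN; last exact: bp_nilp.
move/(congr1 (fun g => g * eu QA (bp x y))%g); rewrite mulgVK mul1g => ->.
rewrite (bottE QA) -(euN QA (Hb _)) -(euD QA (Hb x) (Hb y)).
have Hxy := nilpD (Hb x) (Hb y).
rewrite -(euD QA Hxy (nilpN (Hb (x * y)%g))) -(euD QA (bcoc_nilp QA x y)).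
  by congr eu; rewrite /bp; ring.
by apply: nilpD => //; exact: nilpN.
Qed.

Lemma bott_cocycle A (QA : isQ A) (x y z : laut A) :
  (bott x y * bott (x * y) z = bott y z * bott x (y * z))%g.
Proof.
rewrite !(bottE QA) -!euD; try exact: bcoc_nilp.
by rewrite bcoc_cocycle.
Qed.

(** The choices in [CC] hide naturality, which is read off from the residue formula [bottE]. *)
Lemma bott_map A (B : comPzRingType) (r : {rmorphism A -> B}) (QA : isQ A) (x y : laut A) :
  bott (base_change r x) (base_change r y) = units_map r (bott x y).
Proof.
have QB := isQ_morph r QA; rewrite (bottE QA) (bottE QB) bcoc_map// eu_map//.
exact: bcoc_nilp.
Qed.
End DefectTrivial.

Lemma isQ_rat (A : calg rat) : isQ A.
Proof.
apply: (isQ_morph (calg_str A)) => n; exists (n.+1%:R^-1).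
by rewrite mulVf// pnatr_eq0.
Qed.

(** * From values on points to cohomology classes *)

Section TwoCocycle.
Variables (R : comPzRingType) (G : groupFunctor R) (M : comGroupFunctor R).
Variable c : forall A : calg R, G A -> G A -> M A.
Hypothesis c_natural : forall (A B : calg R) (r : calg_hom A B) x y,
  c (gf_map r x) (gf_map r y) = gf_map r (c x y).
Hypothesis c_cocycle : forall (A : calg R) (x y z : G A),
  (c x y * c (x * y) z = c y z * c x (y * z))%g.

Lemma cochain2_subproof :
  natural (fun A (g : 'I_2 -> G A) => c (g ord0) (g ord_max)).
Proof. by move=> A B r g /=; exact: c_natural. Qed.
Definition cochain2 : cochain G M 2 := Cochain cochain2_subproof.

Lemma cochain2_diff : diff cochain2 = cochain1 G M 3.
Proof.
apply: cochainP => A g; rewrite /= /diff_fun big_ord_recl big_ord1 /alt /= /contract /=.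
have E (i j : 'I_3) : i = j :> nat -> g i = g j by move=> /ord_inj ->.
rewrite (E (lift ord0 ord_max) (lift ord0 (lift ord0 ord0)))//.
set a := g (widen_ord _ ord0); set b := g (lift ord0 ord0).
set d := g (lift ord0 (lift ord0 ord0)).
rewrite (E (widen_ord _ ord_max) (lift ord0 ord0))// -/b.
rewrite (cgf_mulC (_^-1)%g) mulgA -c_cocycle -mulgA -invgM.
exact: mulgV.
Qed.

Definition cocycle2 : cocycle G M 2 := Cocycle cochain2_diff.
End TwoCocycle.

Lemma cohomX_hclass (R : comPzRingType) (G : groupFunctor R) (M : comGroupFunctor R) q
    (c : cocycle G M q) n :
  cohomX (hclass c) n = hclass (iter n (cocycleM c) (cocycle1 G M q)).
Proof. by elim: n => //= n IH; rewrite hclassM -IH. Qed.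

Lemma iter_cocycleM (R : comPzRingType) (G : groupFunctor R) (M : comGroupFunctor R) q
    (c : cocycle G M q) n (A : calg R) (g : 'I_q -> G A) :
  iter n (cocycleM c) (cocycle1 G M q) A g = (c A g ^+ n)%g.
Proof. by elim: n => //= n IH; rewrite IH expgS. Qed.

Lemma beta_natural : @natural rat (LAut rat) (Gm rat) 1
  (fun A g => eu (isQ_rat A) (beta (g ord0))).
Proof.
move=> A B r g; rewrite /= (beta_map r (isQ_rat A)) -(eu_map r (isQ_rat A))//.
exact: beta_nilp (isQ_rat A) _.
Qed.

Theorem theorem5p2 :
  exists D B : cocycle (LAut rat) (Gm rat) 2,
    [/\ forall (A : calg rat) (g : 'I_2 -> laut A),
          D A g = det_cocycle (g ord0) (g ord_max),
        forall (A : calg rat) (g : 'I_2 -> laut A),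
          B A g = bott (g ord0) (g ord_max) &
        cohomX (hclass D) 12 = hclass B].
Proof.
have Dnat (A B : calg rat) (r : calg_hom A B) (x y : laut A) :
    det_cocycle (base_change r x) (base_change r y) = units_map r (det_cocycle x y).
  exact: detc_morph.
have Dcoc (A : calg rat) (x y z : laut A) :
    (det_cocycle x y * det_cocycle (x * y) z = det_cocycle y z * det_cocycle x (y * z))%g.
  exact: detc_cocycle.
have Bnat (A B : calg rat) (r : calg_hom A B) (x y : laut A) :
    bott (base_change r x) (base_change r y) = units_map r (bott x y).
  exact: (bott_map r (isQ_rat A)).
have Bcoc (A : calg rat) (x y z : laut A) :
    (bott x y * bott (x * y) z = bott y z * bott x (y * z))%g.
  exact: (bott_cocycle (isQ_rat A)).
set Dc := @cocycle2 rat (LAut rat) (Gm rat) _ Dnat Dcoc.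
set Bc := @cocycle2 rat (LAut rat) (Gm rat) _ Bnat Bcoc.
exists Dc, Bc; split=> //; rewrite cohomX_hclass; apply/hclassP.
(* By [D12_val] the quotient of the two cocycles is the coboundary of $\exp\beta$; only the order of
   the commuting factors remains to be adjusted. *)
exists (Cochain beta_natural); apply: cochainP => A g.
rewrite -[LHS]/(iter 12 (cocycleM Dc) (cocycle1 _ _ _) A g * (Bc A g)^-1)%g iter_cocycleM.
rewrite -[Dc A g]/(det_cocycle (g ord0) (g ord_max)) -[Bc A g]/(bott (g ord0) (g ord_max)).
rewrite (D12_val (isQ_rat A)) [RHS]/= /diff_fun big_ord1 /alt /= /contract /=.
have E (i j : 'I_2) : i = j :> nat -> g i = g j by move=> /ord_inj ->.
rewrite (E (lift ord0 ord0) ord_max)// (E (widen_ord _ ord0) ord0)//.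
rewrite (units_mulC (bott _ _)) mulgK (units_mulC (eu _ (beta (g ord0)))).
by rewrite -mulgA (units_mulC (eu _ (beta (g ord0)))) mulgA.
Qed.
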